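(* Let $G$ be a finite connected graph with Hermitian edge weights and real potential, and let $\mathcal T$ be its universal cover, with periodic Jacobi operator $A_{\mathcal T}$ and density of states $\mu$. Then for each $\lambda\in\mathbb R$, $$\mu\{\lambda\}=\frac1{|V(G)|}\max_{X\in\mathcal A_\lambda(G)}\big(\mathsf{cc}(X)-|\partial X|\big).$$ Moreover, $\operatorname{Spec}_pA_{\mathcal T}$ may be computed from $G$ in finite time.
   Context: Graphs. A graph $G=(V,E,a,b)$ (self-loops and multi-edges allowed) has a vertex set $V$, a set $E$ of directed edges with a fixed-point-free direction-reversing involution $e\mapsto\check e$, source and terminal maps $\sigma,\tau:E\to V$ with $\sigma(e)=\tau(\check e)$, edge weights $a:E\to\mathbb C$ and potential $b$ on $V$. For a vertex $u$, $\tau(u)$ also denotes the set of directed edges with terminal $u$. Weights and potential are Hermitian: $\overline{a_e}=a_{\check e}$ for all $e$, and $b:V\to\mathbb R$. A non-backtracking walk is a sequence of edges $e_1,\dots,e_\ell$ with $\tau(e_s)=\sigma(e_{s+1})$ and $e_s\ne\check e_{s+1}$ for $1\le s\le \ell-1$. A graph is acyclic if it has no closed non-backtracking walk (so an acyclic graph has no self-loops or multi-edges and its connected components are trees). Universal cover. For $G$ connected, the universal cover $\mathcal T=(\mathcal V,\mathcal E,\mathscr a,\mathscr b)$ is the (unique up to isomorphism) tree covering every cover of $G$; concretely, its vertices are the non-backtracking walks in $G$ starting at a fixed root (including the empty walk), two walks being joined by an edge (in both directions) when one extends the other by one edge. The covering map is $\Xi:\mathcal T\to G$, and $\mathscr a_{\tilde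 e}=a_{\Xi(\tilde e)}$, $\mathscr b_{\tilde v}=b_{\Xi(\tilde v)}$. Jacobi operators. $A_G$ acts on $\ell^2(V)$ by $(A_G\eta)(u)=b_u\eta(u)+\sum_{e\in\tau(u)}a_e\,\eta(\sigma(e))$; $A_{\mathcal T}$ is the bounded self-adjoint operator on $\ell^2(\mathcal V)$ given by the same formula on $\mathcal T$. The induced Jacobi operator of a subgraph is the Jacobi operator of that subgraph with the inherited weights and potential. The point spectrum is $\operatorname{Spec}_pA_{\mathcal T}=\{\lambda\in\mathbb R:\operatorname{Ker}(\lambda-A_{\mathcal T})\ne\{0\}\}$, with kernels in $\ell^2(\mathcal V)$. For $u\in V$, $\mu_u$ is the spectral measure with $\langle\delta_{\tilde u},f(A_{\mathcal T})\delta_{\tilde u}\rangle=\int f\,d\mu_u$ for every $\tilde u\in\Xi^{-1}(u)$ and bounded measurable $f$; the density of states is $\mu=\frac1{|V|}\sum_{u\in V}\mu_u$. For $X\subset V$, the subgraph induced by $X$ contains all edges of $G$ with both ends in $X$; $\mathsf{cc}(X)$ is its number of connected components; $\partial X$ is the set of vertices outside $X$ joined to $X$ by an edge. For $\lambda\in\mathbb R$, $\mathcal A_\lambda(G)$ is the set of all $X\subset V(G)$ which induce an acyclic subgraph, each connected component of which has $\lambda$ in the spectrum of its induced Jacobi operator, and such that $\mathsf{cc}(X)-|\partial X|>0$. The maximum over an empty $\mathcal A_\lambda(G)$ is read as $0$. ''Computed in finite time'' means: there is a procedure which, given $G$ (with its weights and potential), outputs the set $\operatorname{Spec}_pA_{\mathcal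 T}$ after finitely many steps, where the steps are combinatorial operations on finite graphs, exact arithmetic and comparison of real numbers, and computation of the spectrum of a finite Hermitian matrix.
   Formalization: The formula for μ{λ} is stated for nonzero edge weights only; with zero weights it fails (two vertices joined by a weight-0 edge, zero potential: μ{0}=1, right side 1/2). The finite-time computability of the point spectrum is stated for all weights. *)

(* Defs.v *)
From mathcomp Require Import all_boot all_order all_algebra.
From mathcomp Require Import complex.
From mathcomp Require Import all_classical all_reals all_analysis.

Set Implicit Arguments.
Unset Strict Implicit.
Unset Printing Implicit Defensive.

Import Order.TTheory GRing.Theory Num.Theory.
Import numFieldNormedType.Exports.

Local Open Scope classical_set_scope.
Local Open Scope ring_scope.
Local Open Scope complex_scope.

(* Vertex and edge types are arbitrary choice types, so that the same structure
   serves for finite graphs (finite types) and for their universal covers.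
   An undirected edge is a pair [{e, erev e}]. *)
Record wgraph (R : realType) (V E : choiceType) := WGraph {
  src : E -> V;
  tgt : E -> V;
  erev : E -> E;
  weight : E -> R[i];
  pot : V -> R;
  erevK : involutive erev;
  erev_neq : forall e, erev e != e;
  src_erev : forall e, src e = tgt (erev e);
  weight_erev : forall e, (weight e)^* = weight (erev e)
}.

Section Walks.
Variables (R : realType) (V E : choiceType) (G : wgraph R V E).

Definition nbstep : rel E := fun e f => (tgt G e == src G f) && (e != erev G f).

Definition nbwalk (s : seq E) : bool := sorted nbstep s.

Definition nbwalk_from (r : V) (s : seq E) : bool :=
  nbwalk s && (if s is e :: _ then src G e == r else true).

Definition acyclic : Prop :=
  forall (e : E) (s : seq E), nbwalk (e :: s) -> tgt G (last e s) <> src G e.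

End Walks.

Section UniversalCover.
Variables (R : realType) (V E : choiceType) (G : wgraph R V E) (r : V).

Definition uc_vert : Type := {s : seq E | nbwalk_from G r s}.

(* [(s, e, true)] is the edge from the walk [s] to its extension [rcons s e],
   and [(s, e, false)] is the reverse edge. *)
Definition uc_edge : Type :=
  {x : seq E * E * bool | nbwalk_from G r (rcons x.1.1 x.1.2)}.

Lemma nbwalk_from_rcons (s : seq E) (e : E) :
  nbwalk_from G r (rcons s e) -> nbwalk_from G r s.
Proof.
case: s => [|f s] // /andP[]; rewrite /nbwalk_from /nbwalk /= rcons_path.
by move=> /andP[-> _] ->.
Qed.

Definition uc_long (x : uc_edge) : uc_vert :=
  exist _ (rcons (val x).1.1 (val x).1.2) (valP x).

Definition uc_short (x : uc_edge) : uc_vert :=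
  exist _ (val x).1.1 (nbwalk_from_rcons (valP x)).

Definition uc_src (x : uc_edge) : uc_vert :=
  if (val x).2 then uc_short x else uc_long x.

Definition uc_tgt (x : uc_edge) : uc_vert :=
  if (val x).2 then uc_long x else uc_short x.

Definition uc_rev (x : uc_edge) : uc_edge :=
  exist _ ((val x).1, ~~ (val x).2) (valP x).

Definition cover_vert (w : uc_vert) : V := last r (map (tgt G) (val w)).

Definition cover_edge (x : uc_edge) : E :=
  if (val x).2 then (val x).1.2 else erev G (val x).1.2.

Lemma uc_revK : involutive uc_rev.
Proof. by move=> x; apply: val_inj; case: x => [[y b] /= h]; rewrite negbK. Qed.

Lemma uc_rev_neq (x : uc_edge) : uc_rev x != x.
Proof.
apply/eqP => /(congr1 (fun y => (val y).2)) /=.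
by case: (val x).2.
Qed.

Lemma uc_src_rev (x : uc_edge) : uc_src x = uc_tgt (uc_rev x).
Proof.
by case: x => [[[s e] []] h]; apply: val_inj.
Qed.

Lemma uc_weight_rev (x : uc_edge) :
  (weight G (cover_edge x))^* = weight G (cover_edge (uc_rev x)).
Proof.
by rewrite weight_erev /cover_edge /=; case: (val x).2 => //=; rewrite erevK.
Qed.

Definition universal_cover : wgraph R uc_vert uc_edge :=
  @WGraph R uc_vert uc_edge uc_src uc_tgt uc_rev
    (fun x => weight G (cover_edge x)) (fun w => pot G (cover_vert w))
    uc_revK uc_rev_neq uc_src_rev uc_weight_rev.

End UniversalCover.

Section Ell2.
Variables (R : realType) (V : choiceType).
Implicit Types f g : V -> R[i].

Definition normsq (z : R[i]) : R := complex.Re z ^+ 2 + complex.Im z ^+ 2.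

Definition ell2 f : Prop := (\esum_(v in [set: V]) (normsq (f v))%:E < +oo)%E.

Definition ell2_norm f : R :=
  Num.sqrt (fine (\esum_(v in [set: V]) (normsq (f v))%:E)%E).

(* Unconditional sums of absolutely summable families; [\esum] only handles
   nonnegative terms. *)
Definition rsum (h : V -> R) : R :=
  fine (\esum_(v in [set: V]) (Num.max (h v) 0)%:E)%E -
  fine (\esum_(v in [set: V]) (Num.max (- h v) 0)%:E)%E.

Definition csum f : R[i] :=
  (rsum (fun v => complex.Re (f v))) +i* (rsum (fun v => complex.Im (f v))).

Definition inner f g : R[i] := csum (fun v => (f v)^* * g v).

Definition delta (u : V) : V -> R[i] := fun v => (v == u)%:R.

(* Operators on l^2 are represented by maps on all functions; only their
   values on l^2 matter. *)
Definition bound_op (A : (V -> R[i]) -> V -> R[i]) (M : R) : Prop :=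
  forall f, ell2 f -> ell2_norm (A f) <= M * ell2_norm f.

Definition bounded_op (A : (V -> R[i]) -> V -> R[i]) : Prop :=
  [/\ forall f, ell2 f -> ell2 (A f),
      forall (c : R[i]) f g, ell2 f -> ell2 g ->
        A (fun v => c * f v + g v) = (fun v => c * A f v + A g v)
    & exists M : R, bound_op A M].

End Ell2.

Section Jacobi.
Variables (R : realType) (V E : choiceType) (G : wgraph R V E).

(* The sum has finite support when the graph is locally finite. *)
Definition jacobi (f : V -> R[i]) : V -> R[i] := fun u =>
  (pot G u)%:C * f u +
  \sum_(e \in [set e | tgt G e = u]) weight G e * f (src G e).

Definition point_spectrum : set R := [set lam : R |
  exists f : V -> R[i], [/\ ell2 f, f <> (fun=> 0)
    & jacobi f = (fun v => lam%:C * f v)]].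

End Jacobi.

Section FunctionalCalculus.
Variables (R : realType) (V : choiceType).

Definition bounded_measurable (f : R -> R) : Prop :=
  measurable_fun [set: R] f /\ exists M : R, forall x, `|f x| <= M.

(* [Phi f] is [f(A)] for the bounded self-adjoint operator [A] on l^2(V) and
   every bounded Borel function [f : R -> R]. By the spectral theorem there is
   exactly one such [Phi], as far as its values on l^2(V) are concerned. The
   function [x |-> x] is not bounded on the whole line, whence the truncation
   outside of [[-M, M]], which contains the spectrum of [A], in the clause
   [bc_id]. *)
Record borel_calculus (A : (V -> R[i]) -> V -> R[i])
    (Phi : (R -> R) -> (V -> R[i]) -> V -> R[i]) : Prop := BorelCalculus {
  bc_bounded : forall f : R -> R, bounded_measurable f -> bounded_op (Phi f);
  bc_sym : forall f : R -> R, bounded_measurable f -> forall x y, ell2 x -> ell2 y ->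
    inner (Phi f x) y = inner x (Phi f y);
  bc_lin : forall (c : R) f g,
    bounded_measurable f -> bounded_measurable g -> forall x, ell2 x ->
    Phi (fun t => c * f t + g t) x = (fun v => c%:C * Phi f x v + Phi g x v);
  bc_mul : forall f g, bounded_measurable f -> bounded_measurable g ->
    forall x, ell2 x -> Phi (fun t => f t * g t) x = Phi f (Phi g x);
  bc_one : forall x, ell2 x -> Phi (fun=> 1) x = x;
  bc_id : forall (M : R) f, bound_op A M -> bounded_measurable f ->
    (forall t, `|t| <= M -> f t = t) -> forall x, ell2 x -> Phi f x = A x;
  bc_cvg : forall (fn : nat -> R -> R) (f : R -> R) (M : R),
    (forall n, measurable_fun [set: R] (fn n)) ->
    (forall n t, `|fn n t| <= M) ->
    (forall t : R, fn n t @[n --> \oo] --> f t) ->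
    forall x : V -> R[i], ell2 x ->
    ell2_norm (fun v => Phi (fn n) x v - Phi f x v) @[n --> \oo] --> (0 : R)
}.

End FunctionalCalculus.

Section Spectral.
Variables (R : realType) (V E : finType) (G : wgraph R V E) (r : V).

Definition spectral_measures
    (Phi : (R -> R) -> (uc_vert G r -> R[i]) -> uc_vert G r -> R[i])
    (mu : V -> {measure set (measurableTypeR R) -> \bar R}) : Prop :=
  forall (w : uc_vert G r) (f : R -> R), bounded_measurable f ->
    inner (delta R w) (Phi f (delta R w)) =
    (\int[mu (cover_vert w)]_t f t)%:C.

Definition density_of_states
    (mu : V -> {measure set (measurableTypeR R) -> \bar R}) : set R -> \bar R :=
  fun B => ((#|V|%:R^-1)%:E * \sum_(u : V) mu u B)%E.

End Spectral.

Section FiniteSpectrum.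
Variables (R : realType) (V E : finType) (G : wgraph R V E).

Definition jacobi_mx : 'M[R[i]]_#|V| :=
  \matrix_(i, j) jacobi G (delta R (enum_val j)) (enum_val i).

Definition spectrum (lam : R) : bool := eigenvalue jacobi_mx lam%:C.

End FiniteSpectrum.

Section FiniteGraphs.
Variables (R : realType) (V E : finType) (G : wgraph R V E).
Implicit Types X C : {set V}.

Definition adj : rel V :=
  fun u v => [exists e, (src G e == u) && (tgt G e == v)].

Definition gconnected : Prop :=
  (0 < #|V|)%N /\ forall u v, connect adj u v.

Section Induced.
Variable X : {set V}.

Definition ind_vert : Type := {v : V | v \in X}.

Definition ind_edge : Type :=
  {e : E | (src G e \in X) && (tgt G e \in X)}.

Lemma ind_src_subproof (e : ind_edge) : src G (val e) \in X.
Proof. by case/andP: (valP e). Qed.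

Lemma ind_tgt_subproof (e : ind_edge) : tgt G (val e) \in X.
Proof. by case/andP: (valP e). Qed.

Lemma ind_rev_subproof (e : ind_edge) :
  (src G (erev G (val e)) \in X) && (tgt G (erev G (val e)) \in X).
Proof.
by rewrite src_erev erevK -src_erev ind_src_subproof ind_tgt_subproof.
Qed.

Definition ind_src (e : ind_edge) : ind_vert :=
  exist _ (src G (val e)) (ind_src_subproof e).
Definition ind_tgt (e : ind_edge) : ind_vert :=
  exist _ (tgt G (val e)) (ind_tgt_subproof e).
Definition ind_rev (e : ind_edge) : ind_edge :=
  exist _ (erev G (val e)) (ind_rev_subproof e).

Lemma ind_revK : involutive ind_rev.
Proof. by move=> e; apply: val_inj; rewrite /= erevK. Qed.

Lemma ind_rev_neq e : ind_rev e != e.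
Proof. by apply/eqP => /(congr1 val) /= /eqP; rewrite (negPf (erev_neq _ _)). Qed.

Lemma ind_src_rev e : ind_src e = ind_tgt (ind_rev e).
Proof. by apply: val_inj; rewrite /= src_erev. Qed.

Lemma ind_weight_rev (e : ind_edge) :
  (weight G (val e))^* = weight G (val (ind_rev e)).
Proof. exact: weight_erev. Qed.

Definition induced_graph : wgraph R ind_vert ind_edge :=
  @WGraph R ind_vert ind_edge ind_src ind_tgt ind_rev
    (fun e => weight G (val e)) (fun v => pot G (val v))
    ind_revK ind_rev_neq ind_src_rev ind_weight_rev.

End Induced.

Definition components X : {set {set V}} :=
  equivalence_partition
    (connect (fun u v => [&& u \in X, v \in X & adj u v])) X.

Definition cc X : nat := #|components X|.

Definition boundary X : {set V} :=
  [set v | (v \notin X) && [exists u in X, adj u v]].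

Definition aomoto (lam : R) : {set {set V}} :=
  [set X : {set V} | [&& `[< acyclic (induced_graph X) >],
     [forall C in components X, spectrum (induced_graph C) lam]
   & (#|boundary X| < cc X)%N]].

End FiniteGraphs.

(* Programs of a first-order language over lists with exact real numbers as
   atoms. Variables are de Bruijn indices and the only numerical literal is 1.
   [PSpectrum] is an oracle for the spectra of finite Hermitian matrices. A
   derivation of [runs rho p v] is a terminating run of [p] in the environment
   [rho] with output [v]; as a finite tree, it has finitely many steps. *)
Inductive prog :=
| PVar of nat
| PLet of prog & prog
| PNil
| PCons of prog & prog
| PHead of prog
| PTail of prog
| PIfNil of prog & prog & prog
| POne
| PAdd of prog & prog
| PSub of prog & prog
| PMul of prog & prog
| PInv of prog
| PIfLe of prog & prog & prog & prog
| PSpectrum of prog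
| PWhile of prog & prog.

Section Computation.
Variable R : realType.

Inductive pval :=
| VNil
| VReal of R
| VCons of pval & pval.

Definition vlist (s : seq pval) : pval := foldr VCons VNil s.

Definition vreals (s : seq R) : pval := vlist (map VReal s).

Definition vcomplex (z : R[i]) : pval :=
  VCons (VReal (complex.Re z)) (VReal (complex.Im z)).

Definition vmatrix (n : nat) (M : 'M[R[i]]_n) : pval :=
  vlist [seq vlist [seq vcomplex (M i j) | j <- enum 'I_n] | i <- enum 'I_n].

(* In [PWhile c b] the state of the loop is the variable of index 0: as long as
   [c] is not [VNil], the state is replaced by the value of [b]. *)
Inductive runs : seq pval -> prog -> pval -> Prop :=
| RVar rho n v : onth rho n = Some v -> runs rho (PVar n) v
| RLet rho a b v w :
    runs rho a v -> runs (v :: rho) b w -> runs rho (PLet a b) w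
| RNil rho : runs rho PNil VNil
| RCons rho a b v w :
    runs rho a v -> runs rho b w -> runs rho (PCons a b) (VCons v w)
| RHead rho a v w : runs rho a (VCons v w) -> runs rho (PHead a) v
| RTail rho a v w : runs rho a (VCons v w) -> runs rho (PTail a) w
| RIfNil_nil rho a b c v :
    runs rho a VNil -> runs rho b v -> runs rho (PIfNil a b c) v
| RIfNil_cons rho a b c x y v :
    runs rho a (VCons x y) -> runs rho c v -> runs rho (PIfNil a b c) v
| ROne rho : runs rho POne (VReal 1)
| RAdd rho a b x y :
    runs rho a (VReal x) -> runs rho b (VReal y) ->
    runs rho (PAdd a b) (VReal (x + y))
| RSub rho a b x y :
    runs rho a (VReal x) -> runs rho b (VReal y) ->
    runs rho (PSub a b) (VReal (x - y))
| RMul rho a b x y :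
    runs rho a (VReal x) -> runs rho b (VReal y) ->
    runs rho (PMul a b) (VReal (x * y))
| RInv rho a x :
    runs rho a (VReal x) -> x != 0 -> runs rho (PInv a) (VReal x^-1)
| RIfLe_le rho a b c d x y v :
    runs rho a (VReal x) -> runs rho b (VReal y) -> x <= y ->
    runs rho c v -> runs rho (PIfLe a b c d) v
| RIfLe_gt rho a b c d x y v :
    runs rho a (VReal x) -> runs rho b (VReal y) -> y < x ->
    runs rho d v -> runs rho (PIfLe a b c d) v
| RSpectrum rho a n (M : 'M[R[i]]_n) (s : seq R) :
    runs rho a (vmatrix M) -> M^T = map_mx Num.conj M ->
    sorted <%R s -> (forall x : R, (x \in s) = eigenvalue M x%:C) ->
    runs rho (PSpectrum a) (vreals s)
| RWhile_stop rho c b v :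
    runs (v :: rho) c VNil -> runs (v :: rho) (PWhile c b) v
| RWhile_step rho c b v x y v' w :
    runs (v :: rho) c (VCons x y) -> runs (v :: rho) b v' ->
    runs (v' :: rho) (PWhile c b) w -> runs (v :: rho) (PWhile c b) w.

Section Encoding.
Variables (V E : finType) (G : wgraph R V E).

(* Vertices and edges are numbered by the enumerations of [V] and [E]. The
   input consists of the list of potentials and of the list of edges, each
   given by the numbers of its source, terminal and reverse edge followed by
   the real and imaginary parts of its weight. *)
Definition vrank (T : finType) (x : T) : pval := VReal (index x (enum T))%:R.

Definition encode_graph : pval :=
  VCons (vreals [seq pot G v | v <- enum V])
        (vlist [seq vlist [:: vrank (src G e); vrank (tgt G e);
                              vrank (erev G e);
                              VReal (complex.Re (weight G e));
                              VReal (complex.Im (weight G e))] | e <- enum E]).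

End Encoding.
End Computation.

(* One program [p] for all graphs; its output does not depend on the root of
   the universal cover, which is not part of the input. *)
Definition computes_point_spectrum (R : realType) (p : prog) : Prop :=
  forall (V E : finType) (G : wgraph R V E), gconnected G ->
  exists s : seq R, runs [:: encode_graph G] p (vreals s) /\
    forall r : V, point_spectrum (universal_cover G r) = [set` s].

(* Main.v *)
Require Import Defs.
From mathcomp Require Import all_boot all_order all_algebra.
From mathcomp Require Import complex finmap zify ring lra.
From mathcomp Require Import all_classical all_reals all_analysis measurable_realfun.
Set Implicit Arguments.
Unset Strict Implicit.
Unset Printing Implicit Defensive.

Import Order.TTheory GRing.Theory Num.Theory.
Import numFieldNormedType.Exports.
Local Open Scope classical_set_scope.
Local Open Scope ring_scope.
Local Notation "x %:C" := (real_complex _ x) : ring_scope.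
Local Notation "x +i* y" := (Complex x y) : ring_scope.

(* For a vertex u, let p_u be the squared norm of the projection of the delta
   function at a lift of u onto Ker (lam - A_T); it is the value and the squared
   norm of the reproducing kernel of Ker (lam - A_T) at the root, and
   mu{lam} = (sum_u p_u) / |V|. All functions live on the words in the edges
   of G, the vertices of T being the non-backtracking words.

   Upper bound. Put X = {u : p_u > 0} and let m(e) be the proportion of the
   norm of the kernel at the source of e that lies behind e. Then
   1 = p_u + (sum of m(e) over the edges e out of u). Unique continuation gives
   m(e) + m(erev e) = 1 when both ends of e are in X, m strictly decreases along
   non-backtracking walks in X, so X is acyclic, and the masses entering a
   boundary vertex of X add up to 1. Hence
   sum_u p_u = |X| - |E(X)| - |bd X| = cc X - |bd X|, with E(X) the undirected
   edges inside X, and the kernels restricted to the components of X are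
   eigenvectors for lam.

   Lower bound. Take X acyclic with unit eigenvectors phi on its components.
   Contracting these components turns T into a tree in which components
   alternate with boundary vertices, and the functions that are multiples of
   phi on every component solve the eigenvalue equation up to its value at the
   boundary vertices. The regularised projection onto those which satisfy it
   also there has, for eta > 0, explicit entries in terms of a cavity recursion,
   and its diagonal entries add up to at least cc X - |bd X|; an ultralimit as
   eta goes to 0 gives elements of Ker (lam - A_T) with the same bound.

   Consequently lam is in the point spectrum iff some X satisfies a finite
   combinatorial criterion, which a program tests by running over all X. *)

(** * Summable families *)

(** The two bounds concern different sets: the lower one holds for every admissible set, and the
    upper one is attained by the set of live vertices; together they give the maximum. Unique
    continuation is the statement that a solution vanishing at a live vertex vanishes across every
    edge of nonzero weight; so the kernels at two adjacent live vertices, seen in the same tree, are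
    proportional. For the lower bound let B send the coefficients of the eigenvectors phi to the
    residual at the boundary vertices, with adjoint B'. Formally the trial function is the column of
    P = eta^2 (eta^2 + B' B)^{-1} at the root component. From 0 <= P <= 1 follows |P delta|^2 <=
    <delta, P delta>, which is the norm bound that Cauchy-Schwarz against the kernel requires. Since
    only an inequality has to survive the limit, an ultralimit suffices. The program must accept
    edges of weight zero, which the operator does not see. Hence the combinatorics counts only edges
    of nonzero weight, and it is identified with the notions of the statement when all weights are
    nonzero. *)

Section RealSums.
Variables (R : realType) (W : choiceType).
Implicit Types (a b h : W -> R).

Definition absum h : Prop := (\esum_(v in [set: W]) `|h v|%:E < +oo)%E.

(** [fine] sends [+oo] to 0, so the value is the sum only for a summable family. *)
Definition nsum a : R := fine (\esum_(v in [set: W]) (a v)%:E)%E.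

Lemma le_absum a h : absum h -> (forall v, `|a v| <= `|h v|) -> absum a.
Proof.
move=> sh ah; apply: le_lt_trans sh; apply: le_esum => v _; rewrite lee_fin; exact: ah.
Qed.

Lemma absumD a b : absum a -> absum b -> absum (fun v => a v + b v).
Proof.
move=> sa sb; have : (\esum_(v in [set: W]) (`|a v|%:E + `|b v|%:E) < +oo)%E.
  by rewrite esumD ?lte_add_pinfty // => v _; rewrite lee_fin.
by apply: le_lt_trans; apply: le_esum => v _; rewrite -EFinD lee_fin ler_normD.
Qed.

Lemma nsum_fin a : (forall v, 0 <= a v) -> absum a ->
  (\esum_(v in [set: W]) (a v)%:E)%E = (nsum a)%:E.
Proof.
move=> a0 sa; rewrite fineK // ge0_fin_numE; last by apply: esum_ge0 => v _; rewrite lee_fin.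
by apply: le_lt_trans sa; apply: le_esum => v _; rewrite lee_fin ler_norm.
Qed.

Lemma nsum_ge0 a : (forall v, 0 <= a v) -> 0 <= nsum a.
Proof. by move=> a0; apply: fine_ge0; apply: esum_ge0 => v _; rewrite lee_fin. Qed.

Lemma nsumD a b : (forall v, 0 <= a v) -> (forall v, 0 <= b v) ->
  absum a -> absum b -> nsum (fun v => a v + b v) = nsum a + nsum b.
Proof.
move=> a0 b0 sa sb; apply/EFin_inj; rewrite EFinD -!nsum_fin //; last exact: absumD.
  by rewrite -esumD // => v _; rewrite lee_fin.
by move=> v; rewrite addr_ge0.
Qed.

Lemma le_nsum a b : (forall v, 0 <= a v) -> (forall v, a v <= b v) ->
  absum b -> nsum a <= nsum b.
Proof.
move=> a0 ab sb; have b0 v : 0 <= b v := le_trans (a0 v) (ab v).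
rewrite -lee_fin -!nsum_fin //; first by apply: le_esum => v _; rewrite lee_fin.
by apply: le_absum sb _ => v; rewrite !ger0_norm.
Qed.

Lemma sum_le_nsum a (s : seq W) : (forall v, 0 <= a v) -> absum a -> uniq s ->
  \sum_(v <- s) a v <= nsum a.
Proof.
move=> a0 sa us; rewrite -lee_fin -nsum_fin // -sumEFin.
apply: esum_ge; exists [set` s]; first by split.
by rewrite fsbig_seq.
Qed.

Lemma nsum_le a M : (forall v, 0 <= a v) ->
  (forall s : seq W, uniq s -> \sum_(v <- s) a v <= M) -> absum a /\ nsum a <= M.
Proof.
move=> a0 aM; have key : (\esum_(v in [set: W]) (a v)%:E <= M%:E)%E.
  apply: ge_ereal_sup => _ [A [fA _] <-].
  by rewrite fsbig_finite //= sumEFin lee_fin; apply: aM; apply: fset_uniq.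
have sa : absum a.
  apply: le_lt_trans (ltry M); apply: le_trans key; apply: le_esum => v _.
  by rewrite ger0_norm.
by split=> //; rewrite -lee_fin -nsum_fin.
Qed.

(** The positive and negative parts of [h] form the smallest such decomposition, hence are summable,
    and [hp + b = hm + a] equates the differences. As [max] is not additive, linearity of [rsum] is
    derived through other decompositions. *)
Lemma rsum_diff h a b : (forall v, 0 <= a v) -> (forall v, 0 <= b v) ->
  absum a -> absum b -> (forall v, h v = a v - b v) -> rsum h = nsum a - nsum b.
Proof.
move=> a0 b0 sa sb hab.
pose hp v := Num.max (h v) 0; pose hm v := Num.max (- h v) 0.
have hp0 v : 0 <= hp v by rewrite le_max lexx orbT.
have hm0 v : 0 <= hm v by rewrite le_max lexx orbT.
have hph v : hp v - hm v = h v.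
  by rewrite /hp /hm !maxEle; case: ifP; case: ifP => ? ?; lra.
have shp : absum hp.
  apply: le_absum (absumD sa sb) _ => v; rewrite !ger0_norm ?addr_ge0 //.
  rewrite /hp ge_max addr_ge0 // hab andbT; have := b0 v; lra.
have shm : absum hm.
  apply: le_absum (absumD sa sb) _ => v; rewrite !ger0_norm ?addr_ge0 //.
  rewrite /hm ge_max addr_ge0 // hab andbT; have := a0 v; lra.
rewrite /rsum -/(nsum hp) -/(nsum hm).
have : nsum (fun v => hp v + b v) = nsum (fun v => hm v + a v).
  by congr nsum; apply/funext => v; have := hph v; rewrite hab; lra.
rewrite !nsumD //; lra.
Qed.

Lemma rsum_ge0E a : (forall v, 0 <= a v) -> absum a -> rsum a = nsum a.
Proof.
move=> a0 sa; rewrite (@rsum_diff a a (fun=> 0)) //.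
- suff -> : nsum (fun=> 0) = 0 by rewrite subr0.
  by rewrite /nsum esum1.
- by apply: le_absum sa _ => v; rewrite normr0.
- by move=> v; rewrite subr0.
Qed.

Lemma absumN a : absum a -> absum (fun v => - a v).
Proof. by move=> sa; apply: le_absum sa _ => v; rewrite normrN. Qed.

Lemma absumZ c a : absum a -> absum (fun v => c * a v).
Proof.
(* [|c|] is replaced by an integer bound, and integer multiples are summable by repeated
   addition. *)
move=> sa; have [c0 c1]: 0 <= `|c| /\ `|c| <= (Num.truncn `|c|).+1%:R.
  by split=> //; apply/ltW/truncnS_gt.
have : absum (fun v => (Num.truncn `|c|).+1%:R * a v).
  elim: (Num.truncn `|c|).+1 => [|n IH].
    by apply: le_absum sa _ => v; rewrite mul0r normr0.
  rewrite (_ : (fun v => _) = (fun v => n%:R * a v + a v)); first exact: absumD.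
  by apply/funext => v; rewrite -natr1 mulrDl mul1r.
move=> /le_absum; apply => v; rewrite !normrM ler_wpM2r //.
by rewrite [leRHS]ger0_norm.
Qed.

Lemma rsumD a b : absum a -> absum b -> rsum (fun v => a v + b v) = rsum a + rsum b.
Proof.
have pos h : absum h -> absum (fun v => Num.max (h v) 0).
  move=> sh; apply: le_absum sh _ => v.
  by rewrite ger0_norm ?le_max ?lexx ?orbT // ge_max ler_norm normr_ge0.
have p0 x : 0 <= Num.max x 0 :> R by rewrite le_max lexx orbT.
move=> sa sb; have sa' := absumN sa; have sb' := absumN sb.
rewrite (@rsum_diff _ (fun v => Num.max (a v) 0 + Num.max (b v) 0)
  (fun v => Num.max (- a v) 0 + Num.max (- b v) 0)).
- rewrite !nsumD ?/rsum -?/(nsum _); do ?by [move=> v; exact: p0 | apply: pos].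
  rewrite -!/(nsum _); lra.
- by move=> v; rewrite addr_ge0.
- by move=> v; rewrite addr_ge0.
- by apply: absumD; apply: pos.
- by apply: absumD; apply: pos.
- by move=> v; rewrite !maxEle; do !case: ifP => ?; lra.
Qed.

Lemma rsumN a : rsum (fun v => - a v) = - rsum a.
Proof.
rewrite /rsum opprB; congr (_ - _).
by congr fine; apply: eq_esum => v _; rewrite opprK.
Qed.

Lemma nsumZ c a : 0 <= c -> (forall v, 0 <= a v) -> absum a ->
  nsum (fun v => c * a v) = c * nsum a.
Proof.
move=> c0 a0 sa; have ca0 v : 0 <= c * a v by rewrite mulr_ge0.
apply/eqP; rewrite eq_le; apply/andP; split.
  suff [] : absum (fun v => c * a v) /\ nsum (fun v => c * a v) <= c * nsum a by [].
  apply: nsum_le => // s us.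
  by rewrite -mulr_sumr ler_wpM2l // sum_le_nsum.
have [->|cn0] := eqVneq c 0; first by rewrite mul0r nsum_ge0 // => v; rewrite mul0r.
have cp : 0 < c by rewrite lt0r cn0.
rewrite mulrC -ler_pdivlMr //.
suff [] : absum a /\ nsum a <= nsum (fun v => c * a v) / c by [].
apply: nsum_le => // s us; rewrite ler_pdivlMr // mulrC mulr_sumr.
apply: (@sum_le_nsum (fun v => c * a v)) => //; exact: absumZ.
Qed.

Lemma rsumZ c a : absum a -> rsum (fun v => c * a v) = c * rsum a.
Proof.
have pos h : absum h -> absum (fun v => Num.max (h v) 0).
  move=> sh; apply: le_absum sh _ => v.
  by rewrite ger0_norm ?le_max ?lexx ?orbT // ge_max ler_norm normr_ge0.
have p0 x : 0 <= Num.max x 0 :> R by rewrite le_max lexx orbT.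
move=> sa; wlog c0 : c / 0 <= c.
  move=> H; have [|c0] := leP 0 c; first exact: H.
  have := H (- c); rewrite oppr_ge0 ltW // => /(_ isT).
  rewrite (_ : (fun v => - c * a v) = (fun v => - (c * a v))); last first.
    by apply/funext => v; rewrite mulNr.
  by rewrite rsumN mulNr => /oppr_inj.
rewrite (@rsum_diff _ (fun v => c * Num.max (a v) 0) (fun v => c * Num.max (- a v) 0)).
- rewrite !nsumZ //; first by rewrite -mulrBr.
  exact/pos/absumN.
  exact/pos.
- by move=> v; rewrite mulr_ge0.
- by move=> v; rewrite mulr_ge0.
- exact/absumZ/pos.
- exact/absumZ/pos/absumN.
- by move=> v; rewrite -mulrBr; congr (_ * _); rewrite !maxEle; do !case: ifP => ?; lra.
Qed.

Lemma absum_sum (I : Type) (r : seq I) (P : pred I) (F : I -> W -> R) :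
  (forall i, P i -> absum (F i)) -> absum (fun v => \sum_(i <- r | P i) F i v).
Proof.
move=> sF; elim: r => [|i r IH].
  rewrite /absum esum1 // => v _; by rewrite big_nil normr0.
case: (boolP (P i)) => Pi.
  rewrite (_ : (fun v => _) = (fun v => F i v + \sum_(j <- r | P j) F j v)).
    by apply: absumD => //; exact: sF.
  by apply/funext => v; rewrite big_cons Pi.
rewrite (_ : (fun v => _) = (fun v => \sum_(j <- r | P j) F j v)) //.
by apply/funext => v; rewrite big_cons (negPf Pi).
Qed.

Lemma absum0 : absum (fun=> 0).
Proof. by rewrite /absum esum1 // => v _; rewrite normr0. Qed.

Lemma nsum1 (w : W) a : (forall v, 0 <= a v) -> (forall v, v != w -> a v = 0) ->
  absum a /\ nsum a = a w.
Proof.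
move=> a0 aw; have [sa le] : absum a /\ nsum a <= a w.
  apply: nsum_le => // s us; have [ws|ws] := boolP (w \in s).
    by rewrite (bigD1_seq w) //= big1 ?addr0 // => v /aw.
  rewrite big_seq big1 // => v vs; apply: aw; apply: contraNneq ws => <- //.
split=> //; apply/eqP; rewrite eq_le le /=.
by have := @sum_le_nsum a [:: w] a0 sa isT; rewrite big_seq1.
Qed.

Lemma rsum1 (w : W) h : (forall v, v != w -> h v = 0) -> absum h /\ rsum h = h w.
Proof.
move=> hw; have [sa na] : absum h /\ nsum (fun v => `|h v|) = `|h w|.
  by have [|v /hw ->|] := @nsum1 w (fun v => `|h v|); rewrite ?normr0 // /absum;
    under eq_esum do rewrite normr_id.
have [v|v vw|sp np] := @nsum1 w (fun v => Num.max (h v) 0).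
- by rewrite le_max lexx orbT.
- by rewrite hw // maxxx.
have [v|v vw|sm nm] := @nsum1 w (fun v => Num.max (- h v) 0).
- by rewrite le_max lexx orbT.
- by rewrite hw // oppr0 maxxx.
split=> //; rewrite /rsum -!/(nsum _) np nm.
by rewrite !maxEle; do !case: ifP => ?; lra.
Qed.

End RealSums.

(** * Sums along a bijection between supports *)

Section Reindex.
Variables (R : realType) (W W' : choiceType) (D : set W) (D' : set W') (t : W -> W').
Hypothesis tbij : set_bij D D' t.

(** Moving the root or crossing an edge is a bijection only between sets of reduced words, while all
    sums range over all words; hence the two vanishing conditions. *)
Lemma esum_reindex0 (a : W -> R) (a' : W' -> R) :
  (forall v, 0 <= a v) -> (forall v, 0 <= a' v) ->
  (forall v, ~ D v -> a v = 0) -> (forall v, ~ D' v -> a' v = 0) ->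
  (forall v, D v -> a v = a' (t v)) ->
  (\esum_(v in [set: W]) (a v)%:E = \esum_(v in [set: W']) (a' v)%:E)%E.
Proof.
move=> a0 a'0 aD aD' aa'.
have -> : (\esum_(v in [set: W]) (a v)%:E = \esum_(v in D) (a v)%:E)%E.
  rewrite [RHS]esum_mkcond; apply: eq_esum => v _; case: ifPn => //.
  by move=> /negP; rewrite inE => /aD ->.
have -> : (\esum_(v in [set: W']) (a' v)%:E = \esum_(v in D') (a' v)%:E)%E.
  rewrite [RHS]esum_mkcond; apply: eq_esum => v _; case: ifPn => //.
  by move=> /negP; rewrite inE => /aD' ->.
rewrite (@reindex_esum R _ _ D D' t (fun v => (a' v)%:E)) //.
  by apply: eq_esum => v Dv; rewrite aa'.
Qed.

Lemma rsum_reindex (h : W -> R) (h' : W' -> R) :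
  (forall v, ~ D v -> h v = 0) -> (forall v, ~ D' v -> h' v = 0) ->
  (forall v, D v -> h v = h' (t v)) ->
  (absum h <-> absum h') /\ rsum h = rsum h'.
Proof.
move=> hD hD' hh'; rewrite /absum /rsum.
have -> : (\esum_(v in [set: W]) `|h v|%:E = \esum_(v in [set: W']) `|h' v|%:E)%E.
  apply: esum_reindex0 => v //; first by move=> /hD ->; rewrite normr0.
    by move=> /hD' ->; rewrite normr0.
  by move=> /hh' ->.
split=> //; congr (fine _ - fine _).
  apply: (@esum_reindex0 (fun v => Num.max (h v) 0) (fun v => Num.max (h' v) 0)) => v.
  - by rewrite le_max lexx orbT.
  - by rewrite le_max lexx orbT.
  - by move=> /hD ->; rewrite maxxx.
  - by move=> /hD' ->; rewrite maxxx.
  - by move=> /hh' ->.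
apply: (@esum_reindex0 (fun v => Num.max (- h v) 0) (fun v => Num.max (- h' v) 0)) => v.
- by rewrite le_max lexx orbT.
- by rewrite le_max lexx orbT.
- by move=> /hD ->; rewrite oppr0 maxxx.
- by move=> /hD' ->; rewrite oppr0 maxxx.
- by move=> /hh' ->.
Qed.

End Reindex.

(** * The Hilbert space of square-summable complex functions *)

Section ComplexL2.
Variables (R : realType) (W : choiceType).
Local Notation C := R[i].
Local Notation Re := complex.Re.
Local Notation Im := complex.Im.
Implicit Types (f g h : W -> C) (z w c : C).

Lemma normsq_ge0 z : 0 <= normsq z.
Proof. by rewrite addr_ge0 // sqr_ge0. Qed.

Lemma conjCD z w : (z + w)^* = z^* + w^*.
Proof. exact: rmorphD. Qed.

Lemma conjCM z w : (z * w)^* = z^* * w^*.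
Proof. exact: rmorphM. Qed.

Lemma conjCR (x : R) : Num.conj (x%:C : C) = x%:C.
Proof. exact: conjc_real. Qed.

Lemma conjc_mul_self z : z^* * z = (normsq z)%:C.
Proof. by case: z => a b; rewrite /normsq; simpc; congr Complex => /=; ring. Qed.

Lemma normsqM z w : normsq (z * w) = normsq z * normsq w.
Proof. by case: z w => [a b] [c d]; rewrite /normsq /=; ring. Qed.

Lemma normsq_conj z : normsq z^* = normsq z.
Proof. by case: z => a b; rewrite /normsq /= sqrrN. Qed.

Lemma normsqN z : normsq (- z) = normsq z.
Proof. by case: z => a b; rewrite /normsq /= !sqrrN. Qed.

Lemma normsqD_le z w : normsq (z + w) <= 2 * normsq z + 2 * normsq w.
Proof.
case: z w => [a b] [c d]; rewrite /normsq /=.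
have := sqr_ge0 (a - c); have := sqr_ge0 (b - d); nra.
Qed.

Lemma normsq0 : normsq (0 : C) = 0.
Proof. by rewrite /normsq /= expr0n addr0. Qed.

Lemma normsq_real (x : R) : normsq x%:C = x ^+ 2.
Proof. by rewrite /normsq /= expr0n addr0. Qed.

Lemma normsq_eq0 z : (normsq z == 0) = (z == 0).
Proof.
case: z => a b; rewrite /normsq /= paddr_eq0 ?sqr_ge0 // !sqrf_eq0.
by rewrite eq_complex.
Qed.

Definition nsq f : R := nsum (fun v => normsq (f v)).

Lemma ell2E f : ell2 f <-> absum (fun v => normsq (f v)).
Proof.
rewrite /ell2 /absum; split; apply: le_lt_trans; apply: le_esum => v _;
  by rewrite ger0_norm // normsq_ge0.
Qed.

Lemma nsq_ge0 f : 0 <= nsq f.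
Proof. by apply: nsum_ge0 => v; exact: normsq_ge0. Qed.

Lemma ell2D f g : ell2 f -> ell2 g -> ell2 (fun v => f v + g v).
Proof.
rewrite !ell2E => sf sg.
apply: le_absum (absumD (absumZ 2 sf) (absumZ 2 sg)) _ => v.
rewrite !ger0_norm ?normsq_ge0 ?addr_ge0 ?mulr_ge0 ?normsq_ge0 //.
exact: normsqD_le.
Qed.

Lemma ell2Z c f : ell2 f -> ell2 (fun v => c * f v).
Proof.
rewrite !ell2E => /(absumZ (normsq c)); rewrite (_ : (fun v => _ * normsq _) =
  (fun v => normsq (c * f v))) //.
by apply/funext => v; rewrite normsqM.
Qed.

Lemma ell2B f g : ell2 f -> ell2 g -> ell2 (fun v => f v - g v).
Proof.
move=> sf /(ell2Z (-1)) /(ell2D sf); congr (@ell2 R W _).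
by apply/funext => v; rewrite mulN1r.
Qed.

Lemma ell2_0 : ell2 (fun _ : W => 0 : C).
Proof. by apply/ell2E; rewrite /absum esum1 // => v _; rewrite normsq0 normr0. Qed.

Lemma ell2_sum (I : Type) (r : seq I) (P : pred I) (F : I -> W -> C) :
  (forall i, P i -> ell2 (F i)) -> ell2 (fun v => \sum_(i <- r | P i) F i v).
Proof.
move=> sF; elim: r => [|i r IH].
  by have := ell2_0; congr (@ell2 R W _); apply/funext => v; rewrite big_nil.
case: (boolP (P i)) => Pi.
  by have := ell2D (sF i Pi) IH; congr (@ell2 R W _); apply/funext => v; rewrite big_cons Pi.
by move: IH; congr (@ell2 R W _); apply/funext => v; rewrite big_cons (negPf Pi).
Qed.

Lemma le_ell2 f g : ell2 g -> (forall v, normsq (f v) <= normsq (g v)) -> ell2 f.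
Proof.
move=> /ell2E sg fg; apply/ell2E; apply: le_absum sg _ => v.
by rewrite !ger0_norm ?normsq_ge0.
Qed.

Definition csummable h := absum (fun v => Re (h v)) /\ absum (fun v => Im (h v)).

Lemma csummable_mul f g : ell2 f -> ell2 g -> csummable (fun v => (f v)^* * g v).
Proof.
rewrite !ell2E => sf sg; have sfg := absumD sf sg.
have le v : `|Re ((f v)^* * g v)| <= normsq (f v) + normsq (g v) /\
  `|Im ((f v)^* * g v)| <= normsq (f v) + normsq (g v).
  rewrite !ler_norml; case: (f v) (g v) => [a b] [c d]; rewrite /normsq /=.
  have := sqr_ge0 (a - c); have := sqr_ge0 (b - d).
  have := sqr_ge0 (a + c); have := sqr_ge0 (b + d).
  have := sqr_ge0 (a + d); have := sqr_ge0 (b - c).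
  have := sqr_ge0 (a - d); have := sqr_ge0 (b + c).
  by move=> *; split; apply/andP; split; nra.
have n0 v : `|normsq (f v) + normsq (g v)| = normsq (f v) + normsq (g v).
  by rewrite ger0_norm // addr_ge0 // normsq_ge0.
by split; apply: le_absum sfg _ => v; rewrite n0; case: (le v).
Qed.

Lemma csumD f g : csummable f -> csummable g ->
  csum (fun v => f v + g v) = csum f + csum g.
Proof.
move=> [rf jf] [rg jg]; rewrite /csum.
rewrite [RHS](_ : _ = (rsum (fun v => Re (f v)) + rsum (fun v => Re (g v))) +i*
  (rsum (fun v => Im (f v)) + rsum (fun v => Im (g v)))) //.
rewrite -!rsumD //; congr Complex; congr rsum;
  by apply/funext => v; case: (f v) (g v) => [? ?] [? ?].
Qed.

Lemma csumZ c f : csummable f -> csum (fun v => c * f v) = c * csum f.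
Proof.
case: c => a b [rf jf]; rewrite /csum /=; simpc.
rewrite -mulNr -!rsumZ // -!rsumD; try by apply: absumZ.
congr Complex; congr rsum; apply/funext => v; case: (f v) => x y /=; ring.
Qed.

Lemma csum_conj f : csum (fun v => (f v)^*) = (csum f)^*.
Proof.
rewrite [RHS](_ : _ = rsum (fun v => Re (f v)) +i* (- rsum (fun v => Im (f v)))) //.
rewrite /csum -rsumN; congr Complex; congr rsum;
  by apply/funext => v; case: (f v).
Qed.

Lemma innerC f g : inner g f = (inner f g)^*.
Proof.
rewrite /inner -csum_conj; congr csum; apply/funext => v.
by rewrite conjCM conjCK mulrC.
Qed.

Lemma innerDr f g h : ell2 f -> ell2 g -> ell2 h ->
  inner f (fun v => g v + h v) = inner f g + inner f h.
Proof.
move=> sf sg sh; rewrite -csumD; try exact: csummable_mul.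
by congr csum; apply/funext => v; rewrite mulrDr.
Qed.

Lemma innerZr c f g : ell2 f -> ell2 g -> inner f (fun v => c * g v) = c * inner f g.
Proof.
move=> sf sg; rewrite -csumZ; last exact: csummable_mul.
by congr csum; apply/funext => v; rewrite mulrCA.
Qed.

Lemma innerDl f g h : ell2 f -> ell2 g -> ell2 h ->
  inner (fun v => g v + h v) f = inner g f + inner h f.
Proof. by move=> sf sg sh; rewrite innerC innerDr // conjCD -!innerC. Qed.

Lemma innerZl c f g : ell2 f -> ell2 g -> inner (fun v => c * g v) f = c^* * inner g f.
Proof. by move=> sf sg; rewrite innerC innerZr // conjCM -innerC. Qed.

Lemma innerBr f g h : ell2 f -> ell2 g -> ell2 h ->
  inner f (fun v => g v - h v) = inner f g - inner f h.
Proof.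
move=> sf sg sh; rewrite -[- inner f h]mulN1r -innerZr // -innerDr //; last exact: ell2Z.
by congr inner; apply/funext => v; rewrite mulN1r.
Qed.

Lemma inner_sumr (I : Type) (r : seq I) (P : pred I) f (F : I -> W -> C) :
  ell2 f -> (forall i, P i -> ell2 (F i)) ->
  inner f (fun v => \sum_(i <- r | P i) F i v) = \sum_(i <- r | P i) inner f (F i).
Proof.
move=> sf sF; elim: r => [|i r IH].
  rewrite big_nil (_ : (fun v => _) = (fun v => 0 * f v)).
    by rewrite innerZr // mul0r.
  by apply/funext => v; rewrite big_nil mul0r.
rewrite big_cons -IH; case: (boolP (P i)) => Pi.
  rewrite -innerDr //; [|exact: sF|exact: ell2_sum].
  by congr inner; apply/funext => v; rewrite big_cons Pi.
by congr inner; apply/funext => v; rewrite big_cons (negPf Pi).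
Qed.

Lemma inner_self f : ell2 f -> inner f f = (nsq f)%:C.
Proof.
move=> /ell2E sf; rewrite /inner /csum.
have e v : (f v)^* * f v = (normsq (f v))%:C by exact: conjc_mul_self.
under [in X in X +i* _]eq_fun do rewrite e.
under [in X in _ +i* X]eq_fun do rewrite e.
rewrite /= rsum_ge0E //; last by move=> v; exact: normsq_ge0.
rewrite rsum_ge0E //; last exact: absum0.
by rewrite /nsq [X in _ +i* X]/nsum esum1.
Qed.

Lemma inner_deltal (w : W) f : inner (delta R w) f = f w.
Proof.
rewrite /inner /csum; have e v : v != w -> (delta R w v)^* * f v = 0.
  by move=> vw; rewrite /delta (negPf vw) rmorph0 mul0r.
rewrite (rsum1 (w := w) _).2; last by move=> v /e ->.
rewrite (rsum1 (w := w) _).2; last by move=> v /e ->.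
by rewrite /delta eqxx rmorph1 mul1r; case: (f w).
Qed.

Lemma nsq_delta (w : W) : ell2 (delta R w) /\ nsq (delta R w) = 1.
Proof.
have [v||s e] := @nsum1 R W w (fun v => normsq (delta R w v)).
- exact: normsq_ge0.
- by move=> v vw; rewrite /delta (negPf vw) normsq0.
- split; first exact/ell2E.
  by rewrite /nsq e /delta eqxx /normsq /= expr1n expr0n addr0.
Qed.

Lemma nsq_expand f g c : ell2 f -> ell2 g ->
  nsq (fun v => f v + c * g v) =
    nsq f + 2 * Re (c * inner f g) + normsq c * nsq g.
Proof.
move=> sf sg; have scg := ell2Z c sg.
have : inner (fun v => f v + c * g v) (fun v => f v + c * g v) =
    (nsq f + 2 * Re (c * inner f g) + normsq c * nsq g)%:C.
  rewrite innerDr //; last exact: ell2D.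
  rewrite innerDl // innerDl // innerZr // innerZl // innerZl // innerZr //.
  rewrite !inner_self // (innerC f g); case: (inner f g) (c) => [x y] [a b].
  by rewrite /normsq /=; simpc; congr Complex => /=; ring.
by rewrite inner_self; [case|exact: ell2D].
Qed.

Lemma nsqZ c f : ell2 f -> nsq (fun v => c * f v) = normsq c * nsq f.
Proof.
move=> /ell2E sf; rewrite /nsq -nsumZ ?normsq_ge0 //; last by move=> v; exact: normsq_ge0.
by congr nsum; apply/funext => v; rewrite normsqM.
Qed.

Lemma normsq_le_nsq f (w : W) : ell2 f -> normsq (f w) <= nsq f.
Proof.
move=> /ell2E sf.
have := @sum_le_nsum R W (fun v => normsq (f v)) [:: w].
by rewrite big_seq1; apply => // v; exact: normsq_ge0.
Qed.

Lemma nsq_eq0 f : ell2 f -> nsq f = 0 -> f = fun=> 0.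
Proof.
move=> sf f0; apply/funext => w; apply/eqP; rewrite -normsq_eq0 eq_le normsq_ge0 andbT.
by rewrite -f0 normsq_le_nsq.
Qed.

Lemma inner_CauchySchwarz f g : ell2 f -> ell2 g -> normsq (inner f g) <= nsq f * nsq g.
Proof.
move=> sf sg; have [g0|g0] := eqVneq (nsq g) 0.
  have -> : inner f g = 0.
    rewrite (nsq_eq0 sg g0) (_ : (fun=> 0) = (fun v => 0 * f v)).
      by rewrite innerZr // mul0r.
    by apply/funext => v; rewrite mul0r.
  by rewrite g0 mulr0 normsq0.
have gp : 0 < nsq g by rewrite lt0r g0 nsq_ge0.
(* This coefficient minimises the norm of [f + c g]. *)
have := nsq_ge0 (fun v => f v + (- (inner f g)^* / (nsq g)%:C) * g v).
rewrite nsq_expand // mulrAC mulNr conjc_mul_self normsqM normsqN normsq_conj.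
rewrite (_ : _ / _ = (- (normsq (inner f g) / nsq g))%:C); last first.
  by rewrite rmorphN rmorphM fmorphV mulNr.
rewrite /= -fmorphV /= normsq_real => H.
have E : normsq (inner f g) * (nsq g)^-1 ^+ 2 * nsq g = normsq (inner f g) / nsq g.
  by field.
rewrite {}E in H; rewrite -ler_pdivrMr //; lra.
Qed.

Definition restr (S : pred W) f : W -> C := fun v => if S v then f v else 0.

Lemma ell2_restr S f : ell2 f -> ell2 (restr S f).
Proof.
move=> sf; apply: le_ell2 sf _ => v; rewrite /restr; case: ifP => // _.
by rewrite normsq0 normsq_ge0.
Qed.

Lemma inner_restr S f g : inner (restr S f) g = inner f (restr S g).
Proof.
rewrite /inner; congr csum; apply/funext => v; rewrite /restr; case: ifP => // _.
by rewrite rmorph0 mul0r mulr0.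
Qed.

Lemma restr_restr S f : restr S (restr S f) = restr S f.
Proof. by apply/funext => v; rewrite /restr; case: (S v). Qed.

Lemma nsq_restr S f : ell2 f -> nsq f = nsq (restr S f) + nsq (restr (predC S) f).
Proof.
move=> sf; rewrite /nsq -nsumD; try by [move=> v; exact: normsq_ge0|apply/ell2E/ell2_restr].
by congr nsum; apply/funext => v; rewrite /restr /=; case: (S v); rewrite normsq0 ?addr0 ?add0r.
Qed.

End ComplexL2.

Section ReindexL2.
Variables (R : realType) (W W' : choiceType) (D : set W) (D' : set W') (t : W -> W').
Hypothesis tbij : set_bij D D' t.

Lemma ell2_reindex (f : W -> R[i]) (f' : W' -> R[i]) :
  (forall v, ~ D v -> f v = 0) -> (forall v, ~ D' v -> f' v = 0) ->
  (forall v, D v -> f v = f' (t v)) ->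
  (ell2 f <-> ell2 f') /\ nsq f = nsq f'.
Proof.
move=> fD fD' ff'; have E := @esum_reindex0 R _ _ _ _ t tbij (fun v => normsq (f v)) (fun v => normsq (f' v)).
have {}E : (\esum_(v in [set: W]) (normsq (f v))%:E = \esum_(v in [set: W']) (normsq (f' v))%:E)%E.
  apply: E => v; try exact: normsq_ge0.
  - by move=> /fD ->; rewrite normsq0.
  - by move=> /fD' ->; rewrite normsq0.
  - by move=> /ff' ->.
by rewrite /ell2 /nsq /nsum E.
Qed.

Lemma inner_reindex (f g : W -> R[i]) (f' g' : W' -> R[i]) :
  (forall v, ~ D v -> f v = 0) -> (forall v, ~ D' v -> f' v = 0) ->
  (forall v, D v -> f v = f' (t v)) -> (forall v, D v -> g v = g' (t v)) ->
  inner f g = inner f' g'.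
Proof.
move=> fD fD' ff' gg'; rewrite /inner /csum; congr Complex.
  apply: (rsum_reindex tbij _ _ _).2 => v; first by move=> /fD ->; rewrite rmorph0 mul0r.
    by move=> /fD' ->; rewrite rmorph0 mul0r.
  by move=> Dv; rewrite ff' // gg'.
apply: (rsum_reindex tbij _ _ _).2 => v; first by move=> /fD ->; rewrite rmorph0 mul0r.
  by move=> /fD' ->; rewrite rmorph0 mul0r.
by move=> Dv; rewrite ff' // gg'.
Qed.

End ReindexL2.

Lemma ultra_cvg (R : realType) (U : set_system nat) (a : nat -> R) (M : R) :
  UltraFilter U -> (forall n, `|a n| <= M) -> exists l : R, a n @[n --> U] --> l.
Proof.
move=> UU aM; have PU := @ultra_proper _ _ UU.
have := @segment_compact R (- M) M (a @ U) _.
have mem : (a @ U) `[(- M), M]%classic.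
  apply: (@filterS _ U _ setT); last exact: filterT.
  by move=> n _ /=; rewrite in_itv /= -ler_norml.
move=> /(_ _ mem) [l [_ cl]]; exists l => B Bl.
have [//|nB] := in_ultra_setVsetC (a @^-1` B) UU.
by have [x []] := cl (~` B) B nB Bl.
Qed.

(** * Ultralimits and projections *)

Section Ultralimits.
Variables (R : realType) (U : set_system nat).
Hypothesis UU : UltraFilter U.
Hypothesis Uoo : \oo `<=` U.
Local Notation C := R[i].
Local Notation Re := complex.Re.
Local Notation Im := complex.Im.

Let PU : ProperFilter U := @ultra_proper _ _ UU.

#[local] Existing Instance PU.

Lemma cvg_oo_ultra (a : nat -> R) (l : R) :
  a n @[n --> \oo] --> l -> a n @[n --> U] --> l.
Proof. by move=> al; apply: cvg_trans al => A; apply: Uoo. Qed.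

Definition ccvg (z : nat -> C) (l : C) : Prop :=
  (Re (z n) @[n --> U] --> Re l) /\ (Im (z n) @[n --> U] --> Im l).

Lemma ccvg_unique z l l' : ccvg z l -> ccvg z l' -> l = l'.
Proof.
case: l l' => [a b] [c d] [rl il] [rl' il'].
have -> : a = c := cvg_unique (@norm_hausdorff R R) rl rl'.
by have -> : b = d := cvg_unique (@norm_hausdorff R R) il il'.
Qed.

Lemma ccvgD z w l m : ccvg z l -> ccvg w m -> ccvg (fun n => z n + w n) (l + m).
Proof.
case: l m => [a b] [c d] [rl il] [rm im]; split.
  rewrite (_ : (fun n => _) = (fun n => Re (z n) + Re (w n))); first exact: (cvgD rl rm).
  by apply/funext => n; case: (z n) (w n) => [? ?] [? ?].
rewrite (_ : (fun n => _) = (fun n => Im (z n) + Im (w n))); first exact: (cvgD il im).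
by apply/funext => n; case: (z n) (w n) => [? ?] [? ?].
Qed.

Lemma ccvgZ c z l : ccvg z l -> ccvg (fun n => c * z n) (c * l).
Proof.
case: c l => [a b] [x y] [rl il]; split.
  rewrite (_ : (fun n => _) = (fun n => a * Re (z n) - b * Im (z n))).
    exact: (cvgB (cvgM (cvg_cst _) rl) (cvgM (cvg_cst _) il)).
  by apply/funext => n; case: (z n).
rewrite (_ : (fun n => _) = (fun n => a * Im (z n) + b * Re (z n))).
  exact: (cvgD (cvgM (cvg_cst _) il) (cvgM (cvg_cst _) rl)).
by apply/funext => n; case: (z n).
Qed.

Lemma ccvg0 : ccvg (fun=> 0) 0.
Proof. by split; exact: cvg_cst. Qed.

Lemma ccvg_sum (I : Type) (r : seq I) (P : pred I) (z : I -> nat -> C) (l : I -> C) :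
  (forall i, P i -> ccvg (z i) (l i)) ->
  ccvg (fun n => \sum_(i <- r | P i) z i n) (\sum_(i <- r | P i) l i).
Proof.
move=> zl; elim: r => [|i r IH].
  by rewrite big_nil (_ : (fun n => _) = fun=> 0);
    [exact: ccvg0|apply/funext => n; rewrite big_nil].
rewrite big_cons; case: (boolP (P i)) => Pi.
  rewrite (_ : (fun n => _) = (fun n => z i n + \sum_(j <- r | P j) z j n)).
    by apply: ccvgD => //; exact: zl.
  by apply/funext => n; rewrite big_cons Pi.
rewrite (_ : (fun n => _) = (fun n => \sum_(j <- r | P j) z j n)) //.
by apply/funext => n; rewrite big_cons (negPf Pi).
Qed.

Lemma ccvg_normsq z l : ccvg z l -> normsq (z n) @[n --> U] --> normsq l.
Proof. by move=> [rl il]; rewrite /normsq !expr2; exact: (cvgD (cvgM rl rl) (cvgM il il)). Qed.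

Lemma ccvg_squeeze z (e : nat -> R) : (forall n, normsq (z n) <= e n) ->
  e n @[n --> \oo] --> 0 -> forall l, ccvg z l -> l = 0.
Proof.
move=> ze /cvg_oo_ultra e0 l /ccvg_normsq zl; apply/eqP; rewrite -normsq_eq0 eq_le normsq_ge0 andbT.
by apply: (@ler_cvg_to _ U _ _ _ _ _ _ zl e0); apply: (@filterS _ U _ setT); [move=> n _; exact: ze|exact: filterT].
Qed.

Variable W : choiceType.
Implicit Types f h : W -> C.

(** The pointwise ultralimit stands in for a weak limit: each finite sum of its squares is a limit
    of finite sums bounded by [M n]. Bounds that vary with [n] give the sharp constant [m], on which
    both [projection] and [lower_bound] rely. *)
Lemma weak_compact (f : nat -> W -> C) (M : nat -> R) (B m : R) :
  (forall n, ell2 (f n)) -> (forall n, nsq (f n) <= M n) -> (forall n, M n <= B) ->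
  M n @[n --> U] --> m ->
  exists g : W -> C, [/\ forall w, ccvg (fun n => f n w) (g w), ell2 g & nsq g <= m].
Proof.
move=> sf fM MB Mm.
have bd n w : normsq (f n w) <= B.
  by apply: le_trans (MB n); apply: le_trans (fM n); apply: normsq_le_nsq.
have key w : exists l : C, ccvg (fun n => f n w) l.
  have abs (x : R) : x ^+ 2 <= B -> `|x| <= B + 1.
    by rewrite ler_norml => ?; apply/andP; split; nra.
  have [|a ra] := @ultra_cvg R U (fun n => Re (f n w)) (B + 1) UU.
    by move=> n; apply: abs; apply: le_trans (bd n w); rewrite lerDl sqr_ge0.
  have [|b ib] := @ultra_cvg R U (fun n => Im (f n w)) (B + 1) UU.
    by move=> n; apply: abs; apply: le_trans (bd n w); rewrite lerDr sqr_ge0.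
  by exists (a +i* b).
have [g gP] := choice key; exists g.
have [|s us|sg ng] := @nsum_le R W (fun v => normsq (g v)) m.
- by move=> v; exact: normsq_ge0.
- have lim : (\sum_(v <- s) normsq (f n v)) @[n --> U] --> \sum_(v <- s) normsq (g v).
    elim: (s) => [|v r IH].
      by rewrite big_nil; under eq_fun do rewrite big_nil; exact: cvg_cst.
    rewrite big_cons; under eq_fun do rewrite big_cons.
    by apply: cvgD => //; apply: ccvg_normsq.
  apply: (@ler_cvg_to _ U _ _ _ _ _ _ lim Mm); apply: (@filterS _ U _ setT); last exact: filterT.
  move=> n _.
  apply: le_trans (fM n); apply: sum_le_nsum => //; last exact/ell2E.
  by move=> v; exact: normsq_ge0.
- by split=> //; apply/ell2E.
Qed.

(** The ultralimit of a minimising sequence lies in [H] and attains the distance, because the norm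
    is lower semicontinuous; closedness under pointwise limits does the work of completeness. *)
Lemma projection (H : (W -> C) -> Prop) :
  H (fun=> 0) ->
  (forall c f h, H f -> H h -> H (fun w => c * f w + h w)) ->
  (forall f, H f -> ell2 f) ->
  (forall (f : nat -> W -> C) g, (forall n, H (f n)) -> ell2 g ->
     (forall w, ccvg (fun n => f n w) (g w)) -> H g) ->
  forall x, ell2 x -> exists2 h, H h & forall f, H f -> inner f (fun w => x w - h w) = 0.
Proof.
move=> H0 Hlin Hell2 Hcl x sx.
pose D : set R := [set r | exists2 h, H h & r = nsq (fun w => x w - h w)].
have hD : has_inf D.
  split; first by exists (nsq (fun w => x w - 0)), (fun=> 0).
  by exists 0 => _ [h _ ->]; exact: nsq_ge0.
pose d := inf D.
have key n : exists h, H h /\ nsq (fun w => x w - h w) <= d + n.+1%:R^-1.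
  have [|_ [h Hh ->] hd] := @inf_adherent R D n.+1%:R^-1 _ hD; first by rewrite invr_gt0.
  by exists h; split=> //; exact: ltW.
have [h hP] := choice key.
have lim0 : d + n.+1%:R^-1 @[n --> U] --> d.
  rewrite -[X in _ --> X]addr0; apply: cvgD; first exact: cvg_cst.
  exact: cvg_oo_ultra cvg_harmonic.
have [n|n|n||y [yl sy yd]] :=
  @weak_compact (fun n w => x w - h n w) (fun n => d + n.+1%:R^-1) (d + 1) d.
- by apply: ell2B => //; apply: Hell2; case: (hP n).
- by case: (hP n).
- by rewrite lerD2l invf_le1 ?ler1n.
- exact: lim0.
pose g w := x w - y w.
have sg : ell2 g by exact: ell2B.
have gl w : ccvg (fun n => h n w) (g w).
  have cx : ccvg (fun=> x w) (x w) by split; exact: cvg_cst.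
  have := ccvgD cx (ccvgZ (-1) (yl w)); rewrite mulN1r.
  by congr (ccvg _ _); apply/funext => n; rewrite mulN1r; ring.
have Hg : H g by apply: Hcl gl => // n; case: (hP n).
exists g => // f Hf.
have xg : (fun w => x w - g w) = y by apply/funext => w; rewrite /g; ring.
rewrite xg; have sf := Hell2 f Hf.
have min c : nsq y <= nsq (fun w => y w + c * f w).
  apply: le_trans yd _; apply: ge_inf; first by case: hD.
  exists (fun w => (- c) * f w + g w); first exact: Hlin.
  by congr nsq; apply/funext => w; rewrite /g; ring.
set z := inner f y.
(* With [e = 1 / (N + 1)], where [N = nsq f] and [q = |z|^2], the variation changes the squared norm
   by [- 2 e q + e^2 q N], which is at most [- e q] because [e N <= 1]; minimality forces
   [q = 0]. *)
have := min ((- (nsq f + 1)^-1)%:C * z); rewrite nsq_expand // (innerC f y) -/z.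
rewrite -mulrA [z * _]mulrC conjc_mul_self -rmorphM /= normsqM normsq_real sqrrN.
set N := nsq f; set q := normsq z.
have N0 : 0 <= N := nsq_ge0 f.
have q0 : 0 <= q := normsq_ge0 z.
move=> le; apply/eqP; rewrite -normsq_eq0 -/q; apply/eqP.
have e0 : 0 < (N + 1)^-1 by rewrite invr_gt0; lra.
have e1 : (N + 1)^-1 * N <= 1 by rewrite mulrC ler_pdivrMr; lra.
move: le; set e := (N + 1)^-1 in e0 e1 *; move=> le.
have : 0 <= - e * q by nra.
nra.
Qed.

End Ultralimits.

Lemma ultra_oo : exists U : set_system nat, UltraFilter U /\ \oo `<=` U.
Proof. exact: ultraFilterLemma. Qed.

Lemma csum_reindex (R : realType) (W W' : choiceType) (D : set W) (D' : set W')
    (t : W -> W') (h : W -> R[i]) (h' : W' -> R[i]) :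
  set_bij D D' t ->
  (forall v, ~ D v -> h v = 0) -> (forall v, ~ D' v -> h' v = 0) ->
  (forall v, D v -> h v = h' (t v)) -> csum h = csum h'.
Proof.
move=> tbij hD hD' hh'; rewrite /csum; congr Complex.
  apply: (rsum_reindex tbij _ _ _).2 => v; first by move=> /hD ->.
    by move=> /hD' ->.
  by move=> /hh' ->.
apply: (rsum_reindex tbij _ _ _).2 => v; first by move=> /hD ->.
  by move=> /hD' ->.
by move=> /hh' ->.
Qed.

(** * Eigenfunctions on non-backtracking words *)

Section Words.
Variables (R : realType) (V E : finType) (G : wgraph R V E).
Local Notation C := R[i].
Local Notation src := (src G).
Local Notation tgt := (tgt G).
Local Notation erev := (erev G).
Local Notation weight := (weight G).
Local Notation pot := (pot G).
Local Notation nb := (nbwalk_from G).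
Implicit Types (e : E) (s t : seq E) (u v : V).

Definition endv u s : V := last u (map tgt s).

Lemma endv_rcons u s e : endv u (rcons s e) = tgt e.
Proof. by rewrite /endv map_rcons last_rcons. Qed.

Lemma endv_cat u s t : endv u (s ++ t) = endv (endv u s) t.
Proof. by rewrite /endv map_cat last_cat. Qed.

Lemma tgt_erev e : tgt (erev e) = src e.
Proof. by rewrite src_erev. Qed.

Lemma src_erev' e : src (erev e) = tgt e.
Proof. by rewrite src_erev erevK. Qed.

Lemma erev_inj : injective erev.
Proof. exact: inv_inj (@erevK _ _ _ G). Qed.

Lemma weight_conj e : Num.conj (weight e) = weight (erev e).
Proof. exact: weight_erev. Qed.

(** The default [e] of [last] makes the third condition vacuous on the empty word, as no edge is its
    own reverse. *)
Lemma nb_rcons u s e :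
  nb u (rcons s e) = [&& nb u s, src e == endv u s & last e s != erev e].
Proof.
have ee : e != erev e by rewrite eq_sym erev_neq.
case: s => [|f s] /=; first by rewrite /nbwalk_from /= ee andbT.
rewrite /nbwalk_from /nbwalk /= rcons_path /endv /= last_map.
have -> : nbstep G (last f s) e = (src e == tgt (last f s)) && (last f s != erev e).
  by rewrite /nbstep eq_sym.
by case: (path _ f s); case: (src f == u); rewrite ?andbT ?andbF.
Qed.

Lemma nb_cons u e s :
  nb u (e :: s) = [&& src e == u, nb (tgt e) s & head e s != erev e].
Proof.
have ee : e != erev e by rewrite eq_sym erev_neq.
case: s => [|f s] /=; first by rewrite /nbwalk_from /= ee andbT.
rewrite /nbwalk_from /nbwalk /=.
have -> : nbstep G e f = (src f == tgt e) && (f != erev e).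
  rewrite /nbstep [src f == _]eq_sym; congr (_ && ~~ _).
  by apply/eqP/eqP => ->; rewrite erevK.
by case: (path _ f s); case: (src e == u); rewrite ?andbT ?andbF.
Qed.

(** For an edge [e] into the end of [s], this is the source of the lift of [e] that ends at [s]:
    either [e] was the last step, which is undone, or [erev e] is appended. The default [erev e] of
    [last] differs from [e], so the empty word is always extended. *)
Definition nbr s e : seq E :=
  if last (erev e) s == e then take (size s).-1 s else rcons s (erev e).

Lemma nbr_nil e : nbr [::] e = [:: erev e].
Proof. by rewrite /nbr /= (negPf (erev_neq _ _)). Qed.

Lemma nbr_rcons s f e :
  nbr (rcons s f) e = if f == e then s else rcons (rcons s f) (erev e).
Proof. by rewrite /nbr last_rcons size_rcons /= -cats1 take_size_cat. Qed.

Lemma nbr1 f e : nbr [:: f] e = if f == e then [::] else [:: f; erev e].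
Proof. exact: (nbr_rcons [::] f e). Qed.

Lemma nbrP u s e : nb u s -> tgt e = endv u s ->
  [/\ nb u (nbr s e), endv u (nbr s e) = src e & nbr (nbr s e) (erev e) = s].
Proof.
have ee : erev e != erev (erev e) by rewrite erevK erev_neq.
case/lastP: s => [_|s f].
  rewrite /endv /= => eu; rewrite nbr_nil nbr1 eqxx.
  by rewrite /nbwalk_from /= src_erev' eu eqxx tgt_erev.
rewrite nbr_rcons endv_rcons => nsf; have [fe|fe] := eqVneq f e => tf.
  move: nsf; rewrite fe nb_rcons => /and3P[ns /eqP se lse]; rewrite -se; split=> //.
  case/lastP: s ns lse se => [|s g] _; rewrite ?nbr_nil ?erevK //.
  by rewrite last_rcons nbr_rcons erevK => /negPf ->.
rewrite nb_rcons nsf endv_rcons last_rcons src_erev' tf eqxx erevK fe.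
by rewrite endv_rcons tgt_erev nbr_rcons eqxx.
Qed.

Definition headis e s : bool := if s is f :: _ then f == e else false.

Definition eshift e s : seq E := if headis (erev e) s then behead s else e :: s.

(** The last claim says that the two branches at an edge, each seen from the opposite end, are
    complementary. *)
Lemma eshiftP e s : nb (tgt e) s ->
  [/\ nb (src e) (eshift e s), endv (src e) (eshift e s) = endv (tgt e) s,
     eshift (erev e) (eshift e s) = s & headis e (eshift e s) = ~~ headis (erev e) s].
Proof.
rewrite /eshift; have [|h] := boolP (headis (erev e) s).
  case: s => [|f s] //= /eqP ->; rewrite nb_cons tgt_erev erevK => /and3P[_ ns hs].
  split=> //; last by case: s hs {ns} => // g s /= /negPf.
    by rewrite /endv /= tgt_erev.
  by case: s hs {ns} => // g s /= /negPf ->.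
move=> ns; rewrite nb_cons eqxx ns /= eqxx erevK /= eqxx; split=> //.
by case: s h {ns} => [|f s] //= _; rewrite eq_sym erev_neq.
Qed.

(** Reduction at the front and at the back of a word commute. They interact only in words of at most
    one letter, where both ends are the same place. *)
Lemma eshift_nbr e s f : nb (tgt e) s -> tgt f = endv (tgt e) s ->
  eshift e (nbr s f) = nbr (eshift e s) f.
Proof.
have en g : (erev g == g) = false := negPf (erev_neq _ _).
have inj g h : (erev g == erev h) = (g == h) by rewrite (inj_eq erev_inj).
case/lastP: s => [|s g].
  rewrite nbr_nil /eshift /= inj nbr1 [e == f]eq_sym => _ _.
  by case: eqP.
rewrite nbr_rcons; case: s => [|h s] /=.
  rewrite /nbwalk_from /endv /= => /eqP sg tf; rewrite /eshift /=.
  have [ge|ge] := eqVneq g (erev e).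
    rewrite nbr_nil; case: eqP => [gf|gf] /=; last by rewrite ge eqxx.
    by rewrite -gf ge erevK.
  by case: eqP => gf //=; rewrite (nbr_rcons [:: e] g f) ?(negPf ge) //; case: eqP.
move=> _ _; rewrite /eshift /=; case: eqP => gf /=; case: eqP => he /=.
- by rewrite nbr_rcons gf eqxx.
- by rewrite -!rcons_cons nbr_rcons gf eqxx.
- by rewrite nbr_rcons; case: eqP.
- by rewrite -!rcons_cons nbr_rcons; case: eqP.
Qed.

Variable lam : R.
Implicit Types f g : seq E -> C.

(** The value of [A_T - lam] at the tree vertex [s], the sum running over the graph edges into the
    end of [s] instead of the tree edges into [s]. *)
Definition opN u f s : C := (pot (endv u s) - lam)%:C * f s +
  \sum_(e | tgt e == endv u s) weight e * f (nbr s e).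

Definition supp u f : Prop := forall s, ~~ nb u s -> f s = 0.

Definition sol u f : Prop :=
  [/\ supp u f, ell2 f & forall s, nb u s -> opN u f s = 0].

Lemma sol_lin u (c : C) f g : sol u f -> sol u g -> sol u (fun s => c * f s + g s).
Proof.
move=> [sf lf ef] [sg lg eg]; split.
- by move=> s ns; rewrite sf // sg // mulr0 addr0.
- by apply: ell2D => //; apply: ell2Z.
move=> s ns; rewrite /opN.
have -> : \sum_(e | tgt e == endv u s) weight e * (c * f (nbr s e) + g (nbr s e)) =
    c * (\sum_(e | tgt e == endv u s) weight e * f (nbr s e)) +
    \sum_(e | tgt e == endv u s) weight e * g (nbr s e).
  by rewrite mulr_sumr -big_split /=; apply: eq_bigr => e _; ring.
have := ef s ns; have := eg s ns; rewrite /opN => /eqP; rewrite addr_eq0 => /eqP e1.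
move=> /eqP; rewrite addr_eq0 => /eqP e2.
by rewrite mulrDr [_ * (c * _)]mulrCA e1 e2; ring.
Qed.

Lemma sol0 u : sol u (fun=> 0).
Proof.
split=> //; first exact: ell2_0.
by move=> s _; rewrite /opN mulr0 big1 ?addr0 // => e _; rewrite mulr0.
Qed.

Lemma solB u f g : sol u f -> sol u g -> sol u (fun s => f s - g s).
Proof.
move=> sf sg; have := sol_lin (-1) sg sf; congr (sol u _).
by apply/funext => s; rewrite mulN1r addrC.
Qed.

Lemma solZ u (c : C) f : sol u f -> sol u (fun s => c * f s).
Proof.
move=> sf; have := sol_lin c sf (sol0 u); congr (sol u _).
by apply/funext => s; rewrite addr0.
Qed.

Lemma nbr_bij u e : set_bij [set s | nb u s /\ endv u s = tgt e]
  [set s | nb u s /\ endv u s = src e] (fun s => nbr s e).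
Proof.
split.
- by move=> s /= [ns es]; have [] := nbrP ns (esym es).
- move=> s t; rewrite !inE /= => -[ns es] [nt et] st.
  by have [_ _ <-] := nbrP ns (esym es); have [_ _ <-] := nbrP nt (esym et); rewrite st.
- move=> s /= [ns es]; have te : tgt (erev e) = endv u s by rewrite tgt_erev.
  have [nt et st] := nbrP ns te; exists (nbr s (erev e)); last by rewrite -{2}(@erevK _ _ _ G e).
  by rewrite src_erev' in et.
Qed.

(** The contribution of one edge to the operator. It is [weight e] times a partial isometry, so
    boundedness and adjointness can be checked edge by edge. *)
Definition hop u e f : seq E -> C := fun s =>
  if nb u s && (tgt e == endv u s) then weight e * f (nbr s e) else 0.

(* Adjointness over all words needs the operator cut off outside the tree. *)
Definition fullN u f : seq E -> C := fun s => if nb u s then opN u f s else 0.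

Lemma ell2_hop u e f : ell2 f -> ell2 (hop u e f).
Proof.
move=> lf; pose f' := restr (fun s => nb u s && (endv u s == src e)) (fun s => weight e * f s).
apply: (ell2_reindex (nbr_bij u e) (f' := f') _ _ _).1.2.
- move=> s /=; rewrite /hop; case: ifP => // /andP[ns /eqP es] []; by split.
- by move=> s /=; rewrite /f' /restr; case: ifP => // /andP[ns /eqP es] []; split.
- move=> s /= [ns es]; rewrite /hop ns es eqxx /= /f' /restr.
  by have [-> -> _] := nbrP ns (esym es); rewrite eqxx.
- exact/ell2_restr/ell2Z.
Qed.

Lemma hop_adj u e f g : inner g (hop u e f) = inner (hop u (erev e) g) f.
Proof.
apply: (csum_reindex (nbr_bij u e)) => s /=.
- by rewrite /hop; case: ifP => [/andP[ns /eqP es] []|]; rewrite ?mulr0.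
- rewrite /hop tgt_erev eq_sym; case: ifP => [/andP[ns /eqP es] []|] //.
  by rewrite rmorph0 mul0r.
move=> [ns es]; have [nt et st] := nbrP ns (esym es).
by rewrite /hop ns es eqxx nt et tgt_erev eqxx st /= rmorphM /= weight_conj erevK; ring.
Qed.

Lemma fullNE u f : supp u f -> fullN u f =
  fun s => (pot (endv u s) - lam)%:C * f s + \sum_e hop u e f s.
Proof.
move=> sf; apply/funext => s; rewrite /fullN /opN /hop; case: ifP => ns.
  by congr (_ + _); rewrite -big_mkcond.
by rewrite sf ?ns // mulr0 big1 ?addr0.
Qed.

Lemma ell2_diag u f : ell2 f -> ell2 (fun s => (pot (endv u s) - lam)%:C * f s).
Proof.
move=> lf; pose B := \sum_v normsq ((pot v - lam)%:C : C).
have B0 : 0 <= B by apply: sumr_ge0 => v _; exact: normsq_ge0.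
(* The factor [B + 1] is chosen because its square dominates [B]. *)
apply: le_ell2 (ell2Z (B + 1)%:C lf) _ => s; rewrite !normsqM ler_wpM2r ?normsq_ge0 //.
apply: (@le_trans _ _ B); last by rewrite normsq_real; nra.
by rewrite /B (bigD1 (endv u s)) //= lerDl sumr_ge0 // => v _; exact: normsq_ge0.
Qed.

Lemma fullN_sym u f g : supp u f -> supp u g -> ell2 f -> ell2 g ->
  inner g (fullN u f) = inner (fullN u g) f.
Proof.
move=> sf sg lf lg; rewrite !fullNE //.
have lh e h : ell2 h -> ell2 (hop u e h) by exact: ell2_hop.
rewrite innerDr //; [|exact: ell2_diag|by apply: ell2_sum => e _; exact: lh].
rewrite innerDl //; [|exact: ell2_diag|by apply: ell2_sum => e _; exact: lh].
congr (_ + _).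
  by congr csum; apply/funext => s; rewrite conjCM conjCR; ring.
rewrite inner_sumr //; last by move=> e _; exact: lh.
rewrite innerC inner_sumr //; last by move=> e _; exact: lh.
rewrite rmorph_sum (reindex_inj erev_inj); apply: eq_bigr => e _ /=.
by rewrite hop_adj erevK innerC.
Qed.

(* [eshift e s] is the reduced form of [e :: s], so that [pull e f] is [f] with
   the root of the tree moved along [e]. *)
Definition pull e f : seq E -> C := fun s => if nb (tgt e) s then f (eshift e s) else 0.

Lemma eshift_bij e : set_bij [set s | nb (tgt e) s] [set s | nb (src e) s] (eshift e).
Proof.
split.
- by move=> s /= ns; have [] := eshiftP ns.
- move=> s t; rewrite !inE /= => ns nt st.
  by have [_ _ <- _] := eshiftP ns; have [_ _ <- _] := eshiftP nt; rewrite st.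
- move=> s /= ns; have ns' : nb (tgt (erev e)) s by rewrite tgt_erev.
  have [nt _ st _] := eshiftP ns'; exists (eshift (erev e) s); first by rewrite src_erev' in nt.
  by rewrite -{1}(@erevK _ _ _ G e).
Qed.

Lemma pull_supp e f : supp (tgt e) (pull e f).
Proof. by move=> s; rewrite /pull => /negPf ->. Qed.

Lemma pull_ell2 e f : supp (src e) f -> (ell2 (pull e f) <-> ell2 f) /\ nsq (pull e f) = nsq f.
Proof.
move=> sf; apply: (ell2_reindex (eshift_bij e)) => s /=.
- by move=> /negP; exact: pull_supp.
- by move=> /negP; exact: sf.
- by rewrite /pull => ->.
Qed.

Lemma pull_inner e f g : supp (src e) f ->
  inner (pull e f) (pull e g) = inner f g.
Proof.
move=> sf; apply: (inner_reindex (eshift_bij e)) => s /=.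
- by move=> /negP; exact: pull_supp.
- by move=> /negP; exact: sf.
- by rewrite /pull => ->.
- by rewrite /pull => ->.
Qed.

Lemma pullK e f : supp (src e) f -> pull (erev e) (pull e f) = f.
Proof.
move=> sf; apply/funext => s; rewrite /pull tgt_erev; case: ifPn => [ns|/sf //].
have ns' : nb (tgt (erev e)) s by rewrite tgt_erev.
by have [] := eshiftP ns'; rewrite erevK src_erev' => -> _ ->.
Qed.

Lemma pull_opN e f s : nb (tgt e) s -> opN (tgt e) (pull e f) s = opN (src e) f (eshift e s).
Proof.
move=> ns; have [_ es _ _] := eshiftP ns; rewrite /opN /pull ns es; congr (_ + _).
apply: eq_bigr => g /eqP tg; have [-> _ _] := nbrP ns tg.
by rewrite eshift_nbr.
Qed.

Lemma pull_sol e f : sol (src e) f -> sol (tgt e) (pull e f).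
Proof.
move=> [sf lf ef]; split; first exact: pull_supp.
  by apply/(pull_ell2 sf).1.
by move=> s ns; rewrite pull_opN // ef //; have [] := eshiftP ns.
Qed.

Lemma sol_closed U (f : nat -> seq E -> C) g u : UltraFilter U ->
  (forall n, sol u (f n)) -> ell2 g -> (forall s, ccvg U (fun n => f n s) (g s)) -> sol u g.
Proof.
move=> UU sf lg fg; split=> //.
  move=> s ns; apply: (ccvg_unique UU (fg s)).
  by rewrite (_ : (fun n => _) = fun=> 0);
    [exact: ccvg0|apply/funext => n; case: (sf n) => ->].
move=> s ns; have lim : ccvg U (fun n => opN u (f n) s) (opN u g s).
  apply: ccvgD => //; first exact: ccvgZ.
  by apply: ccvg_sum => // e _; exact: ccvgZ.
apply: (ccvg_unique UU lim); rewrite (_ : (fun n => _) = fun=> 0); first exact: ccvg0.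
by apply/funext => n; case: (sf n) => _ _ ->.
Qed.

Lemma sol_proj u (x : seq E -> C) : ell2 x ->
  exists2 h, sol u h & forall f, sol u f -> inner f (fun s => x s - h s) = 0.
Proof.
have [U [UU Uoo]] := ultra_oo.
apply: (@projection R U UU Uoo _ (sol u)); first exact: sol0.
- by move=> c f h; exact: sol_lin.
- by move=> f [].
- by move=> f g sf lg fg; exact: sol_closed fg.
Qed.

(** The orthogonal projection of the delta function at the root works: pairing with a solution does
    not see the part that was projected away. *)
Lemma sol_kernel_ex u : exists k, sol u k /\ forall f, sol u f -> inner k f = f [::].
Proof.
have ld : ell2 (delta R ([::] : seq E)) := (nsq_delta R [::]).1.
have [k sk kP] := sol_proj u ld; exists k; split=> // f sf.
have lk : ell2 k by case: sk.
have lf : ell2 f by case: sf.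
have := kP f sf; rewrite innerBr // => /eqP; rewrite subr_eq0 => /eqP e.
by rewrite innerC -e -innerC inner_deltal.
Qed.

(* The reproducing kernel, at the root, of the space of solutions. *)
Definition rk u : seq E -> C := projT1 (cid (sol_kernel_ex u)).

Lemma rk_sol u : sol u (rk u).
Proof. by rewrite /rk; case: cid => k []. Qed.

Lemma rkP u f : sol u f -> inner (rk u) f = f [::].
Proof. by rewrite /rk; case: cid => k [_ kP] /= /kP. Qed.

Lemma rk_ell2 u : ell2 (rk u).
Proof. by case: (rk_sol u). Qed.

Definition rkp u : R := nsq (rk u).

Lemma rkpE u : rkp u = nsq (rk u).
Proof. by []. Qed.

Lemma rkp_ge0 u : 0 <= rkp u.
Proof. exact: nsq_ge0. Qed.

Lemma rk_nil u : rk u [::] = (rkp u)%:C.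
Proof. by rewrite -(rkP (rk_sol u)) inner_self //; exact: rk_ell2. Qed.

Lemma eval_le u f : sol u f -> normsq (f [::]) <= rkp u * nsq f.
Proof.
move=> sf; rewrite -(rkP sf) /rkp. apply: inner_CauchySchwarz; first exact: rk_ell2.
by case: sf.
Qed.

Lemma rkp0 u f : rkp u = 0 -> sol u f -> f [::] = 0.
Proof.
move=> p0 sf; apply/eqP; rewrite -normsq_eq0 eq_le normsq_ge0 andbT.
by apply: le_trans (eval_le sf) _; rewrite p0 mul0r.
Qed.

End Words.

Lemma nsum_sum (R : realType) (W : choiceType) (I : Type) (r : seq I) (P : pred I) (F : I -> W -> R) :
  (forall i v, 0 <= F i v) -> (forall i, P i -> absum (F i)) ->
  nsum (fun v => \sum_(i <- r | P i) F i v) = \sum_(i <- r | P i) nsum (F i).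
Proof.
move=> F0 sF; elim: r => [|i r IH].
  by rewrite big_nil /nsum esum1 // => v _; rewrite big_nil.
rewrite big_cons; case: (boolP (P i)) => Pi.
  rewrite -IH -nsumD //; [|by move=> v; exact: sumr_ge0|exact: sF|exact: absum_sum].
  by congr nsum; apply/funext => v; rewrite big_cons Pi.
by rewrite -IH; congr nsum; apply/funext => v; rewrite big_cons (negPf Pi).
Qed.

(** * Upper bound *)

Section Masses.
Variables (R : realType) (V E : finType) (G : wgraph R V E) (lam : R).
Local Notation C := R[i].
Local Notation src := (src G).
Local Notation tgt := (tgt G).
Local Notation erev := (erev G).
Local Notation weight := (weight G).
Local Notation pot := (pot G).
Local Notation nb := (nbwalk_from G).
Local Notation sol := (sol G lam).
Local Notation rk := (rk G lam).
Local Notation rkp := (rkp G lam).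
Local Notation opL := (opN G lam).
Local Notation fullL := (fullN G lam).
Implicit Types (e : E) (s t : seq E) (u v : V) (f g : seq E -> C).

Lemma nsq_heads f : ell2 f ->
  nsq f = normsq (f [::]) + \sum_e nsq (restr (headis e) f).
Proof.
move=> lf; have n0 g s : 0 <= normsq (g s : C) by exact: normsq_ge0.
have [||sn nn] := @nsum1 R _ ([::] : seq E) (fun s => if s == [::] then normsq (f s) else 0).
- by move=> s; case: ifP.
- by move=> s /negPf ->.
rewrite eqxx in nn; rewrite -{1}nn -nsum_sum //; last first.
  by move=> e _; apply/ell2E/ell2_restr.
rewrite -nsumD //; first last.
- by apply: absum_sum => e _; apply/ell2E/ell2_restr.
- by move=> s; exact: sumr_ge0.
- by move=> s; case: ifP.
congr nsum; apply/funext => -[|e s] /=.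
  by rewrite big1 ?addr0 // => e _; rewrite /restr normsq0.
rewrite add0r (bigD1 e) //= big1 ?addr0 /restr /= ?eqxx // => e' /negPf ee'.
by rewrite eq_sym ee' normsq0.
Qed.

Lemma headis_nbr e s (f : E) : s != [::] -> nbr G s f != [::] -> headis e (nbr G s f) = headis e s.
Proof.
case/lastP: s => [//|s g] _; rewrite nbr_rcons; have [_|_] := eqVneq g f; last by case: s.
by case: s => [|h s].
Qed.

Lemma fullN_sol u f : sol u f -> fullL u f = fun=> 0.
Proof. by move=> [_ _ ef]; apply/funext => s; rewrite /fullN; case: ifP => // /ef. Qed.

Definition spike (c : C) : seq E -> C := fun s => if s == [::] then c else 0.

Lemma spikeP (c : C) : ell2 (spike c) /\ forall f, ell2 f -> inner f (spike c) = Num.conj (f [::]) * c.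
Proof.
have -> : spike c = (fun s => c * delta R ([::] : seq E) s).
  by apply/funext => s; rewrite /spike /delta; case: eqP; rewrite ?mulr1 ?mulr0.
have [ld _] := nsq_delta R ([::] : seq E); split; first exact: ell2Z.
by move=> f lf; rewrite innerZr // mulrC innerC inner_deltal.
Qed.

(* Cutting a solution down to the branch of the tree behind [e] spoils the
   equation only at the root, when nothing flows through [e] from the root. *)
Lemma branchN e f : sol (src e) f -> weight e * f [::] = 0 ->
  fullL (src e) (restr (headis e) f) = spike (weight (erev e) * f [:: e]).
Proof.
move=> [sf _ ef] w0; apply/funext => s; rewrite /fullN /spike; case: ifPn => ns; last first.
  by case: eqP ns => [->|].
case: (eqVneq s [::]) => [->|s0].
  rewrite /opN /restr /= mulr0 add0r (bigD1 (erev e)) /= ?tgt_erev // nbr_nil /= erevK eqxx.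
  rewrite big1 ?addr0 // => g /andP[_ ge]; rewrite nbr_nil /=.
  case: eqP => gE; last by rewrite mulr0.
  by rewrite -gE erevK eqxx in ge.
case: (boolP (headis e s)) => he; last first.
  rewrite /opN {1}/restr (negPf he) mulr0 add0r big1 // => g _.
  rewrite /restr; have [->|n0] := eqVneq (nbr G s g) [::]; first by rewrite mulr0.
  by rewrite headis_nbr // (negPf he) mulr0.
rewrite -[RHS](ef s ns) /opN {1}/restr he; congr (_ + _); apply: eq_bigr => g /eqP tg.
rewrite /restr; have [n0|n0] := eqVneq (nbr G s g) [::]; last by rewrite headis_nbr // he.
rewrite n0 /= mulr0; case: s he s0 n0 ns tg => [//|h s] /eqP -> _ n0 ns tg.
suff -> : g = e by rewrite w0.
move: n0; case/lastP: s ns tg => [|s k] ns tg; first by rewrite nbr1; case: eqP.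
by rewrite -rcons_cons nbr_rcons; case: eqP.
Qed.

Lemma fullN_solP u f : supp G u f -> ell2 f -> fullL u f = (fun=> 0) -> sol u f.
Proof.
move=> sf lf ef; split=> // s ns; have := congr1 (@^~ s) ef.
by rewrite /fullN ns.
Qed.

Lemma restr_supp u (S : pred (seq E)) f : supp G u f -> supp G u (restr S f).
Proof. by move=> sf s ns; rewrite /restr sf //; case: ifP. Qed.

(** The part of [f] behind [e] solves the equation up to a spike at the root of height [weight (erev
    e) * f [:: e]]. By symmetry of the operator this spike is orthogonal to the kernel, whose value
    at the root is positive. *)
Lemma neighbour0 e f : sol (src e) f -> f [::] = 0 -> weight e != 0 -> 0 < rkp (src e) ->
  f [:: e] = 0.
Proof.
move=> sf f0 w0 p0; set g := restr (headis e) f.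
have [su lf _] := sf; have lg : ell2 g by exact: ell2_restr.
have sg : supp G (src e) g by exact: restr_supp.
have gN : fullL (src e) g = spike (weight (erev e) * f [:: e]).
  by apply: branchN => //; rewrite f0 mulr0.
have [sr lr _] := rk_sol G lam (src e).
have := fullN_sym lam sg sr lg lr; rewrite gN (fullN_sol (rk_sol _ _ _)) (spikeP _).2 //.
rewrite rk_nil conjCR (_ : (fun=> 0) = (fun s => 0 * g s)); last first.
  by apply/funext => s; rewrite mul0r.
rewrite innerZl // rmorph0 mul0r => /eqP.
rewrite mulf_eq0 -weight_conj mulf_eq0 conjC_eq0 (negPf w0) /=.
by rewrite eq_complex /= eqxx andbT (gt_eqF p0) => /eqP.
Qed.

Lemma sol_inner_eq u k k' : sol u k -> sol u k' ->
  (forall f, sol u f -> inner k f = inner k' f) -> k = k'.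
Proof.
move=> sk sk' kk'; have sd := solB sk sk'.
have [_ ld _] := sd; have [_ lk _] := sk; have [_ lk' _] := sk'.
have d0 : inner (fun s => k s - k' s) (fun s => k s - k' s) = 0.
  rewrite innerC innerBr // [X in X - _]innerC [X in _ - X]innerC.
  by rewrite kk' // subrr rmorph0.
have := nsq_eq0 ld _; rewrite inner_self // in d0.
by case: d0 => -> /(_ erefl) e; apply/funext => s; apply/eqP; rewrite -subr_eq0 (congr1 (@^~ s) e).
Qed.

Lemma pull_rev_sol e f : sol (tgt e) f -> sol (src e) (pull G (erev e) f).
Proof. by move=> sf; have := @pull_sol _ _ _ G lam (erev e) f; rewrite src_erev' tgt_erev; apply. Qed.

(** Moving the root is unitary, so the kernel at [src e], seen from [tgt e], represents evaluation
    at the neighbour [[:: erev e]]. *)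
Lemma pull_rk e f : sol (tgt e) f -> inner (pull G e (rk (src e))) f = f [:: erev e].
Proof.
move=> sf; have [su _ _] := sf.
have e1 : pull G e (pull G (erev e) f) = f.
  by have := @pullK _ _ _ G (erev e) f; rewrite src_erev' erevK; apply.
have [sr _ _] := rk_sol G lam (src e).
rewrite -{1}e1 pull_inner // rkP; last exact: pull_rev_sol.
by rewrite /pull tgt_erev /eshift /=.
Qed.

Lemma pull_rk_rev e f : sol (src e) f -> inner (pull G (erev e) (rk (tgt e))) f = f [:: e].
Proof. by move=> sf; have := @pull_rk (erev e) f; rewrite tgt_erev src_erev' erevK; apply. Qed.

Lemma restr_pull e f : restr (headis (erev e)) (pull G e f) =
  pull G e (restr (predC (headis e)) f).
Proof.
apply/funext => s; rewrite /restr /pull /=; case: (boolP (nb (tgt e) s)) => ns; last by case: ifP.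
by have [_ _ _ ->] := eshiftP ns; rewrite negbK; case: ifP.
Qed.

(** The proportion m(e) of the overview is [mass e / rkp (src e)]; the unnormalised mass keeps its
    meaning where [rkp] vanishes. *)
Definition mass e : R := nsq (restr (headis e) (rk (src e))).

Lemma mass_ge0 e : 0 <= mass e.
Proof. exact: nsq_ge0. Qed.

Lemma nsq_branch e : nsq (restr (headis (erev e)) (pull G e (rk (src e)))) = rkp (src e) - mass e.
Proof.
have [sr lr _] := rk_sol G lam (src e).
rewrite restr_pull (pull_ell2 (restr_supp _ sr)).2 rkpE (nsq_restr (headis e) lr) /mass.
by rewrite addrC addKr.
Qed.

(** The squared norm of the kernel is sorted by first letters; the root contributes [rkp u ^+ 2]
    because the value of the kernel there is its squared norm. *)
Lemma rkp_split u : rkp u = rkp u ^+ 2 + \sum_(e | src e == u) mass e.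
Proof.
rewrite {1}rkpE nsq_heads; last exact: rk_ell2.
rewrite rk_nil normsq_real; congr (_ + _).
rewrite [RHS]big_mkcond /=; apply: eq_bigr => e _; case: eqP => [<- //|eu].
rewrite (_ : restr _ _ = fun=> 0); first by rewrite /nsq /nsum esum1 // => s _; rewrite normsq0.
apply/funext => s; rewrite /restr; case: s => [//|h s] /=; case: eqP => // ->.
have [-> //] := rk_sol G lam u.
by rewrite nb_cons; move/eqP/negPf: eu => ->.
Qed.

(** A branch behind an edge of weight zero decouples, so the kernel cut down to it is again a
    solution. Its pairing with the kernel is the mass, and by the reproducing property also its
    value at the root, which is 0. *)
Lemma mass_weight0 e : weight e = 0 -> mass e = 0.
Proof.
move=> w0; have sr := rk_sol G lam (src e); have [su lr _] := sr.
have sh : sol (src e) (restr (headis e) (rk (src e))).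
  apply: fullN_solP; [exact: restr_supp|exact: ell2_restr|].
  rewrite branchN ?w0 ?mul0r // -weight_conj w0 rmorph0 mul0r.
  by apply/funext => s; rewrite /spike; case: ifP.
have := rkP sh; rewrite {2}/restr /= -restr_restr -inner_restr inner_self; last exact: ell2_restr.
by rewrite /mass; case.
Qed.

(** By [neighbour0], evaluation across [e] is a multiple of evaluation at the root, so the kernel at
    [tgt e], moved to [src e], is a multiple of the kernel at [src e]. Comparing the norms on the
    whole tree and on the branch behind [e] gives the identity. *)
Lemma mass_int e : weight e != 0 -> 0 < rkp (src e) -> 0 < rkp (tgt e) ->
  mass e / rkp (src e) + mass (erev e) / rkp (tgt e) = 1.
Proof.
move=> w0 pu pv; set u := src e; set v := tgt e.
set k := pull G (erev e) (rk v); set r := rk u [:: e] / (rkp u)%:C.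
have sk : sol u k by apply: pull_rev_sol; exact: rk_sol.
have rE f : sol u f -> f [:: e] = r * f [::].
  move=> sf; have sg := solB sf (solZ (f [::] / (rkp u)%:C) (rk_sol G lam u)).
  have p0 : (rkp u)%:C != 0 by rewrite eq_complex /= eqxx andbT gt_eqF.
  have := neighbour0 sg _ w0 pu; rewrite rk_nil divfK // subrr => /(_ erefl) /eqP.
  by rewrite subr_eq0 => /eqP ->; rewrite /r mulrAC [RHS]mulrC mulrA.
have kE : k = (fun s => Num.conj r * rk u s).
  apply: (@sol_inner_eq u) => //; first by apply: solZ; exact: rk_sol.
  move=> f sf; have [_ lf _] := sf; rewrite innerZl //; last exact: rk_ell2.
  by rewrite conjCK rkP // pull_rk_rev // rE.
have [sv lv _] := rk_sol G lam v.
have nk : nsq k = rkp v.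
  by rewrite /k (pull_ell2 _).2 // src_erev'.
have nk' : nsq k = normsq r * rkp u.
  by rewrite kE nsqZ ?normsq_conj //; exact: rk_ell2.
have hk : nsq (restr (headis e) k) = rkp v - mass (erev e).
  by have := nsq_branch (erev e); rewrite erevK src_erev'.
have hk' : nsq (restr (headis e) k) = normsq r * mass e.
  rewrite kE -(normsq_conj r) -nsqZ; last by apply: ell2_restr; exact: rk_ell2.
  by congr nsq; apply/funext => s; rewrite /restr; case: ifP; rewrite ?mulr0.
have rr : normsq r = rkp v / rkp u by rewrite -nk nk' mulfK // gt_eqF.
rewrite hk' rr in hk.
have -> : mass (erev e) = rkp v - rkp v / rkp u * mass e by rewrite hk; ring.
by rewrite -/u; field; rewrite !gt_eqF.
Qed.

(** At the common vertex [v] the proportions of the outgoing edges and [rkp v] add up to 1. The edge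
    [erev e] takes 1 - m(e), so at most m(e) - [rkp v] is left for [f]. *)
Lemma mass_lt e (f : E) : nbstep G e f -> weight e != 0 -> 0 < rkp (src e) ->
  0 < rkp (src f) -> mass f / rkp (src f) < mass e / rkp (src e).
Proof.
move=> /andP[/eqP tef ef] w0 pu pv; rewrite -tef in pv *.
have := mass_int w0 pu pv; set v := tgt e => E1.
have := rkp_split v; rewrite (bigD1 (erev e)) /= ?src_erev' // (bigD1 f) /=; last first.
  rewrite -tef eqxx /=; apply: contra ef => /eqP ->; by rewrite erevK.
set S := \sum_(_ | _) _; have S0 : 0 <= S by apply: sumr_ge0 => i _; exact: mass_ge0.
move=> E2; have E3 : mass f / rkp v <= 1 - rkp v - mass (erev e) / rkp v.
  rewrite ler_pdivrMr // !mulrBl divfK ?gt_eqF //; rewrite expr2 in E2; lra.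
lra.
Qed.

(** The functions [h e], scaled branches of the kernels at the live neighbours, all solve the
    equation up to the same delta function at the root. They share their component orthogonal to the
    solutions, and the equation of this component at the root is the asserted sum. *)
Lemma mass_boundary v : rkp v = 0 ->
  (exists e, [/\ tgt e = v, weight e != 0 & 0 < rkp (src e)]) ->
  \sum_(e | [&& tgt e == v, weight e != 0 & 0 < rkp (src e)]) mass e / rkp (src e) = 1.
Proof.
move=> pv0 [e0 [te0 we0 pe0]].
pose k e := pull G e (rk (src e)).
pose c e := weight e * (rkp (src e))%:C.
pose h e s := (c e)^-1 * restr (headis (erev e)) (k e) s.
pose good e := [&& tgt e == v, weight e != 0 & 0 < rkp (src e)].
have sk e : tgt e = v -> sol v (k e) by move=> <-; apply: pull_sol; exact: rk_sol.
have k0 e : tgt e = v -> k e [::] = 0 by move=> te; apply: (rkp0 pv0); exact: sk.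
have ke e : k e [:: erev e] = (rkp (src e))%:C.
  have nbe : nb (tgt e) [:: erev e] by rewrite /nbwalk_from /= src_erev' eqxx.
  by rewrite /k /pull nbe /eshift /= eqxx rk_nil.
have c0 e : good e -> c e != 0.
  move=> /and3P[_ w0 p0]; rewrite mulf_neq0 // eq_complex /= eqxx andbT gt_eqF //.
have lh e : tgt e = v -> ell2 (h e).
  by move=> te; have [_ lk _] := sk e te; apply/ell2Z/ell2_restr.
have suh e : tgt e = v -> supp G v (h e).
  move=> te s ns; have [su _ _] := sk e te; rewrite /h (restr_supp _ su) ?mulr0 //.
have opZ u (z : C) f s : opL u (fun s => z * f s) s = z * opL u f s.
  rewrite /opN mulrDr mulr_sumr mulrCA; congr (_ + _); apply: eq_bigr => e _; ring.
have opB u f g s : opL u (fun s => f s - g s) s = opL u f s - opL u g s.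
  rewrite /opN opprD addrACA -sumrB mulrBr; congr (_ + _); apply: eq_bigr => e _; ring.
have hN e s : good e -> nb v s -> opL v (h e) s = spike 1 s.
  move=> ge ns; have /and3P[/eqP te _ _] := ge.
  rewrite /h opZ; have := @branchN (erev e) (k e); rewrite src_erev' te.
  move=> /(_ (sk e te)); rewrite k0 // mulr0 => /(_ erefl) /(congr1 (@^~ s)).
  rewrite /fullN ns => ->; rewrite erevK ke -/(c e) /spike.
  by case: eqP => _; rewrite ?mulr0 // mulVf // c0.
have ge0 : good e0 by rewrite /good te0 eqxx we0.
(* The difference [g] of [h e0] and [q] is orthogonal to all solutions and differs from every good
   [h e] by a solution, so the choice of [e0] does not matter. *)
have [q sq qP] := sol_proj G lam v (lh e0 te0).
pose g s := h e0 s - q s.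
have [suq lq eq] := sq.
have lg : ell2 g by apply: ell2B => //; exact: lh.
have gN : opL v g [::] = 1.
  by rewrite opB hN // eq // subr0.
have g0 : g [::] = 0.
  by rewrite /g /h /restr /= mulr0 (rkp0 pv0 sq) subrr.
move: gN; rewrite /opN g0 mulr0 add0r => gN.
have term e : tgt e == v -> weight e * g (nbr G [::] e) = (if good e then mass e / rkp (src e) else 0)%:C.
  move=> /eqP te; rewrite nbr_nil; case: ifPn => ge; last first.
    have [->|w0] := eqVneq (weight e) 0; first by rewrite mul0r.
    have pe : rkp (src e) = 0.
      apply/eqP; move: ge; rewrite /good te eqxx w0 /= lt0r rkp_ge0 andbT negbK //.
    rewrite /g /h /restr /=.
    have -> : (erev e == erev e0) = false.
      by apply/eqP => /erev_inj ee; rewrite ee ge0 in ge.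
    have [suk lk _] := sk e te.
    (* A dead neighbour has the zero kernel, so the solution [q] vanishes there. *)
    have kz : k e = fun=> 0.
      apply: nsq_eq0 => //; rewrite /k (pull_ell2 _).2 //.
      by have [] := rk_sol G lam (src e).
    have <- : inner (k e) q = q [:: erev e] by apply: pull_rk; rewrite te.
    rewrite kz (_ : (fun=> 0) = (fun s => 0 * q s)); last by apply/funext => s; rewrite mul0r.
    by rewrite innerZl // rmorph0 mul0r mulr0 subr0 mulr0.
  have /and3P[_ w0 pe] := ge.
  have sq' : sol v (fun s => h e s - g s).
    split.
    - by move=> s ns; rewrite /g !suh // suq // !subr0.
    - by apply: ell2B => //; exact: lh.
    - by move=> s ns; rewrite opB hN // opB hN // eq // subr0 subrr.
  have [_ lk _] := sk e te.
  (* [k e] evaluates the solution [h e - g] at the neighbour and is itself orthogonal to [g]; this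
     expresses the value of [g] there through [h e] alone. *)
  have := pull_rk (_ : sol (tgt e) (fun s => h e s - g s)); rewrite te => /(_ sq').
  rewrite -/(k e) innerBr //; last exact: lh.
  rewrite qP ?subr0; last exact: sk.
  have -> : inner (k e) (h e) = (c e)^-1 * (rkp (src e) - mass e)%:C.
    rewrite /h innerZr //; last exact: ell2_restr.
    rewrite -restr_restr -inner_restr inner_self; last exact: ell2_restr.
    by rewrite nsq_branch.
  move=> E1; have -> : g [:: erev e] = h e [:: erev e] - (h e [:: erev e] - g [:: erev e]).
    by ring.
  rewrite -E1 {1}/h /restr /= eqxx ke -mulrBr -rmorphB /= opprB addrCA subrr addr0.
  by rewrite mulrA /c invfM mulrA mulfV // mul1r mulrC -fmorphV -rmorphM.
have : (\sum_(e | tgt e == v) (if good e then mass e / rkp (src e) else 0))%:C = 1 :> C.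
  by rewrite rmorph_sum /= -gN; apply: eq_bigr => e te; rewrite term.
case=> <-; rewrite -big_mkcondr; apply: eq_bigl => e /=.
by rewrite /good; case: (tgt e == v).
Qed.

End Masses.

(** * Non-backtracking walks and trees inside a vertex set *)

Section Forest.
Variables (R : realType) (V E : finType) (G : wgraph R V E).
Local Notation src := (src G).
Local Notation tgt := (tgt G).
Local Notation erev := (erev G).
Local Notation weight := (weight G).
Local Notation nb := (nbwalk_from G).
Local Notation ev := (endv G).
Variable X : {set V}.
Implicit Types (e : E) (s t : seq E) (u v : V).

Definition intE e : bool := [&& weight e != 0, src e \in X & tgt e \in X].

Definition intEset : {set E} := [set e | intE e].

Definition exitE e : bool := [&& weight e != 0, src e \in X & tgt e \notin X].

Definition bdry : {set V} := [set v | [exists e, exitE e && (tgt e == v)]].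

Definition istep : rel V := fun u v => [exists e, [&& intE e, src e == u & tgt e == v]].

Definition conn : rel V := connect istep.

Definition ccomp u : {set V} := [set v | conn u v].

(** Unlike in [acyclic], the closing step of the cycle is non-backtracking too; [closed_cycle]
    bridges the difference. *)
Definition forest : Prop := forall c, c != [::] -> all intE c -> ~~ cycle (nbstep G) c.

Lemma intE_erev e : intE (erev e) = intE e.
Proof.
rewrite /intE src_erev' tgt_erev -weight_conj conjC_eq0.
by congr (_ && _); rewrite andbC.
Qed.

Lemma istep_sym : symmetric istep.
Proof.
suff H u v : istep u v -> istep v u by move=> u v; apply/idP/idP; exact: H.
move=> /existsP[e /and3P[ie /eqP su /eqP tv]]; apply/existsP; exists (erev e).
by rewrite intE_erev ie src_erev' tgt_erev su tv !eqxx.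
Qed.

Lemma conn_sym u v : conn u v = conn v u.
Proof. exact: (sym_connect_sym istep_sym). Qed.

Lemma conn_edge e : intE e -> conn (src e) (tgt e).
Proof. by move=> ie; apply: connect1; apply/existsP; exists e; rewrite ie !eqxx. Qed.

Lemma conn_in u v : conn u v -> u \in X -> v \in X.
Proof.
move=> /connectP[p pp ->]; elim: p u pp => [//|w p IH] u /= /andP[/existsP[e]].
by move=> /and3P[/and3P[_ _ tX] _ /eqP <-] pp _; apply: IH.
Qed.

Definition nbX u s : bool := nb u s && all intE s.

Lemma nbX_rcons u s e : nbX u (rcons s e) =
  [&& nbX u s, src e == ev u s, last e s != erev e & intE e].
Proof.
rewrite /nbX nb_rcons all_rcons; case: (nb u s); case: (src e == _) => //=.
by case: (last e s != _); case: (intE e); case: (all intE s).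
by case: (all intE s). Qed.

Lemma nbX_nbr u s e : nbX u s -> tgt e = ev u s -> intE e -> nbX u (nbr G s e).
Proof.
move=> /andP[ns Xs] te ie; have [nt _ _] := nbrP ns te; rewrite /nbX nt /=.
rewrite /nbr; case: ifP => _; last by rewrite all_rcons Xs andbT intE_erev.
by apply/allP => f /mem_take; exact/allP.
Qed.

Lemma conn_path u v : conn u v -> exists s, nbX u s /\ ev u s = v.
Proof.
move=> /connectP[p pp ->]; elim/last_ind: p pp => [|p w IH].
  by move=> _; exists [::].
rewrite rcons_path last_rcons => /andP[pp /existsP[e /and3P[ie /eqP se /eqP te]]].
have [s [ns es]] := IH pp; exists (nbr G s (erev e)).
have te' : tgt (erev e) = ev u s by rewrite tgt_erev es se.
have /andP[ns' _] := ns; have [_ -> _] := nbrP ns' te'.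
by rewrite src_erev'; split=> //; apply: nbX_nbr; rewrite ?intE_erev.
Qed.

Lemma nbX_conn u s : nbX u s -> conn u (ev u s).
Proof.
elim/last_ind: s => [_|s e IH]; first exact: connect0.
rewrite nbX_rcons endv_rcons => /and4P[ns /eqP se _ ie].
by apply: connect_trans (IH ns) _; rewrite -se; exact: conn_edge.
Qed.

Lemma nbX_cons u e s : nbX u (e :: s) =
  [&& src e == u, intE e, nbX (tgt e) s & head e s != erev e].
Proof.
rewrite /nbX nb_cons /=; case: (src e == u); case: (nb (tgt e) s) => //=; rewrite ?andbF //=.
by case: (head e s != _); case: (intE e); case: (all intE s). Qed.

(** As long as the last edge reverses the first, both are removed. What remains is a shorter closed
    walk, and it is not empty since [[:: e; erev e]] backtracks. *)
Lemma closed_cycle u s : s != [::] -> nbX u s -> ev u s = u ->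
  exists c, [/\ c != [::], all intE c & cycle (nbstep G) c].
Proof.
have [n] := ubnP (size s); elim: n s u => [//|n IH] [//|e s] u /= sn _.
move=> nes ues; have [le|le] := eqVneq (last e s) (erev e); last first.
  exists (e :: s); move: nes => /andP[/andP[ns /eqP se] al]; split=> //=.
  rewrite /nbwalk /= in ns; rewrite rcons_path ns /nbstep le andbT /=.
  by rewrite se -ues /endv /= last_map.
case/lastP: s le sn nes ues => [|s f]; first by move=> /= le; move: (erev_neq G e); rewrite -le eqxx.
rewrite last_rcons => -> sn; rewrite nbX_cons => /and4P[/eqP se ie ns hs] ues.
have s0 : s != [::] by case: (s) hs => //=; rewrite eqxx.
move: ns; rewrite nbX_rcons => /and4P[ns /eqP ss _ _].
apply: (IH s (tgt e)) => //; last by rewrite -ss src_erev'.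
by move: sn; rewrite size_rcons ltnS => /ltnW.
Qed.

Lemma nbX_rev u s : nbX u s -> nbX (ev u s) (rev (map erev s)).
Proof.
elim/last_ind: s => [//|s e IH]; rewrite nbX_rcons endv_rcons => /and4P[ns /eqP se ls ie].
rewrite map_rcons rev_rcons nbX_cons src_erev' eqxx intE_erev ie tgt_erev se IH //=.
case/lastP: s ls {IH ns se} => [|s f]; first by rewrite /= erevK erev_neq.
rewrite last_rcons map_rcons rev_rcons /= erevK; apply: contra => /eqP <-.
by rewrite erevK.
Qed.

Lemma nbX_cat u s e t : nbX u (rcons s e) -> nbX (tgt e) t -> head (erev (erev e)) t != erev e ->
  nbX u (rcons s e ++ t).
Proof.
move=> ns; elim/last_ind: t => [|t f IH]; first by rewrite cats0.
rewrite nbX_rcons => /and4P[nt /eqP sf lf iF] hf; rewrite -rcons_cat nbX_rcons iF andbT.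
apply/and3P; split.
- by apply: IH => //; case: (t) hf nt => // _ _; rewrite /= erevK eq_sym erev_neq.
- by rewrite endv_cat endv_rcons sf.
- rewrite last_cat last_rcons; case: (t) lf hf => [_|//] /=.
  by apply: contra => /eqP ->; rewrite erevK.
Qed.

(** Equal last edges are stripped; if they differ, one word followed by the reverse of the other is
    a closed non-backtracking walk. *)
Lemma nbX_unique u s t : forest -> nbX u s -> nbX u t -> ev u s = ev u t -> s = t.
Proof.
move=> F; elim/last_ind: s t => [|s e IH] t.
  move=> _ nt et; case: (eqVneq t [::]) => // t0.
  by have [c [c0 ac cc]] := closed_cycle t0 nt (esym et); have := F c c0 ac; rewrite cc.
move=> nse; case/lastP: t => [_ et|t f ntf].
  have s0 : rcons s e != [::] by case: (s).
  by have [c [c0 ac cc]] := closed_cycle s0 nse et; have := F c c0 ac; rewrite cc.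
rewrite !endv_rcons => ef; have [fe|fe] := eqVneq e f.
  move: nse ntf; rewrite fe !nbX_rcons => /and4P[ns /eqP se _ _] /and4P[nt /eqP sf _ _].
  by rewrite (IH t) // -se -sf.
have nr := nbX_rev ntf; rewrite endv_rcons -ef in nr.
have ncl : nbX u (rcons s e ++ rev (map erev (rcons t f))).
  apply: nbX_cat => //; rewrite map_rcons rev_rcons /=.
  by rewrite (inj_eq (@erev_inj _ _ _ G)) eq_sym.
have cl : ev u (rcons s e ++ rev (map erev (rcons t f))) = u.
  rewrite endv_cat endv_rcons.
  have : nb u (rcons t f) by case/andP: ntf.
  case: (t) => [|g t'] /=; first by rewrite nb_cons => /and3P[/eqP <- _ _]; rewrite /endv /= tgt_erev.
  rewrite nb_cons => /and3P[/eqP <- _ _]; rewrite rev_cons endv_rcons.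
  by rewrite tgt_erev.
have c0 : rcons s e ++ rev (map erev (rcons t f)) != [::] by case: (s).
by have [c [c0' ac cc]] := closed_cycle c0 ncl cl; have := F c c0' ac; rewrite cc.
Qed.

(** The word [[::]] for vertices that are not connected is a dummy, so statements about [pth] are
    guarded by [conn]. *)
Definition pth u v : seq E :=
  if pselect (exists s, nbX u s /\ ev u s = v) is left h then projT1 (cid h) else [::].

Lemma pthP u v : conn u v -> nbX u (pth u v) /\ ev u (pth u v) = v.
Proof. by move=> /conn_path h; rewrite /pth; case: pselect => // h'; case: cid. Qed.

Lemma pth_eq u s : forest -> nbX u s -> pth u (ev u s) = s.
Proof.
move=> F ns; have [np ep] := pthP (nbX_conn ns).
exact: (nbX_unique F np ns ep).
Qed.

Definition croots : {set V} := [set u in X | fingraph.root istep u == u].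

(* Each vertex other than the root of its tree owns the edge that leads to it
   from the root, and this edge is not the reverse of another such edge. *)
Lemma forest_edges : forest -> (2 * #|X| <= #|intEset| + 2 * #|croots|)%N.
Proof.
move=> F; pose rt := fingraph.root istep; pose N := X :\: croots.
have rtc u : conn (rt u) u by rewrite conn_sym; exact: connect_root.
have rtE u v : conn u v -> rt u = rt v.
  by move=> uv; apply/eqP; rewrite (root_connect (sym_connect_sym istep_sym)).
pose lst (s : seq E) : option E := if s is x :: r then Some (last x r) else None.
have lst_rcons s e : lst (rcons s e) = Some e by case: s => //= a s; rewrite last_rcons.
pose f u := lst (pth (rt u) u).
have fP u : u \in N -> exists s e, [/\ pth (rt u) u = rcons s e, nbX (rt u) (rcons s e), tgt e = u & f u = Some e].
  rewrite inE => /andP[nr uX]; have [np ep] := pthP (rtc u).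
  rewrite /f; case/lastP: (pth _ _) np ep => [|s e] np ep.
    by move: nr; rewrite inE uX -/(rt u) -{2}ep eqxx.
  by exists s, e; rewrite endv_rcons in ep; rewrite lst_rcons.
pose g u := omap erev (f u).
have cN : (#|X| = #|N| + #|croots|)%N.
  rewrite -(cardsID croots X) addnC; congr (_ + _)%N.
  by rewrite (_ : X :&: croots = croots) //; apply/setP => u; rewrite !inE andbA andbb.
have fi : {in N &, injective f}.
  move=> u v /fP[s [e [_ _ <- ->]]] /fP[t [e' [_ _ <- ->]]]; by case=> ->.
have gi : {in N &, injective g}.
  move=> u v uN vN gg; apply: fi => //; move: gg; rewrite /g.
  have [s [e [_ _ _ ->]]] := fP u uN; have [t [e' [_ _ _ ->]]] := fP v vN.
  by move=> /= [/erev_inj ->].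
have sub : f @: N :|: g @: N \subset (@Some E) @: intEset.
  apply/fintype.subsetP => x; rewrite inE => /orP[] /imsetP[u uN ->];
    have [s [e [_]]] := fP u uN; rewrite nbX_rcons => /and4P[_ _ _ ie] _ fe.
    by rewrite fe imset_f // inE.
  by rewrite /g fe /= imset_f // inE intE_erev.
(* If the edge owned by [u] were the reverse of the one owned by [v], each of their two paths would
   extend the other by one edge. *)
have dis : f @: N :&: g @: N = finset.set0.
  apply/finset.setP => x; rewrite !inE; apply/negP => /andP[/imsetP[u uN ->] /imsetP[v vN]].
  have [s [e [ps ns te fe]]] := fP u uN; have [t [e' [pt nt te' fe']]] := fP v vN.
  rewrite fe /g fe' => -[ee].
  move: (ns) (nt); rewrite !nbX_rcons => /and4P[ns' /eqP se _ ie] /and4P[nt' /eqP st _ ie'].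
  have su : src e = v by rewrite ee src_erev'.
  have sv : src e' = u by rewrite -te ee tgt_erev.
  have rr : rt u = rt v by rewrite -su -te; apply/esym/rtE/conn_edge.
  have e1 : s = rcons t e'.
    by rewrite -pt -rr -su se pth_eq.
  have e2 : t = rcons s e.
    by rewrite -ps rr -sv st pth_eq.
  by have := congr1 size e1; rewrite e2 !size_rcons; elim: (size s) => // n IH [/IH].
rewrite cN mulnDr leq_add2r.
have si : injective (@Some E) by move=> x y [].
rewrite -(card_imset _ si).
apply: leq_trans (subset_leq_card sub).
by rewrite cardsU dis cards0 subn0 (card_in_imset fi) (card_in_imset gi) mul2n -addnn.
Qed.

End Forest.

(** * The set of live vertices *)

Section UpperBound.
Variables (R : realType) (V E : finType) (G : wgraph R V E) (lam : R).
Local Notation C := R[i].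
Local Notation src := (src G).
Local Notation tgt := (tgt G).
Local Notation erev := (erev G).
Local Notation weight := (weight G).
Local Notation pot := (pot G).
Local Notation nb := (nbwalk_from G).
Local Notation sol := (sol G lam).
Local Notation rk := (rk G lam).
Local Notation rkp := (rkp G lam).
Local Notation mass := (mass G lam).
Local Notation ev := (endv G).
Implicit Types (e : E) (s t : seq E) (u v : V).

(** [lam] is an eigenvalue of the Jacobi operator induced on [D]. The eigenvector is a function on
    all of [V] that vanishes outside [D], which avoids a subtype. *)
Definition eigset (D : {set V}) : Prop :=
  exists phi : V -> C, [/\ exists v, phi v != 0, forall v, v \notin D -> phi v = 0
    & forall u, u \in D ->
        (pot u - lam)%:C * phi u + \sum_(e | tgt e == u) weight e * phi (src e) = 0].

Lemma headis_cons u e s : nb u (e :: s) -> headis (erev e) s = false.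
Proof. by rewrite nb_cons => /and3P[_ _]; case: s => //= f s /negPf. Qed.

(** The tree looks the same from all lifts of a vertex, so evaluation at [s] is represented by the
    kernel of [ev u s] with its root moved along [s]. *)
Lemma rk_at u s : nb u s -> exists k, [/\ sol u k,
  forall f, sol u f -> inner k f = f s & k s = (rkp (ev u s))%:C].
Proof.
elim: s u => [u _|e s IH u nes].
  by exists (rk u); split; [exact: rk_sol|exact: rkP|rewrite rk_nil].
have he := headis_cons nes; have /and3P[/eqP se ns _] : [&& src e == u, nb (tgt e) s & head e s != erev e].
  by rewrite -nb_cons.
have [k [sk kP kE]] := IH _ ns; exists (pull G (erev e) k); rewrite -se; split.
- exact: pull_rev_sol.
- move=> f sf; have [suk _ _] := sk; have [suf _ _] := sf.
  rewrite -{1}(pullK suf) pull_inner ?src_erev' //.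
  by rewrite kP; [rewrite /pull ns /eshift he|exact: pull_sol].
- rewrite /pull tgt_erev se nes /eshift /= erevK eqxx kE.
  by rewrite /endv /= .
Qed.

Lemma sol_dead u s f : sol u f -> nb u s -> rkp (ev u s) = 0 -> f s = 0.
Proof.
move=> sf ns p0; have [k [sk kP kE]] := rk_at ns; have [_ lk _] := sk; have [_ lf _] := sf.
have k0 : nsq k = 0.
  by have := kP k sk; rewrite inner_self // kE p0; case.
rewrite -kP // (nsq_eq0 lk k0) (_ : (fun=> 0) = (fun s => 0 * f s)).
  by rewrite innerZl // rmorph0 mul0r.
by apply/funext => t; rewrite mul0r.
Qed.

Definition live : {set V} := [set u | 0 < rkp u].

Lemma live_forest : forest G live.
Proof.
move=> [//|e0 c] _ al; apply/negP => cyc.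
pose m e := mass e / rkp (src e).
have [e ec emin] := @arg_minP _ R E e0 (fun e => e \in e0 :: c) m (mem_head _ _).
have nx := next_cycle cyc ec; have nin : next (e0 :: c) e \in e0 :: c by rewrite mem_next.
have := emin _ nin; rewrite leNgt => /negP; apply.
have /and3P[we se te] := allP al _ ec; have /and3P[_ sn _] := allP al _ nin.
by rewrite !inE in se sn; exact: mass_lt.
Qed.

(** Each vertex of the component has a unique path from [u] inside the live set, so the kernel
    descends to a function on the component. All other tree neighbours across edges of nonzero
    weight are dead and contribute 0 to the equation. *)
Lemma live_eigset u : u \in live -> eigset (ccomp G live u).
Proof.
move=> uX; have F := live_forest; pose phi v := if conn G live u v then rk u (pth G live u v) else 0.
exists phi; split.
- exists u; rewrite /phi /conn connect0.
  have -> : pth G live u u = [::] by exact: (@pth_eq _ _ _ _ _ u [::]).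
  by rewrite rk_nil eq_complex /= eqxx andbT gt_eqF //; rewrite inE in uX.
- by move=> v; rewrite inE /phi => /negPf ->.
move=> v; rewrite inE => uv; have [ns es] := pthP uv.
have /andP[ns' _] := ns; have [_ _ /(_ _ ns')] := rk_sol G lam u.
have -> : phi v = rk u (pth G live u v) by rewrite /phi uv.
rewrite /opN es => eqv; rewrite -[RHS]eqv; congr (_ + _); apply: eq_bigr => e /eqP te.
have [->|we] := eqVneq (weight e) 0; first by rewrite !mul0r.
congr (_ * _); have te' : tgt e = ev u (pth G live u v) by rewrite es.
have [nt et _] := nbrP ns' te'.
have vX : v \in live by exact: conn_in uv uX.
have [sX|sX] := boolP (src e \in live); last first.
  rewrite (sol_dead (rk_sol G lam u) nt); last first.
    by rewrite et; apply/eqP; move: sX; rewrite inE lt0r rkp_ge0 andbT negbK.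
  rewrite /phi; case: ifP => // us; case/negP: sX; exact: conn_in us uX.
have ie : intE G live e by rewrite /intE we sX te.
have nn := nbX_nbr ns te' ie.
rewrite /phi (_ : conn G live u (src e)); last by rewrite -et; exact: nbX_conn.
by rewrite -{1}et pth_eq.
Qed.

Lemma rkp_live u : u \notin live -> rkp u = 0.
Proof. by rewrite inE lt0r rkp_ge0 andbT negbK => /eqP. Qed.

(** The edges inside the live set pair up to 1 with their reverses, and the edges leaving it add up
    to 1 at each boundary vertex. [intEset] counts directed edges, hence the division by 2. *)
Lemma sum_rkp : \sum_u rkp u =
  #|live|%:R - #|intEset G live|%:R / 2 - #|bdry G live|%:R.
Proof.
pose m e := mass e / rkp (src e).
have L1 : \sum_u rkp u = \sum_(u in live) rkp u.
  by rewrite [RHS]big_mkcond; apply: eq_bigr => u _; case: ifPn => // /rkp_live.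
have L2 : \sum_(u in live) (1 - rkp u) = \sum_(e | src e \in live) m e.
  rewrite (partition_big src (fun u => u \in live)) //=; apply: eq_bigr => u uX.
  have p0 : 0 < rkp u by rewrite inE in uX.
  transitivity (\sum_(e | src e == u) m e); last first.
    apply: eq_bigl => e; case: eqP => [->|_]; rewrite ?uX ?andbF //.
  rewrite (eq_bigr (fun e => mass e / rkp u)); last by move=> e /eqP eu; rewrite /m eu.
  rewrite -mulr_suml; have e1 := rkp_split G lam u.
  have -> : \sum_(e | src e == u) mass e = rkp u - rkp u ^+ 2 by rewrite {1}e1; ring.
  by field; rewrite gt_eqF.
have L3 : \sum_(e | src e \in live) m e = \sum_(e | intE G live e) m e + \sum_(e | exitE G live e) m e.
  rewrite (bigID (fun e => weight e == 0)) /= [X in X + _]big1 ?add0r; last first.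
    by move=> e /andP[_ /eqP w0]; rewrite /m mass_weight0 // mul0r.
  rewrite (bigID (fun e => tgt e \in live)) /=; congr (_ + _); apply: eq_bigl => e;
    by rewrite /intE /exitE; case: (src e \in live); rewrite /= ?andbF ?andbT.
have L4 : \sum_(e | intE G live e) m e = #|intEset G live|%:R / 2.
  have sym : \sum_(e | intE G live e) m e = \sum_(e | intE G live e) m (erev e).
    rewrite (reindex_inj (@erev_inj _ _ _ G)) /=; apply: eq_bigl => e; exact: intE_erev.
  suff : 2 * \sum_(e | intE G live e) m e = #|intEset G live|%:R by move=> <-; field.
  rewrite mulr_natl mulr2n {2}sym -big_split /= (eq_bigr (fun=> 1)); last first.
    move=> e /and3P[w0 sX tX]; rewrite !inE in sX tX.
    by rewrite /m src_erev'; exact: mass_int.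
  by rewrite -sum1_card natr_sum; apply: eq_bigl => e; rewrite inE.
have L5 : \sum_(e | exitE G live e) m e = #|bdry G live|%:R.
  rewrite (partition_big tgt (fun v => v \in bdry G live)) /=; last first.
    by move=> e xe; rewrite inE; apply/existsP; exists e; rewrite xe eqxx.
  rewrite -sum1_card natr_sum; apply: eq_bigr => v; rewrite inE => /existsP[e /andP[xe /eqP te]].
  have /and3P[w0 sX tX] := xe.
  rewrite -(mass_boundary (rkp_live tX)); last first.
    by exists e; split=> //; rewrite inE in sX.
  rewrite te; apply: eq_bigl => e'; rewrite /exitE !inE.
  case: (eqVneq (tgt e') v) => [->|_]; rewrite ?andbF //= andbT.
  by rewrite -te; rewrite inE in tX; rewrite tX andbT.
rewrite L1; have : \sum_(u in live) (1 - rkp u) = #|live|%:R - \sum_(u in live) rkp u.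
  by rewrite sumrB sumr_const.
rewrite L2 L3 L4 L5 => h; rewrite -addrA -opprD h; ring.
Qed.

End UpperBound.

(** Eliminating [y] leaves the fixed points of [H], a composition of two order-reversing maps and
    therefore monotone, with values at most [eta^-1]. As in Tarski's theorem, the supremum of all
    [x] with [x <= H x] is a fixed point. *)
Lemma cavity (R : realType) (I : finType) (b : I -> R) (r1 r2 : rel I) (eta : R) :
  (forall i, 0 <= b i) -> 0 < eta ->
  exists x y : I -> R, forall i, [/\ 0 < x i, 0 < y i,
    (x i)^-1 = eta + \sum_(j | r1 i j) b j * y j
    & (y i)^-1 = eta + \sum_(j | r2 i j) b j * x j].
Proof.
move=> b0 eta0.
pose D (r : rel I) (x : I -> R) i := eta + \sum_(j | r i j) b j * x j.
have Dp r x i : (forall j, 0 <= x j) -> eta <= D r x i.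
  by move=> x0; rewrite lerDl sumr_ge0 // => j _; rewrite mulr_ge0.
have Dp0 r x i : (forall j, 0 <= x j) -> 0 < D r x i.
  by move=> x0; apply: lt_le_trans eta0 (Dp r x i x0).
have Dmon r x x' i : (forall j, x j <= x' j) -> D r x i <= D r x' i.
  by move=> xx; rewrite lerD2l; apply: ler_sum => j _; rewrite ler_wpM2l.
pose F r x i := (D r x i)^-1.
have F0 r x i : (forall j, 0 <= x j) -> 0 < F r x i.
  by move=> x0; rewrite invr_gt0 Dp0.
have Fanti r x x' i : (forall j, 0 <= x j) -> (forall j, x j <= x' j) -> F r x' i <= F r x i.
  move=> x0 xx; rewrite /F lef_pV2 ?posrE ?Dp0 //; first exact: (Dmon _).
  by move=> j; apply: le_trans (xx j).
pose H x := F r1 (F r2 x).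
have H0 x i : (forall j, 0 <= x j) -> 0 < H x i.
  by move=> x0; apply: (F0 _) => j; apply/ltW/F0.
have Hmon x x' i : (forall j, 0 <= x j) -> (forall j, x j <= x' j) -> H x i <= H x' i.
  move=> x0 xx; apply: (Fanti _) => [j|j]; last exact: (Fanti _).
  by apply/ltW/F0 => k; apply: le_trans (xx k).
have Hb x i : (forall j, 0 <= x j) -> H x i <= eta^-1.
  move=> x0; rewrite /H /F lef_pV2 ?posrE //; first by apply: (Dp _) => j; apply/ltW/F0.
  by apply: (Dp0 _) => j; apply/ltW/F0.
pose S := [set x : I -> R | (forall i, 0 <= x i) /\ forall i, x i <= H x i].
have S0 : S (fun=> 0) by split=> // i; apply/ltW/H0.
pose z i := sup [set x i | x in S].
have hs i : has_sup [set x i | x in S].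
  split; first by exists 0, (fun=> 0).
  by exists eta^-1 => _ [x [x0 xH] <-]; apply: le_trans (xH i) (Hb _ _ x0).
have zub x i : S x -> x i <= z i.
  by move=> Sx; apply: ub_le_sup; [case: (hs i)|exists x].
have z0 i : 0 <= z i by exact: zub S0.
have zH i : z i <= H z i.
  apply: ge_sup; first by case: (hs i).
  move=> _ [x [x0 xH] <-]; apply: le_trans (xH i) _; apply: (Hmon _) => // j.
  by apply: zub; split.
have SH : S (H z).
  by split=> [i|i]; [apply/ltW/H0|apply: (Hmon _)].
have zE i : H z i = z i by apply/eqP; rewrite eq_le zH zub.
exists z, (F r2 z) => i; split.
- by rewrite -zE; apply: (H0 _).
- exact: (F0 _).
- by rewrite -zE invrK.
- by rewrite /F invrK.
Qed.

Lemma ler_sum_subseq (R : realType) (T : eqType) (L M : seq T) (F : T -> R) :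
  (forall t, 0 <= F t) -> uniq L -> {subset L <= M} ->
  \sum_(t <- L) F t <= \sum_(t <- M) F t.
Proof.
move=> F0; elim: L M => [|x L IH] M /=; first by rewrite big_nil sumr_ge0.
move=> /andP[xL uL] LM; rewrite big_cons [leRHS](big_rem x) /=; last by apply: LM; rewrite mem_head.
rewrite lerD2l; apply: IH => // t tL.
have tM : t \in M by apply: LM; rewrite inE tL orbT.
have tx : t != x by apply: contraNneq xL => <-.
by have := perm_mem (perm_to_rem (LM x (mem_head _ _))) t; rewrite tM inE (negPf tx) /= => <-.
Qed.

(** * Lower bound *)

Section BranchSums.
Variables (R : realType) (V E : finType) (G : wgraph R V E) (X : {set V}).
Local Notation src := (src G).
Local Notation tgt := (tgt G).
Local Notation erev := (erev G).
Hypothesis F : forest G X.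
Implicit Types (e : E) (u v : V) (w : V -> R).

(** The condition on the path selects the part of the tree that lies behind [e]. *)
Definition bsum w e : R :=
  \sum_(v | conn G X (src e) v && headis e (pth G X (src e) v)) w v.

Lemma pth_self u : pth G X u u = [::].
Proof. exact: (@pth_eq _ _ _ _ _ u [::]). Qed.

Lemma bsum_root w u : \sum_(v | conn G X u v) w v =
  w u + \sum_(e | intE G X e && (src e == u)) bsum w e.
Proof.
rewrite (bigD1 u) /=; last exact: connect0.
congr (_ + _).
pose h v := ohead (pth G X u v).
have hP v : conn G X u v -> v != u -> exists e, [/\ h v = Some e, intE G X e & src e = u].
  move=> /pthP[np ep] vu; rewrite /h; case: (pth _ _ _ _) np ep => [_ uv|e s].
    by rewrite -uv eqxx in vu.
  by rewrite nbX_cons => /and4P[/eqP se ie _ _] _; exists e.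
transitivity (\sum_(v | conn G X u v && (v != u)) \sum_(e | [&& intE G X e, src e == u & h v == Some e]) w v).
  apply: eq_bigr => v /andP[uv vu]; have [e [he ie se]] := hP v uv vu.
  rewrite (bigD1 e) /= ?ie ?se ?he ?eqxx // big1 ?addr0 // => f /andP[/and3P[_ _ /eqP hf]].
  by move: hf => [->]; rewrite eqxx.
rewrite (exchange_big_dep (fun e => intE G X e && (src e == u))) /=; last first.
  by move=> v e _ /and3P[-> ->].
apply: eq_bigr => e /andP[ie /eqP se]; apply: eq_bigl => v.
rewrite ie se eqxx /= /h; have [uv|//] := boolP (conn G X u v).
case: (eqVneq v u) => [->|vu] /=; first by rewrite pth_self.
by case: (pth _ _ _ _) => //= a s; apply/eqP/eqP => [[]|->].
Qed.

(** Removing [e] cuts its tree in two: the path to [v] from [src e] starts with [e] exactly when the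
    path from [tgt e] does not start with [erev e]. *)
Lemma bsum_split w e : intE G X e ->
  bsum w e + bsum w (erev e) = \sum_(v | conn G X (tgt e) v) w v.
Proof.
move=> ie; have ce := conn_edge ie.
have cE v : conn G X (src e) v = conn G X (tgt e) v.
  by apply/idP/idP; apply: connect_trans => //; rewrite -/(conn G X _ _) conn_sym.
rewrite [RHS](bigID (fun v => headis e (pth G X (src e) v))) /=; congr (_ + _).
  by apply: eq_bigl => v; rewrite cE.
rewrite /bsum src_erev'; apply: eq_bigl => v; case: (boolP (conn G X (tgt e) v)) => //= cv.
have [np ep] := pthP cv; have /andP[ns Xs] := np.
have [nt et _ ht] := eshiftP ns.
have nX : nbX G X (src e) (eshift G e (pth G X (tgt e) v)).
  rewrite /nbX nt /eshift; case: ifP => _ /=; last by rewrite ie.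
  by apply/allP => f /mem_behead; exact/allP.
have := pth_eq F nX; rewrite et ep => ->.
by rewrite ht negbK.
Qed.

Lemma bsum_rec w e : intE G X e -> bsum w e = w (tgt e) +
  \sum_(f | [&& intE G X f, src f == tgt e & f != erev e]) bsum w f.
Proof.
move=> ie; have := bsum_root w (tgt e); rewrite -(bsum_split w ie).
rewrite (bigD1 (erev e)) /=; last by rewrite intE_erev ie src_erev' eqxx.
rewrite addrCA [bsum w e + _]addrC => /addrI ->.
by congr (_ + _); apply: eq_bigl => f; rewrite andbA.
Qed.

Lemma bsum_ge0 w e : (forall v, 0 <= w v) -> 0 <= bsum w e.
Proof. by move=> w0; apply: sumr_ge0. Qed.

End BranchSums.

(** * The trial function and its energy *)

Section Resolvent.
Variables (R : realType) (V E : finType) (G : wgraph R V E) (lam : R) (X : {set V}).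
Local Notation C := R[i].
Local Notation src := (src G).
Local Notation tgt := (tgt G).
Local Notation erev := (erev G).
Local Notation weight := (weight G).
Local Notation pot := (pot G).
Local Notation nb := (nbwalk_from G).
Local Notation ev := (endv G).
Local Notation intX := (intE G X).
Local Notation extX := (exitE G X).
Local Notation conn := (conn G X).
Implicit Types (e l : E) (s t : seq E) (u v : V).

Variable phi : V -> C.
Hypothesis F : forest G X.
Hypothesis phi0 : forall v, v \notin X -> phi v = 0.
Hypothesis phiE : forall u, u \in X ->
  (pot u - lam)%:C * phi u + \sum_(e | tgt e == u) weight e * phi (src e) = 0.
Hypothesis phi1 : forall u, u \in X -> \sum_(v | conn u v) normsq (phi v) = 1.

(** The amplitude with which the eigenvector of a component acts through the exit edge [e] on the
    boundary vertex [tgt e]. *)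
Definition beta e : C := weight e * phi (src e).
Definition betasq e : R := normsq (beta e).

Variables (eta : R) (x y : E -> R).
Hypothesis eta0 : 0 < eta.
Hypothesis x0 : forall e, 0 < x e.
Hypothesis y0 : forall e, 0 < y e.
Hypothesis xE : forall e, (x e)^-1 =
  eta + \sum_(f | [&& extX f, tgt f == tgt e & f != e]) betasq f * y f.
Hypothesis yE : forall e, (y e)^-1 =
  eta + \sum_(f | [&& extX f, conn (src e) (src f) & f != e]) betasq f * x f.

Lemma betasq_ge0 e : 0 <= betasq e.
Proof. exact: normsq_ge0. Qed.

(* Entries of the resolvent with parameter [eta]: [green u] is the diagonal one
   at the component of [u], while [x e] and [y e], which belong to the two ends
   of an exit edge [e], are computed in the branch of the contracted tree from
   which [e] has been removed. *)
Definition flux u : R := \sum_(f | extX f && conn u (src f)) betasq f * x f.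
Definition green u : R := (eta + flux u)^-1.

Lemma flux_ge0 u : 0 <= flux u.
Proof. by apply: sumr_ge0 => e _; rewrite mulr_ge0 ?betasq_ge0 // ltW. Qed.

Lemma green_gt0 u : 0 < green u.
Proof. by rewrite invr_gt0 ltr_wpDr ?flux_ge0. Qed.

Lemma green_le u : 0 <= eta * green u <= 1.
Proof.
have h0 : 0 < eta + flux u by rewrite ltr_wpDr ?flux_ge0.
apply/andP; split; first by rewrite mulr_ge0 // ltW ?green_gt0.
by rewrite /green ler_pdivrMr // mul1r lerDl flux_ge0.
Qed.

Section Root.
Variable u0 : V.
Hypothesis u0X : u0 \in X.

(** The diagonal entry of the regularised projection at the root component. *)
Let c0 : C := (eta * green u0)%:C.

(* The trial function is multiplied by [fac p e] when the last edge [p] of the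
   word is followed by [e]: the constant is kept inside a component and when
   leaving it, and changes on entering the next one. *)
Definition fac (p : option E) e : C :=
  if intX e || extX e then 1
  else if extX (erev e) then
    if p is Some l then
      if extX l then (- (x l * y (erev e)))%:C * beta l * Num.conj (beta (erev e)) else 0
    else 0
  else 0.

Definition olast s : option E := if s is a :: r then Some (last a r) else None.

(** The state keeps the last edge next to the coefficient, because the factor for entering a
    component involves both the exit edge just used and the entering edge. *)
Definition wstate s : option E * C :=
  foldl (fun st e => (Some e, fac st.1 e * st.2)) (None, c0) s.

Definition cw s : C := (wstate s).2.

Lemma olast_rcons s e : olast (rcons s e) = Some e.
Proof. by case: s => //= a s; rewrite last_rcons. Qed.

Lemma wstate1 s : (wstate s).1 = olast s.
Proof. by case/lastP: s => // s e; rewrite /wstate foldl_rcons olast_rcons. Qed.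

Lemma cw_rcons s e : cw (rcons s e) = fac (olast s) e * cw s.
Proof. by rewrite /cw {1}/wstate foldl_rcons -/(wstate s) wstate1. Qed.

Definition trial s : C := if nb u0 s then cw s * phi (ev u0 s) else 0.

Let psi : E -> R := bsum G X (fun v => normsq (phi v)).
Let wx v : R := \sum_(f | extX f && (src f == v)) betasq f * x f.
Let theta : E -> R := bsum G X wx.

Lemma wx_ge0 v : 0 <= wx v.
Proof. by apply: sumr_ge0 => e _; rewrite mulr_ge0 ?betasq_ge0 // ltW. Qed.

Lemma flux_wx u : flux u = \sum_(v | conn u v) wx v.
Proof.
rewrite /flux (partition_big src (fun v => conn u v)) /=; last by move=> e /andP[].
apply: eq_bigr => v uv; apply: eq_bigl => e; case: eqP => [->|]; rewrite ?andbF //.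
by rewrite uv andbT.
Qed.

(* [energy s] dominates the squared norm of the trial function on the words
   that extend [s], by the supersolution property [super]. *)
Definition qfac e : R :=
  if intX e then psi e + theta e / eta
  else if extX e then betasq e * x e / eta
  else if extX (erev e) then (eta * y (erev e))^-1 else 0.

Lemma qfac_ge0 e : 0 <= qfac e.
Proof.
rewrite /qfac; case: ifP => _.
  rewrite addr_ge0 ?divr_ge0 ?(ltW eta0) //; apply: bsum_ge0 => v; [exact: normsq_ge0|exact: wx_ge0].
case: ifP => _; first by rewrite divr_ge0 ?mulr_ge0 ?betasq_ge0 // ltW.
by case: ifP => // _; rewrite invr_ge0 mulr_ge0 // ltW.
Qed.

Definition energy s : R :=
  if nb u0 s then
    if olast s is Some l then normsq (cw s) * qfac l else normsq c0 / (eta * green u0)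
  else 0.

Lemma energy_rcons s e : nb u0 (rcons s e) ->
  energy (rcons s e) = normsq (cw (rcons s e)) * qfac e.
Proof. by rewrite /energy olast_rcons => ->. Qed.

Lemma energy_ge0 s : 0 <= energy s.
Proof.
rewrite /energy; case: ifP => // _; case: (olast s) => [l|]; first by rewrite mulr_ge0 ?normsq_ge0 ?qfac_ge0.
by rewrite divr_ge0 ?normsq_ge0 //; have /andP[] := green_le u0.
Qed.

Lemma energy_nil : energy [::] = eta * green u0.
Proof.
rewrite /energy /= normsq_real expr2 mulfK // mulf_neq0 ?gt_eqF ?green_gt0 //.
Qed.

Lemma exit_int e : extX e -> intX e = false.
Proof. by rewrite /exitE /intE => /and3P[-> -> /negPf ->]. Qed.

Lemma exit_rev_src e : extX (erev e) -> (src e \in X = false) * (tgt e \in X).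
Proof. by rewrite /exitE src_erev' tgt_erev => /and3P[_ -> /negPf ->]. Qed.

Lemma fac_in p e : src e \in X -> fac p e = (intX e || extX e)%:R.
Proof.
move=> sX; rewrite /fac; case: ifP => //= _; case: ifP => // /exit_rev_src [].
by rewrite sX.
Qed.

Lemma fac_out p e : src e \notin X -> fac p e =
  if extX (erev e) then
    if p is Some l then
      if extX l then (- (x l * y (erev e)))%:C * beta l * Num.conj (beta (erev e)) else 0
    else 0
  else 0.
Proof. by move=> /negPf sX; rewrite /fac /intE /exitE sX !andbF. Qed.

Lemma children_in s : nb u0 s -> ev u0 s \in X ->
  \sum_e energy (rcons s e) = normsq (cw s) *
    (\sum_(e | [&& intX e, src e == ev u0 s & last e s != erev e]) (psi e + theta e / eta) +
     \sum_(e | [&& extX e, src e == ev u0 s & last e s != erev e]) betasq e * x e / eta).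
Proof.
move=> ns vX; rewrite [X in _ * (X + _)]big_mkcond [X in _ * (_ + X)]big_mkcond -big_split mulr_sumr /=.
apply: eq_bigr => e _; rewrite {1}/energy olast_rcons nb_rcons ns /=.
case: (eqVneq (src e) (ev u0 s)) => [se|]; rewrite ?andbF ?addr0 ?mulr0 //=.
rewrite cw_rcons fac_in ?se // /qfac.
case: (last e s != erev e); rewrite ?andbF ?addr0 ?mulr0 //= !andbT.
case: (boolP (intX e)) => ie /=.
  have -> : extX e = false by apply/negP => /exit_int; rewrite ie.
  by rewrite addr0 mul1r.
case: (boolP (extX e)) => xe /=; first by rewrite add0r mul1r.
by rewrite mul0r normsq0 mul0r addr0 mulr0.
Qed.

(** Each case is a recursion for [qfac]: [bsum_rec] inside a component, [yE] on entering one, [xE]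
    at a boundary vertex. The slack lies at the boundary vertices, where [x l ^+ 2 * betasq l] is
    given away. *)
Lemma super s : nb u0 s -> normsq (trial s) + \sum_e energy (rcons s e) <= energy s.
Proof.
move=> ns; rewrite /trial ns normsqM.
case: (boolP (ev u0 s \in X)) => vX.
  rewrite children_in // -mulrDr; case/lastP: s ns vX => [|s l] ns vX.
    rewrite /energy /= ler_wpM2l ?normsq_ge0 //.
    rewrite (eq_bigl (fun e => intX e && (src e == u0))); last first.
      by move=> e; rewrite /= [e == _]eq_sym erev_neq andbT.
    rewrite [X in _ + (_ + X)](eq_bigl (fun e => extX e && (src e == u0))); last first.
      by move=> e; rewrite /= [e == _]eq_sym erev_neq andbT.
    rewrite big_split /= -!mulr_suml -/(wx u0).
    have /= e1 := bsum_root F (fun v => normsq (phi v)) u0; rewrite phi1 // in e1.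
    have e2 := bsum_root F wx u0; rewrite -flux_wx in e2.
    have g0 := green_gt0 u0; rewrite /green in g0 *.
    have h0 : 0 < eta + flux u0 by rewrite -invr_gt0.
    rewrite le_eqVlt; apply/orP; left; apply/eqP.
    rewrite /endv /= -/psi -/theta in e1 e2 *.
    set A := \sum_(e | _) psi e in e1 *; set B := \sum_(e | _) theta e in e2 *.
    have -> : normsq (phi u0) = 1 - A by rewrite e1; ring.
    have -> : wx u0 = flux u0 - B by rewrite e2; ring.
    by field; rewrite !gt_eqF.
  rewrite endv_rcons in vX *; rewrite energy_rcons //.
  have lE e : (last e (rcons s l) != erev e) = (e != erev l).
    rewrite last_rcons; congr (~~ _); apply/eqP/eqP => ->; by rewrite erevK.
  rewrite (eq_bigl (fun e => [&& intX e, src e == tgt l & e != erev l])); last first.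
    by move=> e; rewrite lE.
  rewrite [X in _ + (_ + X)](eq_bigl (fun e => [&& extX e, src e == tgt l & e != erev l])); last first.
    by move=> e; rewrite lE.
  have [il|il] := boolP (intX l).
    rewrite ler_wpM2l ?normsq_ge0 // /qfac il big_split /= -!mulr_suml.
    rewrite [psi l]bsum_rec // [theta l]bsum_rec //.
    rewrite [X in _ + (_ + X / _)](eq_bigl (fun e => extX e && (src e == tgt l))); last first.
      move=> e; rewrite andbA andbC; case: eqP => //= ->.
      by apply/esym/negbTE/negP => /andP[/exit_int]; rewrite intE_erev il.
    by rewrite -/(wx _) -/psi -/theta le_eqVlt; apply/orP; left; apply/eqP; ring.
  have xl : extX l = false by rewrite /exitE vX !andbF.
  have [xr|xr] := boolP (extX (erev l)); last first.
    by rewrite cw_rcons /fac (negPf il) xl (negPf xr) mul0r normsq0 !mul0r.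
  rewrite ler_wpM2l ?normsq_ge0 // /qfac (negPf il) xl xr.
  rewrite (eq_bigl (fun e => intX e && (src e == tgt l))); last first.
    move=> e; rewrite andbA andbC; case: eqP => //= ->.
    by rewrite (exit_int xr).
  rewrite big_split /= -!mulr_suml.
  have /= e1 := bsum_root F (fun v => normsq (phi v)) (tgt l); rewrite phi1 // in e1.
  have e2 := bsum_root F wx (tgt l); rewrite -flux_wx in e2.
  have e3 : flux (tgt l) = betasq (erev l) * x (erev l) +
      \sum_(f | [&& extX f, conn (tgt l) (src f) & f != erev l]) betasq f * x f.
    have cc : conn (tgt l) (src (erev l)) by rewrite src_erev'; exact: connect0.
    rewrite /flux (bigD1 (erev l)) /= ?xr ?cc //; congr (_ + _).
    by apply: eq_bigl => e; rewrite andbA.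
  have e4 : wx (tgt l) = betasq (erev l) * x (erev l) +
      \sum_(f | [&& extX f, src f == tgt l & f != erev l]) betasq f * x f.
    rewrite /wx (bigD1 (erev l)) /= ?xr ?src_erev' ?eqxx //; congr (_ + _).
    by apply: eq_bigl => e; rewrite andbA.
  have := yE (erev l); rewrite src_erev' => e5.
  rewrite -/psi -/theta in e1 e2 *; move: e1 e2 e3 e4 e5.
  set A := \sum_(e | _) psi e; set B := \sum_(e | _) theta e.
  set S := \sum_(f | _) _; set S' := \sum_(f | _) _ => e1 e2 e3 e4 e5.
  rewrite invfM e5 le_eqVlt; apply/orP; left; apply/eqP.
  have -> : normsq (phi (tgt l)) = 1 - A by rewrite e1; ring.
  have -> : B = flux (tgt l) - wx (tgt l) by rewrite e2; ring.
  by rewrite e3 e4; field; rewrite gt_eqF.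
rewrite phi0 // normsq0 mulr0 add0r.
case/lastP: s ns vX => [|s l] ns; first by rewrite /endv /= u0X.
rewrite endv_rcons => vX.
have qE e : src e \notin X -> qfac e = if extX (erev e) then (eta * y (erev e))^-1 else 0.
  by move=> /negPf sX; rewrite /qfac /intE {1}/exitE sX !andbF.
have [xl|xl] := boolP (extX l); last first.
  rewrite big1 ?energy_ge0 // => e _; rewrite /energy; case: ifP => // ne.
  rewrite olast_rcons cw_rcons; move: ne; rewrite nb_rcons endv_rcons => /and3P[_ /eqP se _].
  by rewrite fac_out ?se // olast_rcons (negPf xl); case: ifP => _; rewrite mul0r normsq0 mul0r.
have il : intX l = false := exit_int xl.
rewrite energy_rcons // /qfac il xl; set c := cw (rcons s l).
rewrite (reindex_inj (@erev_inj _ _ _ G)) /=.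
rewrite (eq_bigr (fun f => if [&& extX f, tgt f == tgt l & f != l] then
    normsq c * (x l ^+ 2 * betasq l / eta * (betasq f * y f)) else 0)); last first.
  move=> f _; rewrite /energy olast_rcons nb_rcons ns endv_rcons last_rcons src_erev' erevK /=.
  case: (eqVneq (tgt f) (tgt l)) => [tf|_]; rewrite ?andbF //=.
  rewrite [l == f]eq_sym; case: (f != l); rewrite ?andbF //= andbT.
  have fX : src (erev f) \notin X by rewrite src_erev' tf.
  rewrite cw_rcons fac_out // qE // erevK olast_rcons xl -/c.
  case: (extX f); last by rewrite mul0r normsq0 mul0r.
  rewrite /betasq /beta !(normsqM, normsq_conj) normsq_real sqrrN.
  by field; rewrite !gt_eqF.
rewrite -big_mkcond -mulr_sumr -mulr_sumr ler_wpM2l ?normsq_ge0 //.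
have e1 := xE l; set S := \sum_(f | _) _ in e1 *.
have -> : S = (x l)^-1 - eta by rewrite e1; ring.
have -> : x l ^+ 2 * betasq l / eta * ((x l)^-1 - eta) = betasq l * x l / eta - x l ^+ 2 * betasq l.
  by field; rewrite !gt_eqF.
by rewrite lerBlDr lerDl mulr_ge0 ?betasq_ge0 // sqr_ge0.
Qed.

Lemma energy_le s : energy s <= eta * green u0.
Proof.
elim/last_ind: s => [|s e IH]; first by rewrite energy_nil.
have [ns|ns] := boolP (nb u0 (rcons s e)); last first.
  by rewrite /energy (negPf ns); have /andP[] := green_le u0.
have ns' : nb u0 s by move: ns; rewrite nb_rcons => /and3P[].
apply: le_trans IH; apply: le_trans (super ns').
rewrite (bigD1 e) //= addrCA lerDl addr_ge0 ?normsq_ge0 // sumr_ge0 // => f _.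
exact: energy_ge0.
Qed.

Fixpoint allw n : seq (seq E) :=
  if n is m.+1 then [::] :: [seq e :: t | e <- enum E, t <- allw m] else [:: [::]].

Lemma mem_allw n s : (size s <= n)%N -> s \in allw n.
Proof.
elim: n s => [|n IH] [|e s] //= sn; rewrite inE /=.
by apply: allpairs_f; [rewrite mem_enum|exact: IH].
Qed.

(** [super] is iterated down to depth [n], and the energies that remain there are dropped. *)
Lemma sum_allw n s : \sum_(t <- allw n) normsq (trial (s ++ t)) <= energy s.
Proof.
have dead t : ~~ nb u0 t -> normsq (trial t) = 0.
  by rewrite /trial => /negPf ->; exact: normsq0.
have nbc t e : ~~ nb u0 t -> ~~ nb u0 (rcons t e).
  by apply: contra; rewrite nb_rcons => /and3P[].
elim: n s => [|n IH] s.
  rewrite /= big_seq1 cats0; have [ns|ns] := boolP (nb u0 s).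
    by apply: le_trans (super ns); rewrite lerDl sumr_ge0 // => e _; exact: energy_ge0.
  by rewrite dead // energy_ge0.
rewrite /= big_cons cats0 big_allpairs_dep /=.
apply: (@le_trans _ _ (normsq (trial s) + \sum_e energy (rcons s e))).
  rewrite lerD2l big_enum /=; apply: ler_sum => e _.
  by under eq_bigr do rewrite -cat_rcons; exact: IH.
have [ns|ns] := boolP (nb u0 s); first exact: super.
rewrite dead // add0r big1 ?energy_ge0 // => e _.
by rewrite /energy (negPf (nbc _ _ ns)).
Qed.

(** This is the inequality |P delta|^2 <= <delta, P delta> for the regularised projection, obtained
    from the energy at the empty word. *)
Lemma trial_ell2 : ell2 trial /\ nsq trial <= eta * green u0.
Proof.
have [||sa le] := @nsum_le R _ (fun s => normsq (trial s)) (eta * green u0).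
- by move=> s; exact: normsq_ge0.
- move=> L uL; rewrite -energy_nil.
  have sub : {subset L <= allw (\max_(t <- L) size t)}.
    by move=> t tL; apply: mem_allw; exact: leq_bigmax_seq.
  apply: le_trans (sum_allw (\max_(t <- L) size t) [::]).
  by apply: ler_sum_subseq => // t; exact: normsq_ge0.
by split=> //; apply/ell2E.
Qed.

Lemma trial_nil : trial [::] = (eta * green u0)%:C * phi u0.
Proof. by []. Qed.

Lemma trial_supp : supp G u0 trial.
Proof. by move=> s; rewrite /trial => /negPf ->. Qed.

(** Within a component the coefficient is constant and the equation of [phi] applies. At a boundary
    vertex reached through the exit edge [l] the terms collapse by [xE] to [eta * x l] times the
    incoming amplitude, which the energy controls uniformly in [s]. *)
Lemma opN_trial s : nb u0 s -> normsq (opN G lam u0 trial s) <= eta ^+ 2.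
Proof.
move=> ns; have [vX|vX] := boolP (ev u0 s \in X).
  suff -> : opN G lam u0 trial s = 0 by rewrite normsq0 sqr_ge0.
  transitivity (cw s * ((pot (ev u0 s) - lam)%:C * phi (ev u0 s) +
    \sum_(e | tgt e == ev u0 s) weight e * phi (src e))); last by rewrite phiE // mulr0.
  rewrite /opN mulrDr mulr_sumr; congr (_ + _); first by rewrite /trial ns mulrCA.
  apply: eq_bigr => e /eqP te; have [nt et _] := nbrP ns te.
  rewrite /trial nt et; have [->|w0] := eqVneq (weight e) 0; first by rewrite !mul0r mulr0.
  have [sX|sX] := boolP (src e \in X); last by rewrite phi0 // !mulr0.
  have ie : intX e by rewrite /intE w0 sX te.
  suff -> : cw (nbr G s e) = cw s by rewrite mulrCA.
  rewrite /nbr; case: ifP => le; last first.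
    by rewrite cw_rcons /fac intE_erev ie mul1r.
  case/lastP: s le {ns te vX nt et} => [|s l]; first by rewrite /= (negPf (erev_neq _ _)).
  rewrite last_rcons => /eqP ->; rewrite size_rcons /= -cats1 take_size_cat //.
  by rewrite cats1 cw_rcons /fac ie mul1r.
case/lastP: s ns vX => [|s l] ns; first by rewrite /endv /= u0X.
rewrite endv_rcons => vX.
rewrite /opN endv_rcons {1}/trial ns endv_rcons phi0 // !mulr0 add0r.
rewrite (bigD1 l) //= nbr_rcons eqxx.
have ns' : nb u0 s /\ src l = ev u0 s by move: ns; rewrite nb_rcons => /and3P[? /eqP].
have [xl|xl] := boolP (extX l); last first.
  (* After an edge that is not an exit edge the trial function vanishes at the next words, and the
     incoming term vanishes because [weight l] or [phi (src l)] does. *)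
  suff -> : weight l * trial s + \sum_(e | (tgt e == tgt l) && (e != l)) weight e * trial (nbr G (rcons s l) e) = 0.
    by rewrite normsq0 sqr_ge0.
  rewrite big1 ?addr0 => [|e /andP[/eqP te el]].
    rewrite /trial ns'.1 -ns'.2.
    have [->|w0] := eqVneq (weight l) 0; first by rewrite mul0r.
    have sX : src l \notin X by move: xl; rewrite /exitE w0 vX andbT.
    by rewrite phi0 // !mulr0.
  rewrite nbr_rcons eq_sym (negPf el) /trial; case: ifP => _; last by rewrite mulr0.
  rewrite cw_rcons fac_out ?src_erev' ?te // olast_rcons (negPf xl).
  by case: ifP => _; rewrite !mul0r mulr0.
set c := cw (rcons s l).
have cE : cw s = c by rewrite /c cw_rcons /fac xl orbT mul1r.
have t1 : weight l * trial s = c * beta l.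
  by rewrite /trial ns'.1 -ns'.2 cE /beta mulrCA.
have t2 e : (tgt e == tgt l) && (e != l) -> weight e * trial (nbr G (rcons s l) e) =
    c * beta l * (- x l * (if extX e then betasq e * y e else 0))%:C.
  move=> /andP[/eqP te el]; rewrite nbr_rcons eq_sym (negPf el).
  have te' : tgt e = ev u0 (rcons s l) by rewrite endv_rcons.
  have [nt et _] := nbrP ns te'; rewrite nbr_rcons eq_sym (negPf el) in nt et.
  rewrite /trial nt et cw_rcons fac_out ?src_erev' ?te // olast_rcons xl erevK -/c.
  case: ifP => xe; last first.
    by rewrite !mul0r !mulr0.
  rewrite [LHS](_ : _ = c * beta l * (- (x l * y e))%:C * (Num.conj (beta e) * beta e)); last first.
    by rewrite /beta; ring.
  by rewrite conjc_mul_self -/(betasq e) -mulrA -rmorphM /=; congr (_ * _%:C); ring.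
rewrite t1 (eq_bigr _ t2) -mulr_sumr -[X in X + _]mulr1 -mulrDr -rmorph_sum /=.
rewrite -(rmorph1 (real_complex R)) -rmorphD /= -mulr_sumr -big_mkcondr /=.
have e1 := xE l; rewrite (eq_bigl (fun f => [&& extX f, tgt f == tgt l & f != l])); last first.
  by move=> f; rewrite andbC.
have -> : \sum_(f | [&& extX f, tgt f == tgt l & f != l]) betasq f * y f = (x l)^-1 - eta.
  by rewrite e1; ring.
have -> : 1 + - x l * ((x l)^-1 - eta) = eta * x l by field; rewrite gt_eqF.
rewrite normsqM [normsq (c * _)]normsqM normsq_real -/(betasq l).
have := energy_le (rcons s l); rewrite energy_rcons // /qfac (exit_int xl) xl -/c => e2.
have /andP[_ e3] := green_le u0; have e4 := le_trans e2 e3.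
have ex : eta * x l <= 1.
  rewrite -ler_pdivlMr // div1r e1 lerDl sumr_ge0 // => f _.
  by rewrite mulr_ge0 ?betasq_ge0 // ltW.
have -> : normsq c * betasq l * (eta * x l) ^+ 2 =
    normsq c * (betasq l * x l / eta) * (eta * x l) * eta ^+ 2.
  by field; rewrite gt_eqF.
rewrite -[leRHS]mul1r ler_wpM2r ?sqr_ge0 // mulr_ile1 //.
- by rewrite mulr_ge0 ?normsq_ge0 // divr_ge0 ?mulr_ge0 ?betasq_ge0 // ltW.
- by rewrite mulr_ge0 // ltW.
Qed.

End Root.
End Resolvent.

Lemma cvg_bigsum (R : realType) (U : set_system nat) (I : Type) (r : seq I) (P : pred I)
    (f : I -> nat -> R) (l : I -> R) : Filter U ->
  (forall i, P i -> f i n @[n --> U] --> l i) ->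
  \sum_(i <- r | P i) f i n @[n --> U] --> \sum_(i <- r | P i) l i.
Proof.
move=> FU fl; elim: r => [|i r IH].
  by rewrite big_nil; under eq_fun do rewrite big_nil; exact: cvg_cst.
rewrite big_cons; under eq_fun do rewrite big_cons.
by case: (boolP (P i)) => Pi //; apply: cvgD => //; exact: fl.
Qed.

(** * Summation over the components and passage to the limit *)

Section LowerBound.
Variables (R : realType) (V E : finType) (G : wgraph R V E) (lam : R) (X : {set V}).
Local Notation C := R[i].
Local Notation src := (src G).
Local Notation tgt := (tgt G).
Local Notation weight := (weight G).
Local Notation pot := (pot G).
Local Notation nb := (nbwalk_from G).
Local Notation ev := (endv G).
Local Notation conn := (conn G X).
Implicit Types (e : E) (s : seq E) (u v : V).

Variable phi : V -> C.
Hypothesis F : forest G X.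
Hypothesis phi0 : forall v, v \notin X -> phi v = 0.
Hypothesis phiE : forall u, u \in X ->
  (pot u - lam)%:C * phi u + \sum_(e | tgt e == u) weight e * phi (src e) = 0.
Hypothesis phi1 : forall u, u \in X -> \sum_(v | conn u v) normsq (phi v) = 1.

Local Notation b := (betasq G phi).
Let r1 : rel E := fun e f => [&& exitE G X f, tgt f == tgt e & f != e].
Let r2 : rel E := fun e f => [&& exitE G X f, conn (src e) (src f) & f != e].

(** [1 - eta * green] is the share [m] that a component loses through its exit edges, and the shares
    arriving at one boundary vertex add up to at most 1. *)
Lemma green_count (eta : R) (x y : E -> R) : 0 < eta ->
  (forall e, [/\ 0 < x e, 0 < y e, (x e)^-1 = eta + \sum_(f | r1 e f) b f * y f
    & (y e)^-1 = eta + \sum_(f | r2 e f) b f * x f]) ->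
  \sum_(u in X) normsq (phi u) - #|bdry G X|%:R <=
  \sum_(u in X) normsq (phi u) * (eta * green G X phi eta x u).
Proof.
move=> eta0 xy; have x0 e : 0 < x e by case: (xy e).
have y0 e : 0 < y e by case: (xy e).
have b0 e : 0 <= b e by exact: normsq_ge0.
pose g u := green G X phi eta x u.
pose m e := g (src e) * (b e * x e).
have g0 u : 0 < g u by exact: green_gt0.
have fluxE e : exitE G X e -> flux G X phi x (src e) = b e * x e + ((y e)^-1 - eta).
  move=> xe; case: (xy e) => _ _ _ ->; rewrite /flux (bigD1 e) /=; last by rewrite xe; exact: connect0.
  congr (_ + _); rewrite addrAC subrr add0r; apply: eq_bigl => f.
  by rewrite /r2 andbA.
have key u : 1 - eta * g u = \sum_(e | exitE G X e && conn u (src e)) m e.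
  have -> : \sum_(e | exitE G X e && conn u (src e)) m e = g u * flux G X phi x u.
    rewrite /flux mulr_sumr; apply: eq_bigr => e /andP[_ ue]; rewrite /m; congr (_ * _).
    rewrite /g /green /flux; congr (_ + _)^-1; apply: eq_bigl => f; congr (_ && _).
    apply/idP/idP => h; first exact: connect_trans ue h.
    by apply: connect_trans h; rewrite -/(conn _ _) conn_sym.
  have gE : eta + flux G X phi x u = (g u)^-1 by rewrite /g /green invrK.
  have -> : flux G X phi x u = (g u)^-1 - eta by rewrite -gE; ring.
  by field; rewrite gt_eqF.
have sum1 : \sum_(u in X) normsq (phi u) * (1 - eta * g u) = \sum_(e | exitE G X e) m e.
  under eq_bigr do rewrite key mulr_sumr.
  rewrite (exchange_big_dep (exitE G X)) /=; last by move=> u e _ /andP[].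
  apply: eq_bigr => e xe; have /and3P[_ sX _] := xe.
  rewrite -mulr_suml -[RHS]mul1r -(phi1 sX); congr (_ * _).
  rewrite big_mkcond [RHS]big_mkcond; apply: eq_bigr => u _.
  rewrite xe /= conn_sym; case: (boolP (conn _ _)) => h; rewrite ?andbF ?andbT //.
  by rewrite (conn_in h sX).
have sum2 : \sum_(e | exitE G X e) m e <= #|bdry G X|%:R.
  rewrite (partition_big tgt (fun v => v \in bdry G X)) /=; last first.
    by move=> e xe; rewrite inE; apply/existsP; exists e; rewrite xe eqxx.
  rewrite -sum1_card natr_sum; apply: ler_sum => v _.
  (* [h] is the inverse of the full resolvent entry at the boundary vertex [v]. In terms of it the
     shares are [b e * y e / h], with sum [(h - eta) / h]. *)
  pose h := eta + \sum_(f | exitE G X f && (tgt f == v)) b f * y f.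
  have h0 : 0 < h by rewrite ltr_wpDr // sumr_ge0 // => f _; rewrite mulr_ge0 // ltW.
  rewrite (eq_bigr (fun e => h^-1 * (b e * y e))); last first.
    move=> e /andP[xe /eqP te]; have hE : h = (x e)^-1 + b e * y e.
      case: (xy e) => _ _ -> _; rewrite /h (bigD1 e) /= ?xe ?te ?eqxx // [b e * _ + _]addrC addrA.
      by congr (_ + _ + _); apply: eq_bigl => f; rewrite /r1 te andbA.
    rewrite /m /g /green fluxE //.
    have -> : eta + (b e * x e + ((y e)^-1 - eta)) = b e * x e + (y e)^-1 by ring.
    rewrite hE; have := x0 e; have := y0 e; have := b0 e => be ye xe'.
    have p : 0 <= b e * y e * x e by rewrite !mulr_ge0 // ltW.
    by field; rewrite !gt_eqF //; lra.
  rewrite -mulr_sumr mulrC ler_pdivrMr // mul1r /h lerDr ltW //.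
rewrite lerBlDr; have := sum2; rewrite -sum1 => le.
have -> : \sum_(u in X) normsq (phi u) = \sum_(u in X) normsq (phi u) * (eta * g u) +
    \sum_(u in X) normsq (phi u) * (1 - eta * g u).
  by rewrite -big_split /=; apply: eq_bigr => u _; ring.
by rewrite lerD2l.
Qed.

(** The limit [g] is a solution with value [pi u * phi u] at the root and squared norm at most
    [pi u], so Cauchy-Schwarz against the kernel gives [normsq (phi u) * pi u <= rkp u]. *)
Theorem lower_bound : \sum_(u in X) normsq (phi u) - #|bdry G X|%:R <= \sum_u rkp G lam u.
Proof.
have [U [UU Uoo]] := ultra_oo; have PU := @ultra_proper _ _ UU.
pose eta n : R := n.+1%:R^-1.
have eta0 n : 0 < eta n by rewrite invr_gt0.
have b0 e : 0 <= b e by exact: normsq_ge0.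
have [x xP] := choice (fun n => @cavity R E b r1 r2 (eta n) b0 (eta0 n)).
have [y xyP] := choice xP.
pose a n u := eta n * green G X phi (eta n) (x n) u.
have x0 n e : 0 < x n e by case: (xyP n e).
have y0 n e : 0 < y n e by case: (xyP n e).
have xE n e : (x n e)^-1 = eta n + \sum_(f | r1 e f) b f * y n f by case: (xyP n e).
have yE n e : (y n e)^-1 = eta n + \sum_(f | r2 e f) b f * x n f by case: (xyP n e).
have a01 n u : 0 <= a n u <= 1 by exact: green_le.
have pi_ex u : exists l : R, a n u @[n --> U] --> l.
  apply: (@ultra_cvg R U (fun n => a n u) 1 UU) => n.
  by have /andP[? ?] := a01 n u; rewrite ger0_norm.
have [pi piP] := choice pi_ex.
have lim : \sum_(u in X) normsq (phi u) * a n u @[n --> U] --> \sum_(u in X) normsq (phi u) * pi u.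
  by apply: cvg_bigsum => u _; apply: cvgM; [exact: cvg_cst|exact: piP].
have le1 : \sum_(u in X) normsq (phi u) - #|bdry G X|%:R <= \sum_(u in X) normsq (phi u) * pi u.
  apply: (cvgr_to_ge lim); apply: (@filterS _ U _ setT); last exact: filterT.
  by move=> n _; apply: green_count (xyP n).
apply: le_trans le1 _; rewrite [leRHS](bigID (fun u => u \in X)) /= -[leLHS]addr0 lerD //; last first.
  by apply: sumr_ge0 => u _; exact: rkp_ge0.
apply: ler_sum => u uX.
pose f n := trial G X phi (eta n) (x n) (y n) u.
have tl n := trial_ell2 F phi0 phi1 (eta0 n) (x0 n) (y0 n) (xE n) (yE n) uX.
have [|||g [gl lg ng]] := @weak_compact R U UU _ f (fun n => a n u) 1 (pi u) _ _ _ (piP u).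
- by move=> n; case: (tl n).
- by move=> n; case: (tl n).
- by move=> n; have /andP[] := a01 n u.
have sg : sol G lam u g.
  split=> // s ns.
    apply: (ccvg_unique UU (gl s)); rewrite (_ : (fun n => _) = fun=> 0); first exact: ccvg0.
    by apply/funext => n; rewrite /f trial_supp.
  have lim2 : ccvg U (fun n => opN G lam u (f n) s) (opN G lam u g s).
    apply: ccvgD => //; first exact: ccvgZ.
    by apply: ccvg_sum => // e _; exact: ccvgZ.
  apply: (ccvg_squeeze UU Uoo (e := fun n => eta n ^+ 2) _ _ lim2) => [n|].
    exact: (opN_trial F phi0 phiE phi1 (eta0 n) (x0 n) (y0 n) (xE n) (yE n) uX ns).
  rewrite -[X in _ --> X](expr0n R 2) /=.
  under eq_fun do rewrite expr2; rewrite expr2.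
  by apply: cvgM; exact: cvg_harmonic.
have g0 : g [::] = (pi u)%:C * phi u.
  apply: (ccvg_unique UU (gl [::])).
  have la : ccvg U (fun n => (a n u)%:C) (pi u)%:C by split; [exact: piP|exact: cvg_cst].
  rewrite (_ : (fun n => f n [::]) = (fun n => phi u * (a n u)%:C)).
    by rewrite mulrC; apply: ccvgZ.
  by apply/funext => n; rewrite /f trial_nil mulrC.
have := eval_le sg; rewrite g0 normsqM normsq_real => ev1.
have pi0 : 0 <= pi u.
  apply: (cvgr_to_ge (piP u)); apply: (@filterS _ U _ setT); last exact: filterT.
  by move=> n _; have /andP[] := a01 n u.
have [->|pn0] := eqVneq (pi u) 0; first by rewrite mulr0 rkp_ge0.
have pp : 0 < pi u by rewrite lt0r pn0.
rewrite -(ler_pM2r pp); apply: (@le_trans _ _ (rkp G lam u * nsq g)).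
  by apply: le_trans ev1; rewrite le_eqVlt; apply/orP; left; apply/eqP; ring.
by rewrite ler_wpM2l ?rkp_ge0.
Qed.

End LowerBound.

(** * Point spectrum and density of states *)

Section Counting.
Variables (R : realType) (V E : finType) (G : wgraph R V E) (lam : R).
Local Notation C := R[i].
Local Notation src := (src G).
Local Notation tgt := (tgt G).
Local Notation weight := (weight G).
Local Notation pot := (pot G).
Implicit Types (e : E) (u v : V) (X : {set V}).

Lemma eigset_normalised (D : {set V}) : eigset G lam D ->
  exists phi : V -> C, [/\ \sum_v normsq (phi v) = 1, forall v, v \notin D -> phi v = 0
    & forall u, u \in D ->
        (pot u - lam)%:C * phi u + \sum_(e | tgt e == u) weight e * phi (src e) = 0].
Proof.
move=> [phi [[w pw] phi0 phiE]]; pose N := \sum_v normsq (phi v).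
have N0 : 0 < N.
  rewrite /N (bigD1 w) //= ltr_pwDl //; first by rewrite lt0r normsq_eq0 pw normsq_ge0.
  by apply: sumr_ge0 => v _; exact: normsq_ge0.
pose c : C := ((Num.sqrt N)^-1)%:C.
have cN : normsq c * N = 1.
  by rewrite normsq_real exprVn sqr_sqrtr ?ltW // mulVf // gt_eqF.
exists (fun v => c * phi v); split.
- by rewrite -cN mulr_sumr; apply: eq_bigr => v _; rewrite normsqM.
- by move=> v /phi0 ->; rewrite mulr0.
- move=> u uD; rewrite mulrCA.
  have -> : \sum_(e | tgt e == u) weight e * (c * phi (src e)) =
      c * \sum_(e | tgt e == u) weight e * phi (src e).
    by rewrite mulr_sumr; apply: eq_bigr => e _; rewrite mulrCA.
  by rewrite -mulrDr phiE // mulr0.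
Qed.

Lemma lower_count X : forest G X -> (forall u, u \in X -> eigset G lam (ccomp G X u)) ->
  #|croots G X|%:R - #|bdry G X|%:R <= \sum_u rkp G lam u.
Proof.
move=> F eig; pose rt := fingraph.root (istep G X).
have rtc u : conn G X u (rt u) by exact: connect_root.
have cs : connect_sym (istep G X) := sym_connect_sym (@istep_sym _ _ _ G X).
have rtE u v : conn G X u v -> rt u = rt v.
  by move=> uv; apply/eqP; rewrite (root_connect cs).
have psi_ex u : exists phi : V -> C, u \in X -> [/\ \sum_v normsq (phi v) = 1,
    forall v, v \notin ccomp G X u -> phi v = 0
    & forall w, w \in ccomp G X u ->
        (pot w - lam)%:C * phi w + \sum_(e | tgt e == w) weight e * phi (src e) = 0].
  have [uX|uX] := boolP (u \in X); last by exists (fun=> 0).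
  by have [phi hphi] := eigset_normalised (eig u uX); exists phi.
have [psi psiP] := choice psi_ex.
(* The eigenvectors are chosen at the canonical representatives [rt v], so that all vertices of a
   component use the same one. *)
pose phi v := if v \in X then psi (rt v) v else 0.
have rtX u : u \in X -> rt u \in X by move=> uX; exact: conn_in (rtc u) uX.
have uc u : u \in ccomp G X (rt u) by rewrite inE conn_sym.
have phi0 v : v \notin X -> phi v = 0 by rewrite /phi => /negPf ->.
have phiE u : u \in X ->
    (pot u - lam)%:C * phi u + \sum_(e | tgt e == u) weight e * phi (src e) = 0.
  move=> uX; have [_ p0 pE] := psiP _ (rtX u uX); rewrite -[RHS](pE u (uc u)).
  rewrite {1}/phi uX; congr (_ + _); apply: eq_bigr => e /eqP te.
  have [->|w0] := eqVneq (weight e) 0; first by rewrite !mul0r.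
  rewrite /phi; case: ifPn => sX.
    have ie : intE G X e by rewrite /intE w0 sX te.
    by rewrite (rtE _ _ (conn_edge ie)) te.
  rewrite p0 //; apply: contra sX; rewrite inE => h; exact: conn_in h (rtX u uX).
have phi1 u : u \in X -> \sum_(v | conn G X u v) normsq (phi v) = 1.
  move=> uX; have [<- p0 _] := psiP _ (rtX u uX).
  rewrite big_mkcond; apply: eq_bigr => v _; case: ifPn => uv.
    by rewrite /phi (conn_in uv uX) -(rtE _ _ uv).
  rewrite p0 ?normsq0 // inE; apply: contra uv; exact: connect_trans (rtc u).
have := lower_bound F phi0 phiE phi1; congr (_ - _ <= _).
rewrite (partition_big rt (fun v => v \in croots G X)) /=; last first.
  by move=> u uX; rewrite inE rtX //=; apply/eqP; exact: root_root.
rewrite -sum1_card natr_sum; apply: eq_bigr => v; rewrite inE => /andP[vX /eqP vr].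
rewrite -(phi1 v vX); apply: eq_bigl => u; apply/andP/idP => [[uX /eqP uv]|uv].
  by rewrite conn_sym -uv; exact: rtc.
by split; [exact: conn_in uv vX|rewrite -(rtE _ _ uv) -/rt /rt vr].
Qed.

Lemma upper_count : \sum_u rkp G lam u <= #|croots G (live G lam)|%:R - #|bdry G (live G lam)|%:R.
Proof.
rewrite sum_rkp lerD2r; have := forest_edges (@live_forest _ _ _ G lam).
rewrite -(ler_nat R) natrD !natrM; lra.
Qed.

(** Counting edges in place of components gives a condition that a program can evaluate directly. In
    one direction [sum_rkp] is exact; in the other, [forest_edges] bounds the number of trees from
    below. *)
Lemma rkp_gt0_criterion : (exists u, 0 < rkp G lam u) <->
  exists X, [/\ forest G X, forall u, u \in X -> eigset G lam (ccomp G X u)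
    & (#|intEset G X| + 2 * #|bdry G X| < 2 * #|X|)%N].
Proof.
split=> [[u u0]|[X [F eig lt]]].
  exists (live G lam); split; [exact: live_forest|exact: live_eigset|].
  have : 0 < \sum_u rkp G lam u.
    by rewrite (bigD1 u) //= ltr_pwDl // sumr_ge0 // => v _; exact: rkp_ge0.
  rewrite sum_rkp -(ltr_nat R) natrD !natrM; lra.
have : 0 < \sum_u rkp G lam u.
  apply: lt_le_trans (lower_count F eig); rewrite subr_gt0 ltr_nat.
  have := forest_edges F; lia.
move=> s0; apply: contrapT => h; move: s0; rewrite big1 ?ltxx // => u _.
by apply/eqP; rewrite eq_le rkp_ge0 andbT leNgt; apply/negP => u0; apply: h; exists u.
Qed.

End Counting.

(** * The universal cover in terms of words *)

Section CoverBridge.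
Variables (R : realType) (V E : finType) (G : wgraph R V E) (r : V).
Local Notation C := R[i].
Local Notation src := (src G).
Local Notation tgt := (tgt G).
Local Notation erev := (erev G).
Local Notation weight := (weight G).
Local Notation pot := (pot G).
Local Notation nb := (nbwalk_from G).
Local Notation W := (uc_vert G r).
Local Notation T := (universal_cover G r).

Definition ext (f : W -> C) : seq E -> C := fun s => if insub s is Some w then f w else 0.

Lemma ext_val f (w : W) : ext f (val w) = f w.
Proof. by rewrite /ext valK. Qed.

Lemma ext_out f s : ~~ nb r s -> ext f s = 0.
Proof. by move=> ns; rewrite /ext insubN. Qed.

Lemma val_bij : set_bij [set: W] [set s | nb r s] val.
Proof.
split=> [w _ /=||s /= ns]; first exact: valP.
  by move=> w w' _ _ /val_inj.
by exists (Sub s ns) => //; rewrite SubK.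
Qed.

Lemma ell2_ext f : (ell2 f <-> ell2 (ext f)) /\ nsq f = nsq (ext f).
Proof.
apply: (ell2_reindex val_bij); first by move=> w [].
  by move=> s /negP; exact: ext_out.
by move=> w _; rewrite ext_val.
Qed.

Lemma inner_ext f g : inner f g = inner (ext f) (ext g).
Proof.
apply: (inner_reindex val_bij); first by move=> w [].
- by move=> s /negP; exact: ext_out.
- by move=> w _; rewrite ext_val.
- by move=> w _; rewrite ext_val.
Qed.

(** The covering map is bijective on the edges into a vertex. The two mixed cases of injectivity
    would require a word that backtracks at its end. *)
Lemma cover_edge_bij (w : W) :
  set_bij [set x : uc_edge G r | Defs.tgt T x = w] [set e | tgt e = endv G r (val w)]
    (@cover_edge R V E G r).
Proof.
split.
- move=> [[[s e] b] /= h] /= <-; rewrite /cover_edge /uc_tgt /=.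
  case: b => /=; first by rewrite endv_rcons.
  by rewrite tgt_erev; move: h; rewrite nb_rcons => /and3P[_ /eqP -> _].
- move=> [[[s e] b] /= h] [[[s' e'] b'] /= h']; rewrite !inE /= /cover_edge /=.
  move=> /(congr1 val) /= w1 /(congr1 val) /= w2 ee; apply: val_inj => /=.
  move: w1 w2 ee; rewrite /uc_tgt /=; case: b => /=; case: b' => /= <-.
  + by move=> /rcons_inj[-> ->].
  + by move=> sE ee; move: h'; rewrite sE nb_rcons last_rcons ee eqxx !andbF.
  + by move=> sE ee; move: h; rewrite -sE nb_rcons last_rcons -ee eqxx !andbF.
  + by move=> -> /erev_inj ->.
- move=> e /= te; have ns : nb r (val w) := valP w.
  have [nt _ _] := nbrP ns te.
  have [le|le] := boolP (last (erev e) (val w) == e).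
    move: ns le; move wE : (val w) => t; case/lastP: t wE => [|s f] wE ns; first by rewrite /= (negPf (erev_neq _ _)).
    rewrite last_rcons => /eqP fe; exists (exist _ ((s, f), true) ns).
      by apply: val_inj; rewrite /= wE.
    by rewrite /cover_edge.
  rewrite /nbr (negPf le) in nt; exists (exist _ ((val w, erev e), false) nt).
    by apply: val_inj.
  by rewrite /cover_edge /= erevK.
Qed.

Lemma ext_uc_src f (x : uc_edge G r) :
  f (Defs.src T x) = ext f (nbr G (val (Defs.tgt T x)) (cover_edge x)).
Proof.
rewrite -[LHS]ext_val; congr (ext f _); case: x => [[[s e] [|]] h].
  by rewrite /= /cover_edge /= nbr_rcons eqxx.
rewrite /= /cover_edge /=; move: h; rewrite /= nb_rcons => /and3P[_ _ le].
rewrite /nbr erevK; case: ifP le => // /eqP -> ; by rewrite eqxx.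
Qed.

Lemma jacobi_cover f (w : W) : jacobi T f w =
  (pot (endv G r (val w)))%:C * f w +
  \sum_(e | tgt e == endv G r (val w)) weight e * ext f (nbr G (val w) e).
Proof.
rewrite /jacobi; congr (_ + _).
transitivity (\sum_(e \in [set e | tgt e = endv G r (val w)]) weight e * ext f (nbr G (val w) e)).
  rewrite (reindex_fsbig (@cover_edge R V E G r) _ _ _ (cover_edge_bij w)).
  by apply: eq_fsbigr => x; rewrite inE => xw; rewrite ext_uc_src (xw : Defs.tgt T x = w).
rewrite (bigfs _ (index_enum_uniq E)) //.
  by apply: eq_fsbigl; apply/seteqP; split=> e /= /eqP.
by move=> e _; rewrite mem_index_enum.
Qed.

Variable lam : R.

Lemma cover_eigen f : ell2 f ->
  (jacobi T f = (fun v => lam%:C * f v) <-> sol G lam r (ext f)).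
Proof.
move=> lf; have opE w : opN G lam r (ext f) (val w) = jacobi T f w - lam%:C * f w.
  by rewrite jacobi_cover /opN ext_val rmorphB /= mulrBl addrAC.
split=> [jf|[_ _ ef]].
  split; [by move=> s; exact: ext_out|by apply/(ell2_ext f).1|].
  move=> s ns; have := opE (Sub s ns); rewrite SubK => ->.
  by rewrite jf subrr.
apply/funext => w; apply/eqP; rewrite -subr_eq0 -opE ef //; exact: valP.
Qed.

Lemma sol_ext f : sol G lam r f -> ext (fun w : W => f (val w)) = f.
Proof.
move=> [sf _ _]; apply/funext => s; have [ns|ns] := boolP (nb r s); last by rewrite ext_out ?sf.
by rewrite -(SubK W ns) ext_val.
Qed.

Lemma reach : gconnected G -> forall u, exists s, nb r s /\ endv G r s = u.
Proof.
move=> [_ /(_ r) cr] u; have /connectP[p pp ->] := cr u.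
elim/last_ind: p pp => [|p w IH]; first by exists [::].
rewrite rcons_path last_rcons => /andP[pp /existsP[e /andP[/eqP se /eqP te]]].
have [s [ns es]] := IH pp; exists (nbr G s (erev e)).
have te' : tgt (erev e) = endv G r s by rewrite tgt_erev es se.
by have [? -> _] := nbrP ns te'; rewrite src_erev'.
Qed.

(** Solutions vanish above vertices with [rkp u = 0], and every vertex has a lift because a path
    reduces to a non-backtracking word; so the criterion does not depend on [r]. *)
Lemma point_spectrum_rkp : gconnected G ->
  (point_spectrum T lam <-> exists u, 0 < rkp G lam u).
Proof.
move=> cG; split.
  move=> [f [lf f0 jf]]; have sf := (cover_eigen lf).1 jf.
  apply: contrapT => h; apply: f0; apply/funext => w; rewrite -ext_val.
  apply: (sol_dead sf); first exact: valP.
  by apply/eqP; rewrite eq_le rkp_ge0 andbT leNgt; apply/negP => u0; apply: h; eexists; exact: u0.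
move=> [u u0]; have [s [ns es]] := reach cG u; have [k [sk _ kE]] := rk_at lam ns.
exists (fun w => k (val w)); have kk := sol_ext sk; have [_ lk _] := sk.
have lf : ell2 (fun w : W => k (val w)) by apply/(ell2_ext _).1; rewrite kk.
split=> //; last by apply/(cover_eigen lf); rewrite kk.
move=> /(congr1 (@^~ (Sub s ns : W))); rewrite SubK kE es => /eqP.
by rewrite eq_complex /= eqxx andbT gt_eqF.
Qed.

End CoverBridge.

(** [eigenvalue] refers to row vectors, while the operator acts on columns; for a Hermitian matrix
    and real [lam], conjugation exchanges the two. *)
Lemma hermitian_eigen (R : realType) n (M : 'M[R[i]]_n) (lam : R) :
  (forall i j, M i j = Num.conj (M j i)) ->
  eigenvalue M lam%:C <->
  exists x : 'I_n -> R[i], (exists i, x i != 0) /\ forall i, \sum_j M i j * x j = lam%:C * x i.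
Proof.
move=> hM; split.
  move=> /eigenvalueP[v vM v0]; exists (fun i => Num.conj (v 0 i)); split.
    apply: contrapT => h; move/eqP: v0; apply; apply/matrixP => a i; rewrite (ord1 a) mxE.
    by apply/eqP/negPn/negP => vi; apply: h; exists i; rewrite conjC_eq0.
  move=> i; have := congr1 (fun w : 'rV_n => Num.conj (w 0 i)) vM; rewrite !mxE rmorphM /= conjCR => <-.
  by rewrite rmorph_sum; apply: eq_bigr => j _ /=; rewrite rmorphM /= (hM i j) mulrC.
move=> [x [[i xi] xM]]; apply/eigenvalueP; exists (\row_j Num.conj (x j)).
  apply/rowP => j; rewrite !mxE -(conjCR lam) -rmorphM -xM rmorph_sum.
  by apply: eq_bigr => k _ /=; rewrite mxE rmorphM /= (hM k j) mulrC.
apply/eqP => /rowP /(_ i); rewrite !mxE => /eqP; rewrite conjC_eq0 => /eqP xi0.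
by rewrite xi0 eqxx in xi.
Qed.

(** * Finite graphs and the notions of the statement *)

Section FiniteSpectra.
Variables (R : realType) (V E : finType) (G : wgraph R V E).
Local Notation C := R[i].
Implicit Types (u v : V) (e : E).

Lemma jacobi_fin (f : V -> C) u : jacobi G f u =
  (pot G u)%:C * f u + \sum_(e | tgt G e == u) weight G e * f (src G e).
Proof.
rewrite /jacobi; congr (_ + _); rewrite (bigfs _ (index_enum_uniq E)) //.
  by apply: eq_fsbigl; apply/seteqP; split=> e /= /eqP.
by move=> e _; rewrite mem_index_enum.
Qed.

Definition entry u v : C := jacobi G (delta R v) u.

Lemma entryE u v : entry u v = (pot G u)%:C * (u == v)%:R +
  \sum_(e | (tgt G e == u) && (src G e == v)) weight G e.
Proof.
rewrite /entry jacobi_fin; congr (_ + _); rewrite [RHS]big_mkcondr.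
by apply: eq_bigr => e _; rewrite /delta; case: eqP; rewrite ?mulr1 ?mulr0.
Qed.

Lemma entry_herm u v : entry u v = Num.conj (entry v u).
Proof.
rewrite !entryE rmorphD rmorphM /= conjCR rmorph_nat [v == u]eq_sym; congr (_ + _).
  by case: eqP => [->|_]; rewrite ?mulr0.
rewrite rmorph_sum (reindex_inj (@erev_inj _ _ _ G)) /=; apply: eq_big => e.
  by rewrite tgt_erev src_erev' andbC.
by rewrite weight_conj.
Qed.

Lemma jacobi_entry (f : V -> C) u : jacobi G f u = \sum_v entry u v * f v.
Proof.
under eq_bigr do rewrite entryE mulrDl.
rewrite big_split /= jacobi_fin; congr (_ + _).
  rewrite (bigD1 u) //= eqxx mulr1 big1 ?addr0 // => v; rewrite eq_sym => /negPf ->.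
  by rewrite mulr0 mul0r.
under [RHS]eq_bigr do rewrite mulr_suml.
rewrite (exchange_big_dep (fun e => tgt G e == u)) /=; last by move=> v e _ /andP[].
apply: eq_bigr => e /eqP te; rewrite (big_pred1 (src G e)) // => v.
by rewrite te eqxx /= eq_sym.
Qed.

Lemma spectrumE (lam : R) : spectrum G lam <->
  exists f : V -> C, (exists v, f v != 0) /\ forall u, jacobi G f u = lam%:C * f u.
Proof.
rewrite /spectrum; have hM i j : jacobi_mx G i j = Num.conj (jacobi_mx G j i).
  by rewrite !mxE; exact: entry_herm.
split=> [/(hermitian_eigen lam hM)[x [[i xi] xM]]|[f [[v fv] fE]]].
  exists (fun v => x (enum_rank v)); split; first by exists (enum_val i); rewrite enum_valK.
  move=> u; rewrite -(xM (enum_rank u)) jacobi_entry [RHS](reindex (@enum_rank V)) /=; last first.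
    by apply: onW_bij; exact: enum_rank_bij.
  by apply: eq_bigr => v _; rewrite mxE !enum_rankK.
apply/(hermitian_eigen lam hM); exists (fun i => f (enum_val i)); split.
  by exists (enum_rank v); rewrite enum_rankK.
move=> i; rewrite -fE jacobi_entry (reindex (@enum_rank V)) /=; last first.
  by apply: onW_bij; exact: enum_rank_bij.
by apply: eq_bigr => w _; rewrite mxE enum_rankK.
Qed.

End FiniteSpectra.

Section Induced.
Variables (R : realType) (V E : finType) (G : wgraph R V E) (lam : R).
Local Notation C := R[i].

Lemma spectrum_induced (D : {set V}) :
  spectrum (induced_graph G D) lam <-> eigset G lam D.
Proof.
have eqE (f : V -> C) (u : ind_vert D) : (forall v, v \notin D -> f v = 0) ->
    jacobi (induced_graph G D) (fun w => f (val w)) u =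
    (pot G (val u))%:C * f (val u) + \sum_(e | tgt G e == val u) weight G e * f (src G e).
  move=> f0; rewrite jacobi_fin /=; congr (_ + _).
  rewrite [RHS](bigID (fun e => src G e \in D)) /= [X in _ + X]big1 ?addr0; last first.
    by move=> e /andP[_ /f0 ->]; rewrite mulr0.
  (* [insubd] requires an inhabitant of the edge type; without one both sums are empty. *)
  have [e0|noE] := pselect (exists e : ind_edge G D, True); last first.
    rewrite !big1 // => e; last by move=> _; case: noE; exists e.
    move=> /andP[/eqP te sD]; case: noE.
    by exists (exist _ e (introT andP (conj sD (eq_ind_r (fun v => v \in D) (valP u) te)))).
  have [e1 _] := e0.
  rewrite [RHS](reindex_onto val (insubd e1)) /=; last first.
    move=> e /andP[/eqP te sD]; rewrite insubdK //; rewrite unfold_in /= sD te; exact: valP.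
  apply: eq_bigl => e; rewrite valKd eqxx andbT.
  have /andP[-> _] := valP e; rewrite andbT.
  by apply/eqP/eqP => [<-//|te]; apply: val_inj.
split.
  move=> /spectrumE[f [[v fv] fE]].
  pose phi v := if insub v is Some w then f w else 0.
  have phiV w : phi (val w) = f w by rewrite /phi valK.
  have phi0 v' : v' \notin D -> phi v' = 0 by move=> vD; rewrite /phi insubN.
  exists phi; split=> //; first by exists (val v); rewrite phiV.
  move=> u uD; have := fE (Sub u uD : ind_vert D).
  have -> : f = (fun w => phi (val w)) by apply/funext => w; rewrite phiV.
  rewrite eqE // !SubK rmorphB /= mulrBl addrAC => ->; exact: subrr.
move=> [phi [[v pv] phi0 phiE]]; apply/spectrumE; exists (fun w : ind_vert D => phi (val w)); split.
  have vD : v \in D by apply: contraNT pv => /phi0 ->.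
  by exists (Sub v vD); rewrite SubK.
move=> u; rewrite eqE //; apply/eqP; rewrite -subr_eq0 addrAC -mulrBl -rmorphB.
by rewrite phiE //; exact: valP.
Qed.

Variable X : {set V}.
Hypothesis w0 : forall e, weight G e != 0.

Lemma istepE u v : istep G X u v = [&& u \in X, v \in X & adj G u v].
Proof.
apply/existsP/and3P => [[e /and3P[/and3P[_ sX tX] /eqP se /eqP te]]|[uX vX /existsP[e /andP[/eqP se /eqP te]]]].
  by split; rewrite -?se -?te //; apply/existsP; exists e; rewrite !eqxx.
by exists e; rewrite /intE w0 se te uX vX !eqxx.
Qed.

Lemma componentsE : components G X = [set ccomp G X u | u in X]%SET.
Proof.
rewrite /components /equivalence_partition; apply: eq_in_imset => u uX.
have e : connect (fun u v => [&& u \in X, v \in X & adj G u v]) =2 conn G X.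
  by apply: eq_connect => a b; rewrite istepE.
apply/finset.setP => v; rewrite !inE e; case: (boolP (conn G X u v)) => uv; rewrite ?andbF //.
by rewrite (conn_in uv uX).
Qed.

Lemma ccE : cc G X = #|croots G X|.
Proof.
have cs : connect_sym (istep G X) := sym_connect_sym (@istep_sym _ _ _ G X).
rewrite /cc componentsE.
have -> : [set ccomp G X u | u in X]%SET = [set ccomp G X u | u in croots G X]%SET.
  apply/finset.setP => D; apply/imsetP/imsetP => [[u uX ->]|[u + ->]]; last first.
    by rewrite inE => /andP[uX _]; exists u.
  have uv : conn G X u (fingraph.root (istep G X) u) by exact: connect_root.
  exists (fingraph.root (istep G X) u).
    by rewrite inE (conn_in uv uX) /=; apply/eqP; exact: root_root.
  apply/finset.setP => v; rewrite !inE; exact: same_connect.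
apply: card_in_imset => u v; rewrite !inE => /andP[_ /eqP ru] /andP[_ /eqP rv] uv.
rewrite -ru -rv; apply/eqP; rewrite (root_connect cs).
by have : v \in ccomp G X u; [rewrite uv inE; exact: connect0|rewrite inE].
Qed.

Lemma boundaryE : boundary G X = bdry G X.
Proof.
apply/finset.setP => v; rewrite !inE; apply/andP/existsP.
  move=> [vX /existsP[u /andP[uX /existsP[e /andP[/eqP se /eqP te]]]]].
  by exists e; rewrite /exitE w0 se te uX vX eqxx.
move=> [e /andP[/and3P[_ sX tX] /eqP te]]; rewrite -te; split=> //.
by apply/existsP; exists (src G e); rewrite sX; apply/existsP; exists e; rewrite !eqxx.
Qed.

Lemma acyclicE : acyclic (induced_graph G X) <-> forest G X.
Proof.
split=> [ac c c0 ic|F e s].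
  apply/negP => cyc; case: c c0 ic cyc => // e c _ ic cyc.
  have val_ie (f : E) : intE G X f -> (src G f \in X) && (tgt G f \in X) by case/and3P=> _ -> ->.
  have lift (s : seq E) : all (intE G X) s -> exists t : seq (ind_edge G X), map val t = s.
    elim: s => [|f s IH] /=; first by exists [::].
    move=> /andP[/val_ie fX /IH[t <-]].
    by exists (exist _ f fX :: t).
  have [[|e' t] //= [ee tc]] := lift _ ic.
  apply: (ac e' t).
    move: cyc; rewrite -ee -tc /= rcons_path => /andP[pth _].
    rewrite /nbwalk /=; move: pth; rewrite path_map; apply: sub_path => a b.
    rewrite /relpre /nbstep /= => /andP[/eqP ab nab]; apply/andP; split.
      by apply/eqP/val_inj.
    by apply: contra nab => /eqP ->.
  apply: val_inj => /=; move: cyc; rewrite /= rcons_path => /andP[_ /andP[/eqP + _]].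
  by rewrite -ee -tc last_map.
move=> nw cl; set s' := map val (e :: s).
have nX : nbX G X (src G (val e)) s'.
  apply/andP; split; last first.
    by apply/allP => f /mapP[g _ ->]; rewrite /intE w0; exact: (valP g).
  rewrite /nbwalk_from /= eqxx andbT; move: nw; rewrite /nbwalk /= path_map.
  apply: sub_path => a b; rewrite /relpre /nbstep /= => /andP[/eqP /(congr1 val) /= -> nab].
  by rewrite eqxx /=; apply: contra nab => /eqP ab; apply/eqP/val_inj.
have cl' : endv G (src G (val e)) s' = src G (val e).
  by rewrite /endv /s' /= !last_map; have /(congr1 val) := cl.
have [c [c0 ic cyc]] := closed_cycle (isT : s' != [::]) nX cl'.
by have := F c c0 ic; rewrite cyc.
Qed.

Lemma aomotoE : X \in aomoto G lam <-> [/\ forest G X,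
  forall u, u \in X -> eigset G lam (ccomp G X u) & (#|bdry G X| < #|croots G X|)%N].
Proof.
rewrite inE boundaryE ccE; split=> [/and3P[/asboolP ac /forall_inP sp lt]|[F eig lt]].
  split=> //; first exact/acyclicE.
  by move=> u uX; apply/spectrum_induced/sp; rewrite componentsE; apply/imsetP; exists u.
apply/and3P; split=> //; first by apply/asboolP/acyclicE.
by apply/forall_inP => D; rewrite componentsE => /imsetP[u uX ->]; apply/spectrum_induced/eig.
Qed.

End Induced.

(** Membership in [aomoto] makes the truncated difference a true one. If the live set is not in
    [aomoto], then [upper_count] bounds the sum by 0, which the maximum is at least. *)
Lemma sum_rkp_max (R : realType) (V E : finType) (G : wgraph R V E) (lam : R) :
  (forall e, weight G e != 0) ->
  \sum_u rkp G lam u = (\max_(X in aomoto G lam) (cc G X - #|boundary G X|))%N%:R.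
Proof.
move=> w0; apply/eqP; rewrite eq_le; apply/andP; split.
  have up := @upper_count _ _ _ G lam.
  case: (ltnP #|bdry G (live G lam)| #|croots G (live G lam)|) => [lt|le].
    have LX : live G lam \in aomoto G lam.
      by apply/(aomotoE _ _ w0); split=> //; [exact: live_forest|exact: live_eigset].
    apply: le_trans up _; rewrite -natrB; last exact: ltnW.
    rewrite ler_nat -(ccE _ w0) -(boundaryE _ w0).
    exact: (@leq_bigmax_cond _ _ (fun X => (cc G X - #|boundary G X|)%N)).
  by apply: le_trans up _; apply: (@le_trans _ _ 0) => //; rewrite subr_le0 ler_nat.
elim/big_ind: _ => [|m n hm hn|X XA].
- by apply: sumr_ge0 => u _; exact: rkp_ge0.
- by rewrite /maxn; case: ifP.
- have [F eig lt] := (aomotoE lam X w0).1 XA.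
  rewrite (ccE _ w0) (boundaryE _ w0) natrB; last exact: ltnW.
  exact: lower_count.
Qed.

(** * Boundedness of the Jacobi operator *)

Section Bounded.
Variables (R : realType) (V E : finType) (G : wgraph R V E) (r : V).
Local Notation C := R[i].
Local Notation W := (uc_vert G r).
Local Notation T := (universal_cover G r).

Lemma nsqD_le (U : choiceType) (f g : U -> C) : ell2 f -> ell2 g ->
  nsq (fun v => f v + g v) <= 2 * nsq f + 2 * nsq g.
Proof.
move=> lf lg; have /ell2E sf := lf; have /ell2E sg := lg.
rewrite /nsq -!nsumZ // -?nsumD; try by [exact: absumZ|move=> v; rewrite ?mulr_ge0 ?normsq_ge0].
apply: le_nsum; last by apply: absumD; apply: absumZ.
  by move=> v; exact: normsq_ge0.
by move=> v; exact: normsqD_le.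
Qed.

Lemma nsq_mono (U : choiceType) (f g : U -> C) : ell2 g ->
  (forall v, normsq (f v) <= normsq (g v)) -> nsq f <= nsq g.
Proof. by move=> /ell2E sg fg; apply: le_nsum => // v; exact: normsq_ge0. Qed.

Lemma nsq_hop u e (f : seq E -> C) : ell2 f ->
  nsq (hop G u e f) <= normsq (weight G e) * nsq f.
Proof.
move=> lf.
pose f' := restr (fun s => nbwalk_from G u s && (endv G u s == src G e)) (fun s => weight G e * f s).
rewrite -nsqZ //.
have -> : nsq (hop G u e f) = nsq f'.
  suff [] : (ell2 (hop G u e f) <-> ell2 f') /\ nsq (hop G u e f) = nsq f' by [].
  apply: (@ell2_reindex R _ _ _ _ _ (@nbr_bij R V E G u e) (hop G u e f) f').
  - move=> s /=; rewrite /hop; case: ifP => // /andP[ns /eqP es] []; by split.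
  - by move=> s /=; rewrite /f' /restr; case: ifP => // /andP[ns /eqP es] []; split.
  - move=> s /= [ns es]; rewrite /hop ns es eqxx /= /f' /restr.
    by have [-> -> _] := nbrP ns (esym es); rewrite eqxx.
apply: nsq_mono; first exact: ell2Z.
by move=> v; rewrite /f' /restr; case: ifP => // _; rewrite normsq0 normsq_ge0.
Qed.

Lemma nsq_sum_hop (L : seq E) u : exists2 B : R, 0 <= B & forall f : seq E -> C, ell2 f ->
  nsq (fun s => \sum_(e <- L) hop G u e f s) <= B * nsq f.
Proof.
elim: L => [|e L [B B0 IH]].
  exists 0 => // f _; rewrite mul0r /nsq /nsum esum1 // => v _.
  by rewrite big_nil normsq0.
exists (2 * normsq (weight G e) + 2 * B) => [|f lf].
  by rewrite addr_ge0 ?mulr_ge0 ?normsq_ge0.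
rewrite (_ : (fun s => _) = (fun s => hop G u e f s + \sum_(e <- L) hop G u e f s)); last first.
  by apply/funext => s; rewrite big_cons.
apply: le_trans (nsqD_le _ _) _; first exact: ell2_hop.
  by apply: ell2_sum => i _; exact: ell2_hop.
rewrite [leRHS]mulrDl -!mulrA lerD // ler_wpM2l //; first exact: nsq_hop.
exact: IH.
Qed.

(** [bc_id] links the functional calculus to the operator only relative to such a bound. *)
Lemma jacobi_bounded : exists2 M : R, 0 <= M & bound_op (jacobi T) M.
Proof.
have [B B0 hB] := nsq_sum_hop (index_enum E) r.
pose D := \sum_v normsq ((pot G v - 0)%:C : C).
have D0 : 0 <= D by apply: sumr_ge0 => v _; exact: normsq_ge0.
pose K := 2 * (D + 1) ^+ 2 + 2 * B.
exists (Num.sqrt K) => [|f lf]; first exact: sqrtr_ge0.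
have [lx nx] := ell2_ext f; have lx' := lx.1 lf.
have sx : supp G r (ext f) by move=> s; exact: ext_out.
have jE : ext (jacobi T f) = fullN G 0 r (ext f).
  apply/funext => s; rewrite /fullN; case: ifPn => ns; last exact: ext_out.
  have -> : s = val (Sub s ns : W) by rewrite SubK.
  by rewrite ext_val jacobi_cover /opN ext_val subr0.
have le : nsq (jacobi T f) <= K * nsq f.
  rewrite (ell2_ext _).2 nx jE fullNE //.
  apply: le_trans (nsqD_le _ _) _; first exact: ell2_diag.
    by apply: ell2_sum => e _; exact: ell2_hop.
  rewrite /K [leRHS]mulrDl -!mulrA lerD // ler_wpM2l //; last exact: hB.
  rewrite mulrA -expr2 -normsq_real -nsqZ //; apply: nsq_mono; first exact: ell2Z.
  move=> s; rewrite !normsqM ler_wpM2r ?normsq_ge0 //.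
  apply: (@le_trans _ _ D); last by rewrite normsq_real; nra.
  by rewrite /D (bigD1 (endv G r s)) //= lerDl sumr_ge0 // => v _; exact: normsq_ge0.
have K0 : 0 <= K by rewrite addr_ge0 // mulr_ge0 // sqr_ge0.
rewrite /ell2_norm -sqrtrM //; exact: ler_wsqrtr.
Qed.

End Bounded.

(** * The functional calculus at an atom *)

Section SpectralAtom.
Variables (R : realType) (V E : finType) (G : wgraph R V E) (r : V) (lam : R).
Local Notation C := R[i].
Local Notation W := (uc_vert G r).
Local Notation T := (universal_cover G r).
Variable Phi : (R -> R) -> (W -> C) -> W -> C.
Hypothesis bc : borel_calculus (jacobi T) Phi.

Let atom : R -> R := \1_[set lam].

Lemma atomE t : atom t = (t == lam)%:R.
Proof.
rewrite /atom indicE; congr (_%:R : R); congr nat_of_bool.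
by apply/idP/eqP; rewrite inE.
Qed.

Lemma bm_atom : bounded_measurable atom.
Proof.
split; first exact: measurable_indic.
by exists 1 => t; rewrite atomE; case: eqP => _; rewrite ?normr1 ?normr0.
Qed.

Lemma bm_cst (c : R) : bounded_measurable (fun=> c).
Proof. by split; [exact: measurable_cst|exists `|c|]. Qed.

(** Outside [[-M, M]] the truncation takes the value [M + 1], which differs from [lam] since
    [|lam| <= M]; so [j] takes the value [lam] only at [lam]. *)
Lemma calculus_id : exists2 j : R -> R, bounded_measurable j &
  (forall t, (j t == lam) = (t == lam)) /\ forall x, ell2 x -> Phi j x = jacobi T x.
Proof.
have [M0 M00 hM0] := jacobi_bounded G r.
pose M := Num.max M0 `|lam|.
have hM : bound_op (jacobi T) M.
  move=> f lf; apply: le_trans (hM0 f lf) _; rewrite ler_wpM2r ?sqrtr_ge0 //.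
  by rewrite le_max lexx.
have lM : `|lam| <= M by rewrite le_max lexx orbT.
pose j t : R := if `|t| <= M then t else M + 1.
have bj : bounded_measurable j.
  split.
    apply: measurable_fun_ifT; last 2 first.
    - exact: measurable_id.
    - exact: measurable_cst.
    by apply: measurable_fun_ler; [exact: normr_measurable|exact: measurable_cst].
  exists (M + 1) => t; rewrite /j; case: ifP => [h|_]; first by rewrite (le_trans h) // lerDl.
  by rewrite ger0_norm // addr_ge0 // (le_trans _ lM).
exists j => //; split=> [t|x lx].
  rewrite /j; case: ifP => // h; have h' : ~~ (`|t| <= M) by rewrite h.
  have [e|_] := eqVneq t lam; first by rewrite e lM in h'.
  apply/negbTE/eqP => e; have := lM; rewrite -e ger0_norm; last first.
    by rewrite addr_ge0 // (le_trans _ lM).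
  lra.
by apply: (bc_id bc hM bj) => // t h; rewrite /j h.
Qed.

Lemma calculus0 f : bounded_measurable f -> Phi f (fun=> 0) = fun=> 0.
Proof.
move=> bf; have [_ lin _] := bc_bounded bc bf; have l0 := @ell2_0 R W.
have := lin (-1) _ _ l0 l0; rewrite (_ : (fun v : W => -1 * 0 + 0) = (fun=> 0 : C)).
  by move=> ->; apply/funext => v; rewrite mulN1r addNr.
by apply/funext => v; rewrite mulr0 addr0.
Qed.

Lemma atom_range x : ell2 x -> jacobi T (Phi atom x) = (fun v => lam%:C * Phi atom x v).
Proof.
have [j bj [jl jE]] := calculus_id => lx; have [be _ _] := bc_bounded bc bm_atom.
rewrite -jE; last exact: be.
rewrite -(bc_mul bc bj bm_atom) //.
(* [lam * atom] is split to match the form [c * f + g] of [bc_lin]. *)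
have -> : (fun t => j t * atom t) = (fun t => (lam - 1) * atom t + atom t).
  apply/funext => t; rewrite !atomE -jl; case: eqP => [->|_] /=; by rewrite ?mulr1 ?mulr0 ?addr0 ?subrK.
rewrite (bc_lin bc) //; try exact: bm_atom.
by apply/funext => v; rewrite rmorphB /= mulrBl mul1r subrK.
Qed.

(** The functions [q n = eps n / (d^2 + eps n)] equal [1 - h n * d], so they fix every vector that
    [d] annihilates; they are bounded by 1 and converge to the indicator of [lam]. *)
Lemma atom_fix x : ell2 x -> jacobi T x = (fun v => lam%:C * x v) -> Phi atom x = x.
Proof.
have [j bj [jl jE]] := calculus_id => lx jx; have [mj [Mj hMj]] := bj.
pose d t := (- lam) * 1 + j t.
have bd : bounded_measurable d.
  split; first by apply: measurable_funD => //; exact: measurable_cst.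
  exists (`|lam| + Mj) => t; rewrite /d mulr1 (le_trans (ler_normD _ _)) // normrN lerD2l.
  exact: hMj.
have d0 : Phi d x = fun=> 0.
  rewrite /d (bc_lin bc _ (bm_cst 1) bj lx) jE // jx (bc_one bc lx).
  by apply/funext => v; rewrite rmorphN mulNr addNr.
pose eps n : R := n.+1%:R^-1.
have e0 n : 0 < eps n by rewrite invr_gt0.
have p0 n z : 0 < z ^+ 2 + eps n :> R by rewrite ltr_wpDl ?sqr_ge0.
pose h n t := d t * (d t ^+ 2 + eps n)^-1.
have [md [B hB]] := bd.
have mh n : measurable_fun [set: R] (h n).
  apply: measurable_funM => //.
  apply: (@measurableT_comp _ _ _ _ _ _ (fun z : R => (z ^+ 2 + eps n)^-1) _ d) => //.
  apply: continuous_measurable_fun => z; apply: cvgV; first by rewrite gt_eqF.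
  by apply: cvgD; [exact: exprn_continuous|exact: cvg_cst].
have bh n : bounded_measurable (h n).
  split=> //; exists (B / eps n) => t; rewrite /h normrM ler_pM //.
  rewrite ger0_norm; last by rewrite invr_ge0 ltW.
  by rewrite lef_pV2 ?posrE // lerDr sqr_ge0.
pose q n t := (-1) * (h n t * d t) + 1.
have qE n t : q n t = eps n / (d t ^+ 2 + eps n).
  by rewrite /q /h; field; rewrite gt_eqF.
have bhd n : bounded_measurable (fun t => h n t * d t).
  split; first exact: measurable_funM.
  have [_ [K hK]] := bh n; exists (K * B) => t; rewrite normrM ler_pM //.
have qx n : Phi (q n) x = x.
  rewrite /q (bc_lin bc _ (bhd n) (bm_cst 1) lx) (bc_mul bc (bh n) bd lx) d0.
  rewrite calculus0 // (bc_one bc lx); apply/funext => v; by rewrite mulr0 add0r.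
have mq n : measurable_fun [set: R] (q n).
  by apply: measurable_funD => //; apply: measurable_funM => //; case: (bhd n).
have q1 n t : `|q n t| <= 1.
  rewrite qE ger0_norm; last by apply: divr_ge0; apply: ltW.
  by rewrite ler_pdivrMr // mul1r lerDr sqr_ge0.
have qlim t : q n t @[n --> \oo] --> atom t.
  rewrite atomE -jl; have dE : d t = j t - lam by rewrite /d; ring.
  case: (eqVneq (j t) lam) => [jt|jt].
    under eq_fun do rewrite qE dE jt subrr expr0n add0r divff ?gt_eqF //.
    exact: cvg_cst.
  have dn : 0 < d t ^+ 2 by rewrite exprn_even_gt0 //= dE subr_eq0.
  apply: (@squeeze_cvgr _ _ _ _ (fun=> 0) (fun n => eps n / d t ^+ 2)).
  - near=> n; rewrite qE; apply/andP; split; first by apply: divr_ge0; apply: ltW.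
    by rewrite ler_pM2l // lef_pV2 ?posrE // lerDl ltW.
  - exact: cvg_cst.
  - rewrite -[X in _ --> X](mul0r (d t ^+ 2)^-1); apply: cvgM; [exact: cvg_harmonic|exact: cvg_cst].
have := bc_cvg bc mq q1 qlim lx.
under eq_fun do rewrite qx.
have [be _ _] := bc_bounded bc bm_atom; have la := be x lx.
move=> /(cvg_unique (@norm_hausdorff R R)) /(_ (cvg_cst _)) n0.
have ld := ell2B lx la.
have nz : nsq (fun v => x v - Phi atom x v) = 0.
  apply/eqP; rewrite eq_le nsq_ge0 andbT -sqrtr_eq0; apply/eqP; exact: esym n0.
by apply/funext => v; have /(congr1 (@^~ v)) /eqP := nsq_eq0 ld nz; rewrite subr_eq0 => /eqP.
Unshelve. all: by end_near.
Qed.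

(** By [atom_range] and [atom_fix], [Phi atom] is the orthogonal projection onto the eigenspace, so
    it sends the delta function at [w] to the kernel of evaluation at [w]. *)
Lemma atom_kernel (w : W) : Phi atom (delta R w) w = (rkp G lam (cover_vert w))%:C.
Proof.
have [ld _] := nsq_delta R w; have [be _ _] := bc_bounded bc bm_atom.
set k := Phi atom (delta R w); have lk : ell2 k by exact: be.
have sk : sol G lam r (ext k) by apply/(cover_eigen lam lk); exact: atom_range.
have nw : nbwalk_from G r (val w) := valP w.
have [k' [sk' kP' kE']] := rk_at lam nw.
suff e : ext k = k' by rewrite -(ext_val k w) e kE'.
apply: (sol_inner_eq sk sk') => f sf; rewrite kP' //.
have fE := sol_ext sf; set g := fun w : W => f (val w) in fE.
have lg : ell2 g by apply/(ell2_ext g).1; rewrite fE; case: sf.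
have jg : jacobi T g = (fun v => lam%:C * g v) by apply/(cover_eigen lam lg); rewrite fE.
by rewrite -fE -inner_ext (bc_sym bc bm_atom ld lg) atom_fix // inner_deltal fE.
Qed.

End SpectralAtom.

Lemma spectral_atom (R : realType) (V E : finType) (G : wgraph R V E) (r : V)
    (Phi : (R -> R) -> (uc_vert G r -> R[i]) -> uc_vert G r -> R[i])
    (mu : V -> {measure set (measurableTypeR R) -> \bar R}) (lam : R) (u : V) :
  gconnected G -> borel_calculus (jacobi (universal_cover G r)) Phi ->
  spectral_measures Phi mu -> mu u [set lam] = (rkp G lam u)%:E.
Proof.
move=> cG bc sm; have [s [ns es]] := reach r cG u.
pose w : uc_vert G r := Sub s ns.
have wu : cover_vert w = u by rewrite -es.
have ml : measurable ([set lam] : set (measurableTypeR R)) by exact: measurable_set1.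
have [ld nd] := nsq_delta R w.
(* Finiteness of the measure has to be derived: [fine] would turn an infinite total mass into 0, and
   the test function 1 excludes this. *)
have tot : mu u setT = 1%:E.
  have := sm w (fun=> 1) (bm_cst 1); rewrite (bc_one bc ld) inner_self // nd wu.
  case; rewrite /Rintegral.
  rewrite (_ : (fun t => _) = cst 1%:E) // integral_cst // mul1e.
  by case: (mu u setT) => [z||] //=; [move=> <-|move=> /eqP; rewrite oner_eq0|move=> /eqP; rewrite oner_eq0].
have := sm w _ (bm_atom lam); rewrite inner_deltal (atom_kernel lam bc) wu.
case; rewrite /Rintegral integral_indic // setIT => ->.
rewrite fineK // ge0_fin_numE //; apply: (@le_lt_trans _ _ (mu u setT)); last by rewrite tot ltry.
by apply: le_measure; rewrite ?inE.
Qed.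

Lemma density_atom (R : realType) (V E : finType) (G : wgraph R V E) (r : V) :
  gconnected G ->
  (forall e, weight G e != 0) ->
  forall Phi : (R -> R) -> (uc_vert G r -> R[i]) -> uc_vert G r -> R[i],
  borel_calculus (jacobi (universal_cover G r)) Phi ->
  forall mu : V -> {measure set (measurableTypeR R) -> \bar R},
  spectral_measures Phi mu ->
  forall lam : R,
  density_of_states mu [set lam] =
    (#|V|%:R^-1 *
     (\max_(X in aomoto G lam) (cc G X - #|boundary G X|))%N%:R)%:E.
Proof.
move=> cG w0 Phi bc mu sm lam; rewrite /density_of_states -sum_rkp_max //.
rewrite (eq_bigr (fun u => (rkp G lam u)%:E)); last first.
  by move=> u _; exact: (spectral_atom lam u cG bc sm).
by rewrite sumEFin -EFinM.
Qed.

(** * Programs *)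

Section Programs.
Variable R : realType.

Record pgraph := PGraph { gV : finType; gE : finType; gG : wgraph R gV gE }.

Definition encoder (A : pgraph -> Type) := forall g, A g -> pval R.

(* [f] is computed, uniformly in the graph, by a program that reads its input in
   the variable of index 0 and ignores the rest of the environment, so that
   such programs can be run below binders. *)
Definition cps (A B : pgraph -> Type) (eA : encoder A) (eB : encoder B)
    (f : forall g, A g -> B g) : Prop :=
  exists p, forall g a rho, runs (eA g a :: rho) p (eB g (f g a)).

Definition e_pair A B (eA : encoder A) (eB : encoder B) : encoder (fun g => A g * B g)%type :=
  fun g x => VCons (eA g x.1) (eB g x.2).
Definition e_seq A (eA : encoder A) : encoder (fun g => seq (A g)) :=
  fun g s => vlist (map (eA g) s).
Definition e_bool : encoder (fun=> bool) :=
  fun g b => if b then VCons (VNil R) (VNil R) else VNil R.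
Definition e_real : encoder (fun=> R) := fun g x => VReal x.
Definition e_cplx : encoder (fun=> R[i]) := fun g z => vcomplex z.
Definition e_mx : encoder (fun g => 'M[R[i]]_#|gV g|) := fun g M => vmatrix M.

Section Closure.
Variables (A : pgraph -> Type) (eA : encoder A).

Lemma cp_id : cps eA eA (fun g a => a).
Proof. by exists (PVar 0) => g a rho; apply: RVar. Qed.

Lemma cp_cut B C (eB : encoder B) (eC : encoder C) f h :
  cps eA eB f -> cps eB eC h -> cps eA eC (fun g a => h g (f g a)).
Proof.
move=> [p hp] [q hq]; exists (PLet p q) => g a rho.
by apply: RLet; [exact: hp|exact: hq].
Qed.

Lemma cp_pair B C (eB : encoder B) (eC : encoder C) f h :
  cps eA eB f -> cps eA eC h -> cps eA (e_pair eB eC) (fun g a => (f g a, h g a)).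
Proof.
by move=> [p hp] [q hq]; exists (PCons p q) => g a rho; apply: RCons; [exact: hp|exact: hq].
Qed.

Lemma cp_fst B C (eB : encoder B) (eC : encoder C) f :
  cps eA (e_pair eB eC) f -> cps eA eB (fun g a => (f g a).1).
Proof. by move=> [p hp]; exists (PHead p) => g a rho; apply: RHead; exact: hp. Qed.

Lemma cp_snd B C (eB : encoder B) (eC : encoder C) f :
  cps eA (e_pair eB eC) f -> cps eA eC (fun g a => (f g a).2).
Proof. by move=> [p hp]; exists (PTail p) => g a rho; apply: RTail; exact: hp. Qed.

Lemma cp_true : cps eA e_bool (fun g a => true).
Proof. by exists (PCons PNil PNil) => g a rho; apply: RCons; exact: RNil. Qed.

Lemma cp_false : cps eA e_bool (fun g a => false).
Proof. by exists PNil => g a rho; exact: RNil. Qed.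

Lemma cp_nil B (eB : encoder B) : cps eA (e_seq eB) (fun g a => [::]).
Proof. by exists PNil => g a rho; exact: RNil. Qed.

Lemma cp_cons B (eB : encoder B) f h :
  cps eA eB f -> cps eA (e_seq eB) h -> cps eA (e_seq eB) (fun g a => f g a :: h g a).
Proof.
by move=> [p hp] [q hq]; exists (PCons p q) => g a rho; apply: RCons; [exact: hp|exact: hq].
Qed.

Lemma cp_one : cps eA e_real (fun g a => 1).
Proof. by exists POne => g a rho; exact: ROne. Qed.

Lemma cp_zero : cps eA e_real (fun g a => 0).
Proof.
exists (PSub POne POne) => g a rho; rewrite /e_real -(subrr 1).
by apply: RSub; exact: ROne.
Qed.

Lemma cp_add f h : cps eA e_real f -> cps eA e_real h -> cps eA e_real (fun g a => f g a + h g a).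
Proof.
by move=> [p hp] [q hq]; exists (PAdd p q) => g a rho; apply: RAdd; [exact: hp|exact: hq].
Qed.

Lemma cp_if B (eB : encoder B) b f h :
  cps eA e_bool b -> cps eA eB f -> cps eA eB h ->
  cps eA eB (fun g a => if b g a then f g a else h g a).
Proof.
move=> [pb hb] [p hp] [q hq]; exists (PIfNil pb q p) => g a rho.
have := hb g a rho; rewrite /e_bool; case: (b g a) => h'.
  by apply: RIfNil_cons h' _; exact: hp.
by apply: RIfNil_nil h' _; exact: hq.
Qed.

Lemma cp_le f h : cps eA e_real f -> cps eA e_real h -> cps eA e_bool (fun g a => f g a <= h g a).
Proof.
move=> [p hp] [q hq]; have [pt ht] := cp_true; have [pf hf] := cp_false.
exists (PIfLe p q pt pf) => g a rho; case: leP => le.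
  by apply: RIfLe_le (hp g a rho) (hq g a rho) le _; exact: (ht g a rho).
by apply: RIfLe_gt (hp g a rho) (hq g a rho) le _; exact: (hf g a rho).
Qed.

Lemma cp_neg b : cps eA e_bool b -> cps eA e_bool (fun g a => ~~ b g a).
Proof. by move=> hb; exact: cp_if hb cp_false cp_true. Qed.

Lemma cp_and b c : cps eA e_bool b -> cps eA e_bool c -> cps eA e_bool (fun g a => b g a && c g a).
Proof. by move=> hb hc; exact: cp_if hb hc cp_false. Qed.

Lemma cp_imply b c : cps eA e_bool b -> cps eA e_bool c -> cps eA e_bool (fun g a => b g a ==> c g a).
Proof. by move=> hb hc; exact: cp_if hb hc cp_true. Qed.

Lemma cp_eqb b c : cps eA e_bool b -> cps eA e_bool c -> cps eA e_bool (fun g a => b g a == c g a).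
Proof.
move=> hb hc; have [p hp] := cp_if hb hc (cp_neg hc); exists p => g a rho.
by have := hp g a rho; case: (b g a); case: (c g a).
Qed.

Lemma cp_eqr f h : cps eA e_real f -> cps eA e_real h -> cps eA e_bool (fun g a => f g a == h g a).
Proof.
move=> hf hh; have [p hp] := cp_and (cp_le hf hh) (cp_le hh hf); exists p => g a rho.
by have := hp g a rho; rewrite -eq_le.
Qed.

Lemma cp_isnil B (eB : encoder B) f : cps eA (e_seq eB) f -> cps eA e_bool (fun g a => nilp (f g a)).
Proof.
move=> [p hp]; have [pt ht] := cp_true; have [pf hf] := cp_false.
exists (PIfNil p pt pf) => g a rho; have := hp g a rho; case: (f g a) => [|x s] h.
  by apply: RIfNil_nil h _; exact: (ht g a rho).
by apply: RIfNil_cons h _; exact: (hf g a rho).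
Qed.

Lemma cp_cplx f h : cps eA e_real f -> cps eA e_real h -> cps eA e_cplx (fun g a => f g a +i* h g a).
Proof.
by move=> [p hp] [q hq]; exists (PCons p q) => g a rho; apply: RCons; [exact: hp|exact: hq].
Qed.

(** The only loop of the programs. Its state consists of the argument [a], the accumulator and the
    rest of the list, and it runs until that rest is empty. *)
Lemma cp_foldl B X (eB : encoder B) (eX : encoder X) (L : forall g, A g -> seq (X g))
    (z : forall g, A g -> B g) (F : forall g, A g -> B g -> X g -> B g) :
  cps eA (e_seq eX) L -> cps eA eB z ->
  cps (e_pair (e_pair eA eB) eX) eB (fun g t => F g t.1.1 t.1.2 t.2) ->
  cps eA eB (fun g a => foldl (F g a) (z g a) (L g a)).
Proof.
move=> [pL hL] [pz hz] [pF hF].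
pose v0 := PVar 0.
pose body := PCons (PHead v0) (PCons
  (PLet (PCons (PCons (PHead v0) (PHead (PTail v0))) (PHead (PTail (PTail v0)))) pF)
  (PTail (PTail (PTail v0)))).
exists (PLet (PCons v0 (PCons pz pL)) (PHead (PTail (PWhile (PTail (PTail v0)) body)))) => g a rho.
eapply RLet.
  apply: RCons; first exact: RVar.
  by apply: RCons; [exact: hz|exact: hL].
apply: RHead; eapply RTail.
have loop s b rho' : runs (VCons (eA a) (VCons (eB g b) (e_seq eX s)) :: rho')
    (PWhile (PTail (PTail v0)) body)
    (VCons (eA a) (VCons (eB g (foldl (F g a) b s)) (VNil R))).
  elim: s b => [|x s IH] b /=.
    apply: RWhile_stop; apply: RTail; apply: RTail; exact: RVar.
  have r0 : runs (VCons (eA a) (VCons (eB g b) (e_seq eX (x :: s))) :: rho') v0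
      (VCons (eA a) (VCons (eB g b) (VCons (eX g x) (e_seq eX s)))) by exact: RVar.
  apply: (@RWhile_step _ _ _ _ _ (eX g x) (e_seq eX s) _ _ _ _ (IH (F g a b x))).
    by apply: RTail; apply: RTail; exact: r0.
  apply: RCons; first by apply: RHead; exact: r0.
  apply: RCons; last by apply: RTail; apply: RTail; apply: RTail; exact: r0.
  apply: RLet; last exact: (hF g (a, b, x)).
  apply: RCons; last by apply: RHead; apply: RTail; apply: RTail; exact: r0.
  apply: RCons; first by apply: RHead; exact: r0.
  by apply: RHead; apply: RTail; exact: r0.
exact: loop.
Qed.

End Closure.

Lemma cp_ext (A B : pgraph -> Type) (eA : encoder A) (eB : encoder B) (f h : forall g, A g -> B g) :
  (forall g a, f g a = h g a) -> cps eA eB f -> cps eA eB h.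
Proof. by move=> fh [p hp]; exists p => g a rho; rewrite -fh; exact: hp. Qed.

Lemma foldl_rcons_rev (T : Type) (s t : seq T) : foldl (fun acc x => x :: acc) t s = catrev s t.
Proof. by elim: s t => //= x s IH t; rewrite IH. Qed.

Section Closure2.
Variables (A : pgraph -> Type) (eA : encoder A).

Lemma cp_rev X (eX : encoder X) L : cps eA (e_seq eX) L -> cps eA (e_seq eX) (fun g a => rev (L g a)).
Proof.
move=> hL; apply: (@cp_ext _ _ _ _ (fun g a => foldl (fun acc x => x :: acc) [::] (L g a))).
  by move=> g a; exact: foldl_rcons_rev.
apply: cp_foldl hL _ _; first exact: cp_nil.
by apply: cp_cons; [apply: cp_snd; exact: cp_id|apply: cp_snd; apply: cp_fst; exact: cp_id].
Qed.

Lemma cp_foldr B X (eB : encoder B) (eX : encoder X) (L : forall g, A g -> seq (X g))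
    (z : forall g, A g -> B g) (F : forall g, A g -> X g -> B g -> B g) :
  cps eA (e_seq eX) L -> cps eA eB z ->
  cps (e_pair (e_pair eA eB) eX) eB (fun g t => F g t.1.1 t.2 t.1.2) ->
  cps eA eB (fun g a => foldr (F g a) (z g a) (L g a)).
Proof.
move=> hL hz hF; apply: (@cp_ext _ _ _ _ (fun g a => foldl (fun b x => F g a x b) (z g a) (rev (L g a)))).
  by move=> g a; rewrite foldl_rev.
exact: cp_foldl (cp_rev hL) hz hF.
Qed.

Lemma cp_map B X (eB : encoder B) (eX : encoder X) (L : forall g, A g -> seq (X g))
    (F : forall g, A g -> X g -> B g) :
  cps eA (e_seq eX) L -> cps (e_pair eA eX) eB (fun g t => F g t.1 t.2) ->
  cps eA (e_seq eB) (fun g a => map (F g a) (L g a)).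
Proof.
move=> hL hF; apply: (@cp_ext _ _ _ _ (fun g a => foldr (fun x acc => F g a x :: acc) [::] (L g a))).
  by move=> g a; elim: (L g a) => //= x s ->.
apply: cp_foldr hL _ _; first exact: cp_nil.
apply: cp_cons; last by apply: cp_snd; apply: cp_fst; exact: cp_id.
have hp : cps (e_pair (e_pair eA (e_seq eB)) eX) (e_pair eA eX) (fun g t => (t.1.1, t.2)).
  by apply: cp_pair; [apply: cp_fst; apply: cp_fst; exact: cp_id|apply: cp_snd; exact: cp_id].
exact: (cp_cut hp hF).
Qed.

Lemma cp_all X (eX : encoder X) (L : forall g, A g -> seq (X g)) (P : forall g, A g -> X g -> bool) :
  cps eA (e_seq eX) L -> cps (e_pair eA eX) e_bool (fun g t => P g t.1 t.2) ->
  cps eA e_bool (fun g a => all (P g a) (L g a)).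
Proof.
move=> hL hP; apply: (@cp_ext _ _ _ _ (fun g a => foldr andb true (map (P g a) (L g a)))).
  by move=> g a; elim: (L g a) => //= x s ->.
apply: (@cp_foldr _ _ e_bool e_bool _ _ (fun g a x b => x && b)); first exact: cp_map hL hP.
  exact: cp_true.
by apply: cp_and; [apply: cp_snd; exact: cp_id|apply: cp_snd; apply: cp_fst; exact: cp_id].
Qed.

Lemma cp_has X (eX : encoder X) (L : forall g, A g -> seq (X g)) (P : forall g, A g -> X g -> bool) :
  cps eA (e_seq eX) L -> cps (e_pair eA eX) e_bool (fun g t => P g t.1 t.2) ->
  cps eA e_bool (fun g a => has (P g a) (L g a)).
Proof.
move=> hL hP; apply: (@cp_ext _ _ _ _ (fun g a => ~~ all (fun x => ~~ P g a x) (L g a))).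
  by move=> g a; rewrite -has_predC; apply: eq_has => x /=; rewrite negbK.
by apply: cp_neg; apply: cp_all hL _; exact: cp_neg.
Qed.

Lemma cp_filter X (eX : encoder X) (L : forall g, A g -> seq (X g)) (P : forall g, A g -> X g -> bool) :
  cps eA (e_seq eX) L -> cps (e_pair eA eX) e_bool (fun g t => P g t.1 t.2) ->
  cps eA (e_seq eX) (fun g a => seq.filter (P g a) (L g a)).
Proof.
move=> hL hP.
apply: (@cp_ext _ _ _ _ (fun g a => foldr (fun x acc => if P g a x then x :: acc else acc) [::] (L g a))) => //.
apply: cp_foldr hL _ _; first exact: cp_nil.
have hacc : cps (e_pair (e_pair eA (e_seq eX)) eX) (e_seq eX) (fun g t => t.1.2).
  by apply: cp_snd; apply: cp_fst; exact: cp_id.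
apply: (cp_if _ _ hacc); last by apply: (cp_cons _ hacc); apply: cp_snd; exact: cp_id.
have hp : cps (e_pair (e_pair eA (e_seq eX)) eX) (e_pair eA eX) (fun g t => (t.1.1, t.2)).
  by apply: cp_pair; [apply: cp_fst; apply: cp_fst; exact: cp_id|apply: cp_snd; exact: cp_id].
exact: (cp_cut hp hP).
Qed.

Lemma cp_cat X (eX : encoder X) L M : cps eA (e_seq eX) L -> cps eA (e_seq eX) M ->
  cps eA (e_seq eX) (fun g a => L g a ++ M g a).
Proof.
move=> hL hM; apply: (@cp_ext _ _ _ _ (fun g a => foldr cons (M g a) (L g a))).
  by move=> g a; elim: (L g a) => //= x s ->.
apply: cp_foldr hL hM _.
by apply: cp_cons; [apply: cp_snd; exact: cp_id|apply: cp_snd; apply: cp_fst; exact: cp_id].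
Qed.

End Closure2.

Section Closure3.
Variables (A : pgraph -> Type) (eA : encoder A).

Lemma cp_flatten X (eX : encoder X) L : cps eA (e_seq (e_seq eX)) L ->
  cps eA (e_seq eX) (fun g a => flatten (L g a)).
Proof.
move=> hL; apply: (cp_foldr (F := fun g a x b => x ++ b)) hL _ _; first exact: cp_nil.
simpl; apply: cp_cat; [apply: cp_snd; exact: cp_id|apply: cp_snd; apply: cp_fst; exact: cp_id].
Qed.

Lemma cp_sum X (eX : encoder X) (L : forall g, A g -> seq (X g)) (F : forall g, A g -> X g -> R) :
  cps eA (e_seq eX) L -> cps (e_pair eA eX) e_real (fun g t => F g t.1 t.2) ->
  cps eA e_real (fun g a => \sum_(x <- L g a) F g a x).
Proof.
move=> hL hF; apply: (@cp_ext _ _ _ _ (fun g a => foldr +%R 0 (map (F g a) (L g a)))).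
  by move=> g a; rewrite foldrE big_map.
apply: (cp_foldr (F := fun g a x b => x + b)); first exact: cp_map hL hF.
  exact: cp_zero.
by apply: cp_add; [apply: cp_snd; exact: cp_id|apply: cp_snd; apply: cp_fst; exact: cp_id].
Qed.

End Closure3.

Fixpoint subs (T : Type) (s : seq T) : seq (seq T) :=
  if s is x :: s' then subs s' ++ map (cons x) (subs s') else [:: [::]].

Lemma mem_subs (T : eqType) (s t : seq T) : (t \in subs s) = subseq t s.
Proof.
elim: s t => [|x s IH] t /=; first by rewrite inE.
rewrite mem_cat IH; case: t => [|y t] /=; first by rewrite sub0seq.
apply/orP/idP => [[h|/mapP[u]]|].
- by case: eqP => // yx; apply: subseq_trans h; rewrite yx; exact: subseq_cons.
- by rewrite IH => us [-> ->]; rewrite eqxx.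
- case: eqP => [-> h|_ h]; [right|by left].
  by apply: map_f; rewrite IH.
Qed.

Lemma cp_subs A (eA : encoder A) X (eX : encoder X) L : cps eA (e_seq eX) L ->
  cps eA (e_seq (e_seq eX)) (fun g a => subs (L g a)).
Proof.
move=> hL.
apply: (@cp_ext _ _ _ _ (fun g a => foldr (fun x acc => acc ++ map (cons x) acc) [:: [::]] (L g a))).
  by move=> g a; elim: (L g a) => //= x s ->.
apply: cp_foldr hL _ _; first by apply: cp_cons; exact: cp_nil.
have hacc : cps (e_pair (e_pair eA (e_seq (e_seq eX))) eX) (e_seq (e_seq eX)) (fun g t => t.1.2).
  by apply: cp_snd; apply: cp_fst; exact: cp_id.
apply: cp_cat => //; apply: cp_map hacc _.
by apply: cp_cons; [apply: cp_snd; apply: cp_fst; exact: cp_id|apply: cp_snd; exact: cp_id].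
Qed.

(** The input lists vertices and edges without their own numbers; these are attached here, as reals
    counted from 0. *)
Definition indexed (T : Type) (s : seq T) : seq (R * T) :=
  foldr (fun x acc => (0, x) :: map (fun p => (p.1 + 1, p.2)) acc) [::] s.

Lemma indexedE (T : Type) (s : seq T) : indexed s = zip [seq i%:R | i <- iota 0 (size s)] s.
Proof.
elim: s => //= x s ->; congr (_ :: _); rewrite (iotaDl 1 0) -map_comp.
elim: s (iota 0 (size s)) => [|y s IH] [|i l] //=; congr (_ :: _) => //.
by rewrite natrD addrC.
Qed.

Lemma cp_indexed A (eA : encoder A) X (eX : encoder X) L : cps eA (e_seq eX) L ->
  cps eA (e_seq (e_pair e_real eX)) (fun g a => indexed (L g a)).
Proof.
move=> hL; apply: cp_foldr hL _ _; first exact: cp_nil.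
have hx : cps (e_pair (e_pair eA (e_seq (e_pair e_real eX))) eX) eX (fun g t => t.2).
  by apply: cp_snd; exact: cp_id.
apply: cp_cons; first by apply: (cp_pair _ hx); exact: cp_zero.
have hacc : cps (e_pair (e_pair eA (e_seq (e_pair e_real eX))) eX) (e_seq (e_pair e_real eX)) (fun g t => t.1.2).
  by apply: cp_snd; apply: cp_fst; exact: cp_id.
apply: (cp_map (F := fun g a p => (p.1 + 1, p.2))) hacc _.
apply: cp_pair; last by apply: cp_snd; apply: cp_snd; exact: cp_id.
by apply: cp_add; [apply: cp_fst; apply: cp_snd; exact: cp_id|exact: cp_one].
Qed.

(** The characteristic polynomial splits over the complex numbers; its real roots, sorted and
    without repetition, are the list that the oracle [PSpectrum] has to return. *)
Lemma real_spectrum n (M : 'M[R[i]]_n) : exists s : seq R,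
  sorted <%R s /\ forall x : R, (x \in s) = eigenvalue M x%:C.
Proof.
have [rs rsE] := closed_field_poly_normal (char_poly M).
exists (sort <=%R (undup [seq complex.Re z | z <- rs & complex.Im z == 0])); split.
  by rewrite sort_lt_sorted undup_uniq.
move=> x; rewrite mem_sort mem_undup eigenvalue_root_char rsE.
rewrite (monicP (char_poly_monic M)) scale1r root_prod_XsubC.
apply/mapP/idP => [[[a b]] /=|h].
  by rewrite mem_filter /= => /andP[/eqP -> h] ->.
by exists x%:C => //; rewrite mem_filter /= eqxx.
Qed.

Definition specseq n (M : 'M[R[i]]_n) : seq R := projT1 (cid (real_spectrum M)).

Lemma specseqP n (M : 'M[R[i]]_n) : sorted <%R (specseq M) /\
  forall x : R, (x \in specseq M) = eigenvalue M x%:C.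
Proof. by rewrite /specseq; case: cid. Qed.

Lemma cp_spectrum A (eA : encoder A) (M : forall g, A g -> 'M[R[i]]_#|gV g|) :
  cps eA e_mx M -> (forall g a i j, M g a i j = Num.conj (M g a j i)) ->
  cps eA (e_seq e_real) (fun g a => specseq (M g a)).
Proof.
move=> [p hp] hM; exists (PSpectrum p) => g a rho.
have [ss sE] := specseqP (M g a).
apply: (RSpectrum (hp g a rho)) => //.
by apply/matrixP => i j; rewrite !mxE hM.
Qed.

End Programs.

(** * The decision procedure *)

Section Algorithm.
Variables (R : realType) (V E : finType) (G : wgraph R V E).
Local Notation src := (src G).
Local Notation tgt := (tgt G).
Local Notation erev := (erev G).
Local Notation weight := (weight G).
Implicit Types (e : E) (u v : V) (X D : seq V).

Definition nzero e : bool := ~~ ((complex.Re (weight e) == 0) && (complex.Im (weight e) == 0)).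
Definition inb X v : bool := has (fun w => w == v) X.
Definition srcin X e : bool := has (fun w => src e == w) X.
Definition tgtin X e : bool := has (fun w => tgt e == w) X.
Definition intb X e : bool := nzero e && (srcin X e && tgtin X e).
Definition nbb e f : bool := (tgt e == src f) && ~~ (e == erev f).
(* The graph has a cycle inside [X] iff some nonempty set of edges inside [X]
   contains a non-backtracking successor of each of its elements. *)
Definition forestb X : bool :=
  all (fun S => nilp S || ~~ all (fun e => intb X e && has (fun f => nbb e f) S) S) (subs (enum E)).
Definition bdryb X v : bool :=
  ~~ inb X v && has (fun e => nzero e && (srcin X e && (tgt e == v))) (enum E).
Definition countb X : bool :=
  ~~ (\sum_(v <- enum V) (if inb X v then 1 + 1 else 0) <=
      \sum_(e <- enum E) (if intb X e then 1 else 0) +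
      \sum_(v <- enum V) (if bdryb X v then 1 + 1 else 0 : R)).
(* [D] is a union of components of [X]. *)
Definition closedb X D : bool :=
  all (fun e => intb X e ==> (srcin D e == tgtin D e)) (enum E).
Definition padentry (c : R) D u v : R[i] :=
  (if inb D u && inb D v then
     (if u == v then pot G u else 0) +
     \sum_(e <- enum E) (if (tgt e == u) && (src e == v) then complex.Re (weight e) else 0)
   else if u == v then c else 0) +i*
  (if inb D u && inb D v then
     \sum_(e <- enum E) (if (tgt e == u) && (src e == v) then complex.Im (weight e) else 0)
   else 0).
(* Matrices of the format of the whole graph, extended outside [D] by [c] times
   the identity: the spectrum of [D] is the intersection of those for two
   distinct values of [c]. *)
Definition padmx (c : R) D : 'M[R[i]]_#|V| := \matrix_(i, j) padentry c D (enum_val i) (enum_val j).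
Definition eigb D (lam : R) : bool :=
  has (fun x => x == lam) (specseq (padmx 0 D)) && has (fun x => x == lam) (specseq (padmx 1 D)).
(** All nonempty unions of components are tested, so single components need not be recognised. This
    is equivalent, as an eigenvector of one component extends by zero to every union that contains
    it. *)
Definition goodb (lam : R) X : bool :=
  forestb X && (countb X && all (fun D =>
    (~~ nilp D && (all (inb X) D && closedb X D)) ==> eigb D lam) (subs (enum V))).
(** The candidates come from the spectra for all [D]; those that the padding introduces are removed
    by [goodb]. *)
Definition output : seq R :=
  flatten [seq seq.filter (fun lam => has (goodb lam) (subs (enum V))) (specseq (padmx 0 D))
          | D <- subs (enum V)].

End Algorithm.

(** * Programs on graph data *)

Section GraphPrograms.
Variable R : realType.
Local Notation e_real := (@e_real R).
Local Notation e_bool := (@e_bool R).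
Local Notation encoder := (@encoder R).

Definition rk_enum (T : finType) (x : T) : R := (index x (enum T))%:R.

Lemma rk_enum_eq (T : finType) (x y : T) : (rk_enum x == rk_enum y) = (x == y).
Proof.
rewrite /rk_enum eqr_nat; apply/eqP/eqP => [h|->//].
by rewrite -(nth_index x (mem_enum T x)) h nth_index // mem_enum.
Qed.

Lemma indexed_enum (T : finType) (U : Type) (h : T -> U) :
  indexed R (map h (enum T)) = [seq (rk_enum x, h x) | x <- enum T].
Proof.
rewrite indexedE size_map.
have -> : [seq i%:R | i <- iota 0 (size (enum T))] = map (@rk_enum T) (enum T).
  apply: (@eq_from_nth _ 0) => [|i]; first by rewrite size_map size_iota [RHS]size_map.
  rewrite size_map size_iota => si.
  have x : T by move: si; case: (enum T) => [|y s]; [rewrite ltn0|move=> _; exact: y].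
  rewrite (nth_map 0%N) ?size_iota // nth_iota // add0n (nth_map x) //.
  by rewrite /rk_enum index_uniq // enum_uniq.
by elim: (enum T) => //= x s ->.
Qed.

Definition e_unit : encoder (fun=> unit) := fun g _ => VNil R.
Definition e_graph : encoder (fun=> unit) := fun g _ => encode_graph (gG g).
Definition e_vert : encoder (fun g => gV g) := fun g v =>
  e_pair (g := g) e_real e_real (rk_enum v, pot (gG g) v).
(** The trailing unit is encoded as [VNil], which gives these nested pairs the encoding of the lists
    in [encode_graph]. *)
Definition edata (g : pgraph R) (e : gE g) : R * (R * (R * (R * (R * unit)))) :=
  (rk_enum (src (gG g) e), (rk_enum (tgt (gG g) e), (rk_enum (erev (gG g) e),
    (complex.Re (weight (gG g) e), (complex.Im (weight (gG g) e), tt))))).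
Definition e_rec := e_pair e_real (e_pair e_real (e_pair e_real (e_pair e_real (e_pair e_real e_unit)))).
Definition e_edge : encoder (fun g => gE g) := fun g e =>
  e_pair (g := g) e_real e_rec (rk_enum e, edata e).

Section Context.
Variables (A : pgraph R -> Type) (eA : encoder A).

Lemma cp_enumV f : cps eA e_graph f -> cps eA (e_seq e_vert) (fun g _ => enum (gV g)).
Proof.
move=> [p hp].
have hL : cps eA (e_seq e_real) (fun g _ => map (pot (gG g)) (enum (gV g))).
  by exists (PHead p) => g a rho; apply: RHead; exact: hp.
have [q hq] := cp_indexed hL; exists q => g a rho; have := hq g a rho.
rewrite /e_seq indexed_enum -map_comp; exact.
Qed.

Lemma cp_enumE f : cps eA e_graph f -> cps eA (e_seq e_edge) (fun g _ => enum (gE g)).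
Proof.
move=> [p hp].
have hL : cps eA (e_seq e_rec) (fun g _ => map (@edata g) (enum (gE g))).
  exists (PTail p) => g a rho; apply: RTail; have := hp g a rho.
  by rewrite /e_graph /encode_graph /e_seq -map_comp; exact.
have [q hq] := cp_indexed hL; exists q => g a rho; have := hq g a rho.
rewrite /e_seq indexed_enum -map_comp; exact.
Qed.

Lemma cp_vrank v : cps eA e_vert v -> cps eA e_real (fun g a => rk_enum (v g a)).
Proof. exact: (@cp_fst _ _ _ _ _ e_real e_real (fun g a => (rk_enum (v g a), pot (gG g) (v g a)))). Qed.

Lemma cp_pot v : cps eA e_vert v -> cps eA e_real (fun g a => pot (gG g) (v g a)).
Proof. exact: (@cp_snd _ _ _ _ _ e_real e_real (fun g a => (rk_enum (v g a), pot (gG g) (v g a)))). Qed.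

Lemma cp_erank e : cps eA e_edge e -> cps eA e_real (fun g a => rk_enum (e g a)).
Proof. exact: (@cp_fst _ _ _ _ _ e_real e_rec (fun g a => (rk_enum (e g a), edata (e g a)))). Qed.

Lemma cp_edata e : cps eA e_edge e -> cps eA e_rec (fun g a => edata (e g a)).
Proof. exact: (@cp_snd _ _ _ _ _ e_real e_rec (fun g a => (rk_enum (e g a), edata (e g a)))). Qed.

Lemma cp_srank e : cps eA e_edge e -> cps eA e_real (fun g a => rk_enum (src (gG g) (e g a))).
Proof. by move=> /cp_edata /cp_fst. Qed.

Lemma cp_trank e : cps eA e_edge e -> cps eA e_real (fun g a => rk_enum (tgt (gG g) (e g a))).
Proof. by move=> /cp_edata /cp_snd /cp_fst. Qed.

Lemma cp_rrank e : cps eA e_edge e -> cps eA e_real (fun g a => rk_enum (erev (gG g) (e g a))).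
Proof. by move=> /cp_edata /cp_snd /cp_snd /cp_fst. Qed.

Lemma cp_wRe e : cps eA e_edge e -> cps eA e_real (fun g a => complex.Re (weight (gG g) (e g a))).
Proof. by move=> /cp_edata /cp_snd /cp_snd /cp_snd /cp_fst. Qed.

Lemma cp_wIm e : cps eA e_edge e -> cps eA e_real (fun g a => complex.Im (weight (gG g) (e g a))).
Proof. by move=> /cp_edata /cp_snd /cp_snd /cp_snd /cp_snd /cp_fst. Qed.

Lemma cp_veq v w : cps eA e_vert v -> cps eA e_vert w -> cps eA e_bool (fun g a => v g a == w g a).
Proof.
move=> hv hw; apply: (cp_ext _ (cp_eqr (cp_vrank hv) (cp_vrank hw))) => g a.
exact: rk_enum_eq.
Qed.

Lemma cp_srceq e v : cps eA e_edge e -> cps eA e_vert v ->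
  cps eA e_bool (fun g a => src (gG g) (e g a) == v g a).
Proof.
move=> he hv; apply: (cp_ext _ (cp_eqr (cp_srank he) (cp_vrank hv))) => g a.
exact: rk_enum_eq.
Qed.

Lemma cp_tgteq e v : cps eA e_edge e -> cps eA e_vert v ->
  cps eA e_bool (fun g a => tgt (gG g) (e g a) == v g a).
Proof.
move=> he hv; apply: (cp_ext _ (cp_eqr (cp_trank he) (cp_vrank hv))) => g a.
exact: rk_enum_eq.
Qed.

Lemma cp_nbb e f : cps eA e_edge e -> cps eA e_edge f ->
  cps eA e_bool (fun g a => nbb (gG g) (e g a) (f g a)).
Proof.
move=> he hf; have h1 := cp_eqr (cp_trank he) (cp_srank hf).
have h2 := cp_neg (cp_eqr (cp_erank he) (cp_rrank hf)).
apply: (cp_ext _ (cp_and h1 h2)) => g a; by rewrite !rk_enum_eq.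
Qed.

Lemma cp_nzero e : cps eA e_edge e -> cps eA e_bool (fun g a => nzero (gG g) (e g a)).
Proof.
move=> he; apply: cp_neg; apply: cp_and; apply: cp_eqr; try exact: cp_zero.
  exact: cp_wRe.
exact: cp_wIm.
Qed.

Lemma cp_or b c : cps eA e_bool b -> cps eA e_bool c -> cps eA e_bool (fun g a => b g a || c g a).
Proof. by move=> hb hc; exact: cp_if hb (cp_true _) hc. Qed.

(** A subprogram is verified once with variables as arguments and then applied to arbitrary
    expressions; the variants below also pass the graph along. *)
Lemma cp_lift2 X Y B (eX : encoder X) (eY : encoder Y) (eB : encoder B)
    (h : forall g, X g -> Y g -> B g) x y :
  cps (e_pair eX eY) eB (fun g t => h g t.1 t.2) ->
  cps eA eX x -> cps eA eY y -> cps eA eB (fun g a => h g (x g a) (y g a)).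
Proof. by move=> hh hx hy; exact: (cp_cut (cp_pair hx hy) hh). Qed.

Lemma cp_lift3 X Y B (eX : encoder X) (eY : encoder Y) (eB : encoder B)
    (h : forall g, X g -> Y g -> B g) f x y :
  cps (e_pair (e_pair e_graph eX) eY) eB (fun g t => h g t.1.2 t.2) ->
  cps eA e_graph f -> cps eA eX x -> cps eA eY y -> cps eA eB (fun g a => h g (x g a) (y g a)).
Proof. by move=> hh hf hx hy; exact: (cp_cut (cp_pair (cp_pair hf hx) hy) hh). Qed.

Lemma cp_lift2g X B (eX : encoder X) (eB : encoder B) (h : forall g, X g -> B g) f x :
  cps (e_pair e_graph eX) eB (fun g t => h g t.2) ->
  cps eA e_graph f -> cps eA eX x -> cps eA eB (fun g a => h g (x g a)).
Proof. by move=> hh hf hx; exact: (cp_cut (cp_pair hf hx) hh). Qed.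

End Context.

(** Environments are pairs nested to the left, the newest binding on the right: [var] reads any
    binding, and [graph] reaches the input at the far left. *)
Ltac var := lazy beta; repeat first [exact: cp_id | apply: cp_fst | apply: cp_snd].
Ltac graph := repeat first [exact: cp_id | apply: cp_fst].

Local Notation e_verts := (e_seq e_vert).

Lemma cp_inb0 : cps (e_pair e_verts e_vert) e_bool (fun g t => inb t.1 t.2).
Proof. by apply: cp_has; [var|apply: cp_veq; var]. Qed.

Lemma cp_srcin0 : cps (e_pair e_verts e_edge) e_bool (fun g t => srcin (gG g) t.1 t.2).
Proof. by apply: cp_has; [var|apply: cp_srceq; var]. Qed.

Lemma cp_tgtin0 : cps (e_pair e_verts e_edge) e_bool (fun g t => tgtin (gG g) t.1 t.2).
Proof. by apply: cp_has; [var|apply: cp_tgteq; var]. Qed.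

Section Context2.
Variables (A : pgraph R -> Type) (eA : encoder A).

Lemma cp_inb X v : cps eA e_verts X -> cps eA e_vert v ->
  cps eA e_bool (fun g a => inb (X g a) (v g a)).
Proof. exact: (cp_lift2 (h := fun g X v => inb X v) cp_inb0). Qed.

Lemma cp_srcin X e : cps eA e_verts X -> cps eA e_edge e ->
  cps eA e_bool (fun g a => srcin (gG g) (X g a) (e g a)).
Proof. exact: (cp_lift2 (h := fun g X e => srcin (gG g) X e) cp_srcin0). Qed.

Lemma cp_tgtin X e : cps eA e_verts X -> cps eA e_edge e ->
  cps eA e_bool (fun g a => tgtin (gG g) (X g a) (e g a)).
Proof. exact: (cp_lift2 (h := fun g X e => tgtin (gG g) X e) cp_tgtin0). Qed.

Lemma cp_intb X e : cps eA e_verts X -> cps eA e_edge e ->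
  cps eA e_bool (fun g a => intb (gG g) (X g a) (e g a)).
Proof.
move=> hX he; apply: cp_and; first exact: cp_nzero.
by apply: cp_and; [exact: cp_srcin|exact: cp_tgtin].
Qed.

End Context2.

Lemma cp_forestb0 : cps (e_pair e_graph e_verts) e_bool (fun g t => forestb (gG g) t.2).
Proof.
apply: cp_all; first by apply: cp_subs; apply: cp_enumE; graph.
lazy beta; apply: cp_or; first by apply: cp_isnil; var.
apply: cp_neg; apply: cp_all; first by var.
lazy beta; apply: cp_and; first by apply: cp_intb; var.
by apply: cp_has; [var|apply: cp_nbb; var].
Qed.

Lemma cp_bdryb0 : cps (e_pair (e_pair e_graph e_verts) e_vert) e_bool
  (fun g t => bdryb (gG g) t.1.2 t.2).
Proof.
apply: cp_and; first by apply: cp_neg; apply: cp_inb; var.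
apply: cp_has; first by apply: cp_enumE; graph.
lazy beta; apply: cp_and; first by apply: cp_nzero; var.
by apply: cp_and; [apply: cp_srcin; var|apply: cp_tgteq; var].
Qed.

Lemma cp_countb0 : cps (e_pair e_graph e_verts) e_bool (fun g t => countb (gG g) t.2).
Proof.
have c2 B (eB : encoder B) : cps eB e_real (fun g a => 1 + 1) by apply: cp_add; exact: cp_one.
apply: cp_neg; apply: cp_le.
  apply: cp_sum; first by apply: cp_enumV; graph.
  by lazy beta; apply: cp_if; [apply: cp_inb; var|exact: c2|exact: cp_zero].
apply: cp_add.
  apply: cp_sum; first by apply: cp_enumE; graph.
  by lazy beta; apply: cp_if; [apply: cp_intb; var|exact: cp_one|exact: cp_zero].
apply: cp_sum; first by apply: cp_enumV; graph.
lazy beta; apply: cp_if; [|exact: c2|exact: cp_zero].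
by apply: (cp_lift3 (h := fun g X v => bdryb (gG g) X v) cp_bdryb0); [graph|var|var].
Qed.

Lemma cp_closedb0 : cps (e_pair (e_pair e_graph e_verts) e_verts) e_bool
  (fun g t => closedb (gG g) t.1.2 t.2).
Proof.
apply: cp_all; first by apply: cp_enumE; graph.
lazy beta; apply: cp_imply; first by apply: cp_intb; var.
by apply: cp_eqb; [apply: cp_srcin; var|apply: cp_tgtin; var].
Qed.

Lemma enum_map_val (T : finType) : enum T = [seq enum_val i | i <- enum 'I_#|T|].
Proof.
have sE : size [seq enum_val i | i <- enum 'I_#|T|] = #|T| by rewrite size_map size_enum_ord.
case eT : (enum T) => [|x s]; first by apply/esym/size0nil; rewrite sE cardE eT.
rewrite -eT; apply: (@eq_from_nth _ x) => [|i]; first by rewrite sE cardE.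
rewrite -cardE => si; rewrite (nth_map (Ordinal si)) ?size_enum_ord //.
by rewrite (enum_val_nth x) nth_enum_ord.
Qed.

Lemma cp_mx A (eA : encoder A) f (m : forall g, A g -> gV g -> gV g -> R[i]) :
  cps eA e_graph f ->
  cps (e_pair (e_pair eA e_vert) e_vert) (@e_cplx R) (fun g t => m g t.1.1 t.1.2 t.2) ->
  cps eA (@e_mx R) (fun g a => \matrix_(i, j) m g a (enum_val i) (enum_val j)).
Proof.
move=> hf hm.
have [p hp] : cps eA (e_seq (e_seq (@e_cplx R)))
    (fun g a => [seq [seq m g a v w | w <- enum (gV g)] | v <- enum (gV g)]).
  apply: cp_map; first exact: cp_enumV hf.
  lazy beta; apply: cp_map; first by apply: (cp_enumV (f := fun g t => f g t.1)); apply: cp_cut hf; var.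
  exact: hm.
exists p => g a rho; have := hp g a rho.
suff -> : e_seq (g := g) (e_seq (@e_cplx R)) [seq [seq m g a v w | w <- enum (gV g)] | v <- enum (gV g)] =
    e_mx (g := g) (\matrix_(i, j) m g a (enum_val i) (enum_val j)) by [].
rewrite /e_mx /vmatrix /e_seq (enum_map_val (gV g)). congr vlist; rewrite -!map_comp.
apply: eq_map => i /=; congr vlist; rewrite -!map_comp.
by apply: eq_map => j /=; rewrite mxE.
Qed.

Lemma cp_padentry0 (c : R) : (forall B (eB : encoder B), cps eB e_real (fun g a => c)) ->
  cps (e_pair (e_pair (e_pair e_graph e_verts) e_vert) e_vert) (@e_cplx R)
    (fun g t => padentry (gG g) c t.1.1.2 t.1.2 t.2).
Proof.
move=> hc.
have hin : cps (e_pair (e_pair (e_pair e_graph e_verts) e_vert) e_vert) e_bool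
    (fun g t => inb t.1.1.2 t.1.2 && inb t.1.1.2 t.2).
  by apply: cp_and; apply: cp_inb; var.
have heq : cps (e_pair (e_pair (e_pair e_graph e_verts) e_vert) e_vert) e_bool
    (fun g t => t.1.2 == t.2) by apply: cp_veq; var.
apply: cp_cplx; apply: (cp_if hin).
- apply: cp_add; first by apply: (cp_if heq); [apply: cp_pot; var|exact: cp_zero].
  apply: cp_sum; first by apply: cp_enumE; graph.
  lazy beta; apply: cp_if; [|apply: cp_wRe; var|exact: cp_zero].
  by apply: cp_and; [apply: cp_tgteq; var|apply: cp_srceq; var].
- by apply: (cp_if heq); [exact: hc|exact: cp_zero].
- apply: cp_sum; first by apply: cp_enumE; graph.
  lazy beta; apply: cp_if; [|apply: cp_wIm; var|exact: cp_zero].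
  by apply: cp_and; [apply: cp_tgteq; var|apply: cp_srceq; var].
- exact: cp_zero.
Qed.

Lemma padentryE (g : pgraph R) (c : R) (D : seq (gV g)) u v :
  padentry (gG g) c D u v =
  if (u \in D) && (v \in D) then entry (gG g) u v else c%:C * (u == v)%:R.
Proof.
have inE' w : inb D w = (w \in D) by exact: has_pred1.
rewrite /padentry !inE'; case: ifP => _; last by case: eqP; rewrite ?mulr1 ?mulr0.
rewrite entryE.
have -> : \sum_(e | (tgt (gG g) e == u) && (src (gG g) e == v)) weight (gG g) e =
   (\sum_(e <- enum (gE g)) (if (tgt (gG g) e == u) && (src (gG g) e == v) then complex.Re (weight (gG g) e) else 0)) +i*
   (\sum_(e <- enum (gE g)) (if (tgt (gG g) e == u) && (src (gG g) e == v) then complex.Im (weight (gG g) e) else 0)).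
  transitivity (\sum_(e <- enum (gE g)) (if (tgt (gG g) e == u) && (src (gG g) e == v) then weight (gG g) e else 0)).
    by rewrite big_enum big_mkcond.
  elim: (enum _) => [|e s IH]; first by rewrite !big_nil.
  by rewrite !big_cons IH; case: ifP => _; case: (weight (gG g) e) => a b; simpc.
by case: eqP => _; rewrite ?mulr1 ?mulr0; simpc.
Qed.

(** The oracle accepts only Hermitian matrices. *)
Lemma padmx_herm (g : pgraph R) (c : R) (D : seq (gV g)) i j :
  padmx (gG g) c D i j = Num.conj (padmx (gG g) c D j i).
Proof.
rewrite !mxE !padentryE [in RHS]andbC.
case: ifP => _; first exact: entry_herm.
by rewrite conjCM conjCR rmorph_nat eq_sym.
Qed.

Lemma cp_spec0 (c : R) : (forall B (eB : encoder B), cps eB e_real (fun g a => c)) ->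
  cps (e_pair e_graph e_verts) (e_seq e_real) (fun g t => specseq (padmx (gG g) c t.2)).
Proof.
move=> hc; apply: cp_spectrum; last by move=> g a i j; exact: padmx_herm.
apply: (cp_mx (m := fun g a u v => padentry (gG g) c a.2 u v)); first by graph.
exact: cp_padentry0.
Qed.

Lemma cp_eigb0 : cps (e_pair (e_pair e_graph e_verts) e_real) e_bool
  (fun g t => eigb (gG g) t.1.2 t.2).
Proof.
have spec c (hc : forall B (eB : encoder B), cps eB e_real (fun g a => c)) :
    cps (e_pair (e_pair e_graph e_verts) e_real) (e_seq e_real)
      (fun g t => specseq (padmx (gG g) c t.1.2)).
  by apply: (cp_lift2g (h := fun g D => specseq (padmx (gG g) c D)) (cp_spec0 hc)); [graph|var].
apply: cp_and.
  apply: cp_has; first by apply: spec => B eB; exact: cp_zero.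
  by apply: cp_eqr; var.
apply: cp_has; first by apply: spec => B eB; exact: cp_one.
by apply: cp_eqr; var.
Qed.

Lemma cp_goodb0 : cps (e_pair (e_pair e_graph e_real) e_verts) e_bool
  (fun g t => goodb (gG g) t.1.2 t.2).
Proof.
apply: cp_and.
  by apply: (cp_lift2g (h := fun g X => forestb (gG g) X) cp_forestb0); [graph|var].
apply: cp_and.
  by apply: (cp_lift2g (h := fun g X => countb (gG g) X) cp_countb0); [graph|var].
apply: cp_all; first by apply: cp_subs; apply: cp_enumV; graph.
lazy beta; apply: cp_imply.
  apply: cp_and; first by apply: cp_neg; apply: cp_isnil; var.
  apply: cp_and; first by apply: cp_all; [var|apply: cp_inb; var].
  by apply: (cp_lift3 (h := fun g X D => closedb (gG g) X D) cp_closedb0); [graph|var|var].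
by apply: (cp_lift3 (h := fun g D l => eigb (gG g) D l) cp_eigb0); [graph|var|var].
Qed.

Lemma cp_output : cps e_graph (e_seq e_real) (fun g _ => output (gG g)).
Proof.
apply: cp_flatten; apply: cp_map; first by apply: cp_subs; apply: (cp_enumV (f := fun g a => a)); graph.
lazy beta; apply: cp_filter.
  apply: (cp_lift2g (h := fun g D => specseq (padmx (gG g) 0 D)) (cp_spec0 _)); [|graph|var].
  by move=> B eB; exact: cp_zero.
lazy beta; apply: cp_has; first by apply: cp_subs; apply: cp_enumV; graph.
by apply: (cp_lift3 (h := fun g l X => goodb (gG g) l X) cp_goodb0); [graph|var|var].
Qed.

End GraphPrograms.

(** * Correctness of the decision procedure *)

Section Correctness.
Variables (R : realType) (V E : finType) (G : wgraph R V E).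
Local Notation C := R[i].
Local Notation src := (src G).
Local Notation tgt := (tgt G).
Local Notation weight := (weight G).
Implicit Types (e : E) (u v : V) (X D : seq V).

Lemma nzeroE e : nzero G e = (weight e != 0).
Proof. by rewrite /nzero eq_complex. Qed.

Lemma inbE X v : inb X v = (v \in X).
Proof. exact: has_pred1. Qed.

Lemma srcinE X e : srcin G X e = (src e \in X).
Proof. by rewrite /srcin -has_pred1; apply: eq_has => w; rewrite eq_sym. Qed.

Lemma tgtinE X e : tgtin G X e = (tgt e \in X).
Proof. by rewrite /tgtin -has_pred1; apply: eq_has => w; rewrite eq_sym. Qed.

Definition lset X : {set V} := [set v in X].

Lemma mem_lset X v : (v \in lset X) = (v \in X).
Proof. by rewrite inE. Qed.

Lemma intbE X e : intb G X e = intE G (lset X) e.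
Proof. by rewrite /intb /intE nzeroE srcinE tgtinE !mem_lset. Qed.

Lemma bdrybE X v : bdryb G X v = (v \in bdry G (lset X)).
Proof.
rewrite /bdryb inbE inE; apply/andP/existsP => [[vX /hasP[e _ /andP[w0 /andP[sX /eqP te]]]]|[e]].
  exists e; rewrite /exitE -nzeroE w0 !mem_lset -srcinE sX te vX eqxx //.
move=> /andP[/and3P[w0 sX tX] /eqP te]; rewrite mem_lset te in tX; split=> //.
apply/hasP; exists e; first by rewrite mem_enum.
by rewrite nzeroE w0 srcinE -mem_lset sX te eqxx.
Qed.

Lemma sum_enum_if (T : finType) (P : pred T) (c : R) :
  \sum_(x <- enum T) (if P x then c else 0) = c *+ #|[pred x | P x]|.
Proof. by rewrite big_enum /= -big_mkcond sumr_const. Qed.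

Lemma countbE X : countb G X =
  (#|intEset G (lset X)| + 2 * #|bdry G (lset X)| < 2 * #|lset X|)%N.
Proof.
rewrite /countb !sum_enum_if -ltNge.
have -> : #|[pred x | inb X x]| = #|lset X| by apply: eq_card => v; rewrite !inE inbE.
have -> : #|[pred x | intb G X x]| = #|intEset G (lset X)|.
  by apply: eq_card => e; rewrite !inE intbE.
have -> : #|[pred x | bdryb G X x]| = #|bdry G (lset X)|.
  by apply: eq_card => v; rewrite inE /= bdrybE.
rewrite -(ltr_nat R) natrD !natrM.
have e2 k : (1 + 1 : R) *+ k = 2%:R * k%:R by rewrite [RHS]mulr_natr mulr2n.
by rewrite !e2.
Qed.

(** Following chosen successors from any element of [S] eventually returns to a visited one; the
    trajectory from there on closes up. *)
Lemma finite_cycle (S : seq E) : S != [::] ->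
  all (fun e => has (fun f => nbstep G e f) S) S ->
  exists c, [/\ c != [::], {subset c <= S} & cycle (nbstep G) c].
Proof.
case: S => [//|e0 S'] _; set S := e0 :: S' => /allP succ.
pose nx e := nth e0 S (find (fun f => nbstep G e f) S).
have nxP e : e \in S -> nx e \in S /\ nbstep G e (nx e).
  by move=> /succ h; split; [rewrite mem_nth // -has_find|exact: nth_find].
have pathP k x : x \in S -> path (nbstep G) x (traject nx (nx x) k) /\ {subset traject nx x k <= S}.
  elim: k x => [|k IH] x xS //=; have [nS st] := nxP x xS; have [pp ss] := IH _ nS.
  by rewrite st pp; split=> // y; rewrite inE => /orP[/eqP ->|/ss].
have iterS k : iter k nx e0 \in S.
  by elim: k => [|k IH] /=; [exact: mem_head|case: (nxP _ IH)].
have /trajectP[i lti it] := looping_order nx e0.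
pose x := iter i nx e0; pose k := (order nx e0 - i).-1.
have kE : order nx e0 = (k.+1 + i)%N by rewrite /k prednK ?subn_gt0 // subnK // ltnW.
have xk : x = iter k.+1 nx x by rewrite /x -iterD -kE.
have [pp ss] := pathP k.+1 x (iterS i).
exists (traject nx x k.+1); split=> //.
have e : rcons (traject nx (nx x) k) x = traject nx (nx x) k.+1.
  by rewrite trajectSr -iterSr -xk.
by rewrite /= e.
Qed.

Lemma forestbE X : forestb G X <-> forest G (lset X).
Proof.
split=> [/allP fb c c0 ic|F].
  apply/negP => cyc; pose L := [seq e <- enum E | e \in c].
  have memL e : (e \in L) = (e \in c) by rewrite mem_filter mem_enum andbT.
  have := fb L; rewrite mem_subs filter_subseq => /(_ isT) /orP[|/negP]; last apply.
    move=> /nilP LE; have [e ec] : exists e, e \in c.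
      by case: (c) c0 => [//|e c'] _; exists e; exact: mem_head.
    by have := memL e; rewrite LE ec.
  apply/allP => e; rewrite memL => ec; rewrite intbE (allP ic e ec) /=.
  apply/hasP; exists (next c e); first by rewrite memL mem_next.
  exact: (next_cycle cyc ec).
apply/allP => S _; case: (eqVneq S [::]) => [->//|S0]; apply/orP; right.
apply/negP => /allP h.
have [|c [c0 cS cyc]] := @finite_cycle S S0.
  by apply/allP => e /h /andP[].
have := F c c0; rewrite cyc => /(_ _) /negP; apply=> //.
by apply/allP => e /cS /h /andP[]; rewrite intbE.
Qed.

Lemma closedbP X D : reflect (forall e, intE G (lset X) e -> (src e \in D) = (tgt e \in D))
  (closedb G X D).
Proof.
apply: (iffP allP) => [h e ie|h e _].
  by have := h e; rewrite mem_enum intbE ie srcinE tgtinE => /(_ isT) /eqP.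
by rewrite intbE srcinE tgtinE; apply/implyP => /h ->.
Qed.

Lemma padspec (c : R) D lam : (lam \in specseq (padmx G c D)) <->
  exists f : V -> C, (exists v, f v != 0) /\ forall v,
    (if v \in D then \sum_(w | w \in D) entry G v w * f w else c%:C * f v) = lam%:C * f v.
Proof.
have [_ ->] := specseqP (padmx G c D).
have hM i j : padmx G c D i j = Num.conj (padmx G c D j i).
  exact: (padmx_herm (g := PGraph G)).
have rowE (f : V -> C) v : \sum_w padentry G c D v w * f w =
    if v \in D then \sum_(w | w \in D) entry G v w * f w else c%:C * f v.
  have pE w : padentry G c D v w = if (v \in D) && (w \in D) then entry G v w else c%:C * (v == w)%:R.
    exact: (padentryE (g := PGraph G)).
  under eq_bigr do rewrite pE.
  case: ifPn => vD /=.
    rewrite [RHS]big_mkcond; apply: eq_bigr => w _; case: ifPn => // wD.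
    by case: eqP wD => [<-|_]; rewrite ?vD // mulr0 mul0r.
  rewrite (bigD1 v) //= eqxx mulr1 big1 ?addr0 // => w; rewrite eq_sym => /negPf ->.
  by rewrite mulr0 mul0r.
split=> [/(hermitian_eigen lam hM)[x [[i xi] xM]]|[f [[v fv] fE]]].
  exists (fun v => x (enum_rank v)); split; first by exists (enum_val i); rewrite enum_valK.
  move=> v; rewrite -(xM (enum_rank v)) (reindex (@enum_rank V)) /=; last first.
    by apply: onW_bij; exact: enum_rank_bij.
  under [RHS]eq_bigr do rewrite mxE !enum_rankK.
  by rewrite (rowE (fun w => x (enum_rank w))).
apply/(hermitian_eigen lam hM); exists (fun i => f (enum_val i)); split.
  by exists (enum_rank v); rewrite enum_rankK.
move=> i; rewrite -fE (reindex (@enum_rank V)) /=; last first.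
  by apply: onW_bij; exact: enum_rank_bij.
under eq_bigr do rewrite mxE enum_rankK.
by rewrite rowE.
Qed.

Lemma eigb_mem D lam :
  eigb G D lam = (lam \in specseq (padmx G 0 D)) && (lam \in specseq (padmx G 1 D)).
Proof.
have hE (s : seq R) : has (fun x => x == lam) s = (lam \in s) by exact: has_pred1.
by congr (_ && _); exact: hE.
Qed.

Lemma eigbE D lam : eigb G D lam <-> eigset G lam (lset D).
Proof.
rewrite eigb_mem.
have jE (f : V -> C) v : (forall w, w \notin D -> f w = 0) ->
    \sum_(w | w \in D) entry G v w * f w = jacobi G f v.
  move=> f0; rewrite jacobi_entry [RHS](bigID (fun w => w \in D)) /= [X in _ + X]big1 ?addr0 //.
  by move=> w /f0 ->; rewrite mulr0.
split=> [/andP[/padspec[f [f0 fE]] /padspec[h [h0 hE]]]|[phi [p0 pD pE]]].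
  (* A padding value different from [lam] is taken, so that the eigenvector vanishes outside [D]. *)
  have [c [k [kn kE cl]]] : exists c, exists k : V -> C, [/\ exists v, k v != 0,
      forall v, (if v \in D then \sum_(w | w \in D) entry G v w * k w else c%:C * k v) = lam%:C * k v
      & c != lam].
    have [l0|l0] := eqVneq 0 lam; last by exists 0, f.
    by exists 1, h; split=> //; rewrite -l0 oner_eq0.
  have kD v : v \notin D -> k v = 0.
    move=> vD; have := kE v; rewrite (negPf vD) => /eqP; rewrite -subr_eq0 -mulrBl mulf_eq0.
    rewrite -rmorphB eq_complex /= eqxx andbT subr_eq0 (negPf cl) /= => /eqP //.
  exists k; split=> //; first by move=> v; rewrite mem_lset; exact: kD.
  move=> u; rewrite mem_lset => uD; have := kE u; rewrite uD jE // jacobi_fin => e.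
  by rewrite rmorphB /= mulrBl addrAC e subrr.
have pD' v : v \notin D -> phi v = 0 by rewrite -mem_lset; exact: pD.
suff key c : lam \in specseq (padmx G c D) by apply/andP; split; apply: key.
apply/padspec; exists phi; split=> // v; case: ifPn => vD; last by rewrite pD' // !mulr0.
rewrite jE // jacobi_fin; apply/eqP; rewrite -subr_eq0 addrAC -mulrBl -rmorphB.
by apply/eqP; apply: pE; rewrite mem_lset.
Qed.

Lemma goodbE lam X : goodb G lam X <-> [/\ forest G (lset X),
  forall u, u \in lset X -> eigset G lam (ccomp G (lset X) u)
  & (#|intEset G (lset X)| + 2 * #|bdry G (lset X)| < 2 * #|lset X|)%N].
Proof.
rewrite /goodb countbE; split=> [/andP[/forestbE F /andP[lt /allP al]]|[F eig lt]].
  split=> // u uX; pose D := [seq v <- enum V | v \in ccomp G (lset X) u].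
  have memD v : (v \in D) = conn G (lset X) u v by rewrite mem_filter mem_enum andbT inE.
  have -> : ccomp G (lset X) u = lset D by apply/finset.setP => v; rewrite mem_lset memD inE.
  apply/eigbE; apply: (implyP (al D _)); first by rewrite mem_subs filter_subseq.
  apply/and3P; split.
  - by apply/nilP => D0; have := memD u; rewrite D0 /conn connect0.
  - by apply/allP => v; rewrite memD inbE -mem_lset => uv; exact: conn_in uv uX.
  - apply/closedbP => e ie; rewrite !memD; have ce := conn_edge ie.
    apply/idP/idP => h; first exact: connect_trans h ce.
    by apply: connect_trans h _; rewrite -/(conn _ _ _ _) conn_sym.
apply/andP; split; first exact/forestbE.
rewrite lt /=; apply/allP => D _; apply/implyP => /and3P[D0 /allP DX /closedbP cl].
have [u uD] : exists u, u \in D by case: (D) D0 => // u s _; exists u; exact: mem_head.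
have XD v : v \in D -> v \in lset X by move=> /DX; rewrite inbE mem_lset.
have subD v : conn G (lset X) u v -> v \in D.
  move=> /connectP[p pp ->]; elim: p u uD pp => [//|w p IH] u uD /= /andP[/existsP[e]].
  by move=> /and3P[ie /eqP se /eqP te] pp; apply: IH => //; rewrite -te -cl // se.
have [phi [p0 pD pE]] := eig u (XD u uD); apply/eigbE; exists phi; split=> //.
  by move=> v; rewrite mem_lset => vD; apply: pD; rewrite inE; apply: contra vD; exact: subD.
move=> v; rewrite mem_lset => vD; have [vc|vc] := boolP (v \in ccomp G (lset X) u).
  exact: pE.
rewrite pD // mulr0 add0r big1 // => e /eqP te.
have [->|w0] := eqVneq (weight e) 0; first by rewrite mul0r.
have [sc|sc] := boolP (src e \in ccomp G (lset X) u); last by rewrite pD // mulr0.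
case/negP: vc; move: sc; rewrite !inE => sc.
have ie : intE G (lset X) e.
  by rewrite /intE w0 (conn_in sc (XD u uD)) te XD.
by rewrite -te; apply: connect_trans sc (conn_edge ie).
Qed.

Lemma outputE lam : (lam \in output G) <-> exists u, 0 < rkp G lam u.
Proof.
rewrite rkp_gt0_criterion; split.
  move=> /flattenP[s /mapP[D _ ->]]; rewrite mem_filter => /andP[/hasP[X _ gX] _].
  by exists (lset X); apply/goodbE.
move=> [S [F eig lt]]; pose X := [seq v <- enum V | v \in S].
have memX v : (v \in X) = (v \in S) by rewrite mem_filter mem_enum andbT.
have XS : lset X = S by apply/finset.setP => v; rewrite mem_lset memX.
have gX : goodb G lam X by apply/goodbE; rewrite XS.
have sX : X \in subs (enum V) by rewrite mem_subs filter_subseq.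
apply/flattenP; exists [seq l <- specseq (padmx G 0 X) | has (goodb G l) (subs (enum V))].
  by apply/mapP; exists X.
rewrite mem_filter; apply/andP; split; first by apply/hasP; exists X.
have /andP[_ /andP[_ /allP /(_ X sX) /implyP imp]] := gX.
(* [X] is closed in itself, so the test for the union [X] already puts [lam] among the
   candidates. *)
suff /imp : ~~ nilp X && (all (inb X) X && closedb G X X).
  by rewrite eigb_mem => /andP[h _]; exact: h.
apply/and3P; split.
- apply/nilP => X0; move: lt; suff -> : S = finset.set0 by rewrite cards0 muln0.
  by apply/finset.setP => v; rewrite -memX X0 !inE.
- by apply/allP => v vX; rewrite inbE.
- by apply/closedbP => e; rewrite /intE !mem_lset => /and3P[_ -> ->].
Qed.

End Correctness.

Lemma program_exists (R : realType) : exists p : prog, computes_point_spectrum R p.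
Proof.
have [p hp] := cp_output R; exists p => V E G cG.
exists (output G); split; first exact: (hp (PGraph G) tt [::]).
move=> r; apply/seteqP; split=> lam /=.
  by move=> /(point_spectrum_rkp r lam cG) /outputE.
by move=> /outputE /(point_spectrum_rkp r lam cG).
Qed.

Theorem corollary3p4 (R : realType) :
  (forall (V E : finType) (G : wgraph R V E) (r : V),
     gconnected G ->
     (forall e, weight G e != 0) ->
     forall Phi : (R -> R) -> (uc_vert G r -> R[i]) -> uc_vert G r -> R[i],
     borel_calculus (jacobi (universal_cover G r)) Phi ->
     forall mu : V -> {measure set (measurableTypeR R) -> \bar R},
     spectral_measures Phi mu ->
     forall lam : R,
     density_of_states mu [set lam] =
       (#|V|%:R^-1 *
        (\max_(X in aomoto G lam) (cc G X - #|boundary G X|))%N%:R)%:E)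
  /\ exists p : prog, computes_point_spectrum R p.
Proof. by split; [exact: density_atom|exact: program_exists]. Qed.
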